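(* Let $p$ be a prime, $N\in\mathbb Z$, $\alpha>0$, $\mu>0$. The resolvent $(A_N+\mu I)^{-1}$ of the operator $A_N$ on $L^1(B_N)$ admits the representation $$\left((A_N+\mu I)^{-1}u\right)(x)=\int_{B_N}K_\mu(x-\xi)u(\xi)\,d\xi+\mu^{-1}p^{-N}\int_{B_N}u(\xi)\,d\xi,\qquad u\in L^1(B_N),$$ where for $0\ne x\in B_N$, $|x|_p=p^m$, $$K_\mu(x)=\int_{p^{-N+1}\le|\eta|_p\le p^{-m+1}}\frac{\chi(\eta x)}{|\eta|_p^\alpha-\lambda+\mu}\,d\eta .$$ If $\alpha>1$, then for any $x\in B_N$, $$K_\mu(x)=\int_{|\eta|_p\ge p^{-N+1}}\frac{\chi(\eta x)}{|\eta|_p^\alpha-\lambda+\mu}\,d\eta .$$ The kernel $K_\mu$ is continuous for $x\ne0$ and belongs to $L^1(B_N)$. Moreover: - if $\alpha>1$, then $K_\mu$ is continuous on $B_N$; - if $\alpha=1$, then there is a constant $C>0$ such that $|K_\mu(x)|\le C\,\bigl|\log|x|_p\bigr|$ for all $x\in B_N$, $x\ne 0$; - if $\alpha<1$, then there is a constant $C>0$ such that $|K_\mu(x)|\le C|x|_p^{\alpha-1}$ for all $x\in B_N$, $x\neq 0$.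
   Context: $\mathbb Q_p$ is the field of $p$-adic numbers with absolute value $|\cdot|_p$, and $dx$ is the Haar measure on its additive group with $\int_{\mathbb Z_p}dx=1$, where $\mathbb Z_p=\{x\in\mathbb Q_p:\ |x|_p\le 1\}$. $\chi(x)=\exp(2\pi i\{x\}_p)$, with $\{x\}_p$ the $p$-adic fractional part, is the standard additive character of $\mathbb Q_p$. $B_N=\{x\in\mathbb Q_p:\ |x|_p\le p^N\}$, and $L^1(B_N)$ is taken with respect to $dx$. $\lambda=\dfrac{p-1}{p^{\alpha+1}-1}\,p^{\alpha(1-N)}$. For $t>0$ let $Z(t,x)=\int_{\mathbb Q_p}\chi(\xi x)e^{-t|\xi|_p^\alpha}\,d\xi$, $x\in\mathbb Q_p$, and, for $x\in B_N$, $$Z_N(t,x)=e^{\lambda t}Z(t,x)+c(t),\qquad c(t)=p^{-N}-p^{-N}(1-p^{-1})e^{\lambda t}\sum_{n=0}^\infty\frac{(-1)^n}{n!}t^n\frac{p^{-N\alpha n}}{1-p^{-\alpha n-1}}.$$ It is known that the operators $$(T_N(t)u)(x)=\int_{B_N}Z_N(t,x-y)u(y)\,dy,\quad t>0,$$ with $T_N(0)=I$, form a strongly continuous contraction semigroup on $L^1(B_N)$. The operator $A_N$ is its generator with the sign convention $T_N(t)=e^{-tA_N}$ (so $-A_N$ is the infinitesimal generator in the usual convention). Thus, for $\mu>0$, $$\left((A_N+\mu I)^{-1}u\right)(x)=\int_0^\infty e^{-\mu t}\,dt\int_{B_N}Z_N(t,x-\xi)u(\xi)\,d\xi,\quad u\in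 L^1(B_N).$$
   Formalization: For α = 1 the bound |K_μ(x)| ≤ C|log|x|_p| is stated only for x ≠ 0 in B_N with |x|_p ≠ 1: at |x|_p = 1 the logarithm is 0, but K_μ(x) need not vanish (for N = 0 it equals −1/(p−λ+μ)). *)

(* Defs.v *)
From HB Require Import structures.
From mathcomp Require Import all_boot all_order all_algebra.
From mathcomp Require Import fraction complex.
From mathcomp Require Import all_classical all_reals all_analysis.

Set Implicit Arguments.
Unset Strict Implicit.
Unset Printing Implicit Defensive.

Import Order.TTheory GRing.Theory Num.Theory.
Import numFieldNormedType.Exports.

Local Open Scope ring_scope.
Local Open Scope classical_set_scope.

(* Z_p is the inverse limit of the rings Z/p^(n+1), n >= 0, and Q_p is its    *)
(* field of fractions.                                                        *)
Definition padic_coherent p (z : forall n, 'Z_(p ^ n.+1)) : Prop :=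
  forall n, (z n.+1 : nat) = z n %[mod p ^ n.+1].

Definition padic_int (p : nat) (p_pr : prime p) : Type :=
  {z : forall n, 'Z_(p ^ n.+1) | padic_coherent z}.

Section PadicIntegers.
Variables (p : nat) (p_pr : prime p).
Local Notation Zp := (padic_int p_pr).

HB.instance Definition _ := gen_eqMixin Zp.
HB.instance Definition _ := gen_choiceMixin Zp.

Let pX_gt1 n : (1 < p ^ n.+1)%N.
Proof. by rewrite -(exp1n n.+1) ltn_exp2r// prime_gt1. Qed.

Let Zp_truncE n : (Zp_trunc (p ^ n.+1)).+2 = (p ^ n.+1)%N.
Proof. exact: Zp_cast. Qed.

Let modX n a : ((a %% p ^ n.+2) = a %[mod p ^ n.+1])%N.
Proof. by rewrite modn_dvdm// dvdn_exp2l. Qed.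

Let coherentC (f : nat -> nat) :
    (forall n, f n.+1 = f n %[mod p ^ n.+1]) ->
  @padic_coherent p (fun n => inZp (f n)).
Proof. by move=> fc n /=; rewrite !Zp_truncE modX modn_mod fc. Qed.

Definition padic_int_of (f : nat -> nat)
    (fc : forall n, f n.+1 = f n %[mod p ^ n.+1]) : Zp :=
  exist _ _ (coherentC fc).

Lemma padic_int_eq (x y : Zp) : (forall n, sval x n = sval y n) -> x = y.
Proof.
move: x y => [x xc] [y yc] /= xy.
by apply: eq_exist; apply: functional_extensionality_dep.
Qed.

Let add_coherent (x y : Zp) n :
  (sval x n.+1 + sval y n.+1 = sval x n + sval y n %[mod p ^ n.+1])%N.
Proof. by rewrite -modnDm (svalP x n) (svalP y n) modnDm. Qed.

Let mul_coherent (x y : Zp) n :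
  (sval x n.+1 * sval y n.+1 = sval x n * sval y n %[mod p ^ n.+1])%N.
Proof. by rewrite -modnMm (svalP x n) (svalP y n) modnMm. Qed.

Let val_le (x : Zp) n : (sval x n <= p ^ n.+1)%N.
Proof. by have := ltnW (ltn_ord (sval x n)); rewrite {2}Zp_truncE. Qed.

Let modn_sub q1 q a b : (q %| q1)%N -> a = b %[mod q] ->
  (a <= q1)%N -> (b <= q)%N -> (q1 - a = q - b %[mod q])%N.
Proof.
move=> /eqP qq1 ab aq bq; apply/eqP; rewrite -(eqn_modDr a) subnK//.
by rewrite -(modnDmr (q - b)) ab modnDmr subnK// qq1 modnn.
Qed.

Let opp_coherent (x : Zp) n :
  (p ^ n.+2 - sval x n.+1 = p ^ n.+1 - sval x n %[mod p ^ n.+1])%N.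
Proof.
by apply: modn_sub; [exact/dvdn_exp2l|exact: (svalP x n)|exact: val_le|exact: val_le].
Qed.

Definition padic_int_add x y := padic_int_of (add_coherent x y).
Definition padic_int_mul x y := padic_int_of (mul_coherent x y).
Definition padic_int_opp x := padic_int_of (opp_coherent x).
Definition padic_int_nat a := @padic_int_of (fun=> a) (fun=> erefl).

Let addE x y n : sval (padic_int_add x y) n = sval x n + sval y n.
Proof. by apply: val_inj. Qed.

Let mulE x y n : sval (padic_int_mul x y) n = sval x n * sval y n.
Proof. by apply: val_inj. Qed.

Let oppE x n : sval (padic_int_opp x) n = - sval x n.
Proof.
by apply: val_inj => /=; congr ((_ - _) %% _)%N; rewrite Zp_truncE.
Qed.

Let natE a n : sval (padic_int_nat a) n = a%:R.
Proof. by rewrite /= -Zp_nat. Qed.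

Fact padic_int_addA : associative padic_int_add.
Proof. by move=> x y z; apply: padic_int_eq => n; rewrite !addE addrA. Qed.
Fact padic_int_addC : commutative padic_int_add.
Proof. by move=> x y; apply: padic_int_eq => n; rewrite !addE addrC. Qed.
Fact padic_int_add0 : left_id (padic_int_nat 0) padic_int_add.
Proof. by move=> x; apply: padic_int_eq => n; rewrite addE natE add0r. Qed.
Fact padic_int_addN : left_inverse (padic_int_nat 0) padic_int_opp padic_int_add.
Proof.
by move=> x; apply: padic_int_eq => n; rewrite addE oppE natE addNr.
Qed.

HB.instance Definition _ := GRing.isZmodule.Build Zp
  padic_int_addA padic_int_addC padic_int_add0 padic_int_addN.

Fact padic_int_mulA : associative padic_int_mul.
Proof. by move=> x y z; apply: padic_int_eq => n; rewrite !mulE mulrA. Qed.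
Fact padic_int_mulC : commutative padic_int_mul.
Proof. by move=> x y; apply: padic_int_eq => n; rewrite !mulE mulrC. Qed.
Fact padic_int_mul1 : left_id (padic_int_nat 1) padic_int_mul.
Proof. by move=> x; apply: padic_int_eq => n; rewrite mulE natE mul1r. Qed.
Fact padic_int_mulDl : left_distributive padic_int_mul +%R.
Proof.
by move=> x y z; apply: padic_int_eq => n; rewrite addE !mulE addE mulrDl.
Qed.
Fact padic_int_1neq0 : padic_int_nat 1 != 0.
Proof.
apply/eqP => /(congr1 (fun z : Zp => sval z 0%N)).
by rewrite !natE => /eqP; rewrite oner_eq0.
Qed.

HB.instance Definition _ := GRing.Zmodule_isComNzRing.Build Zp
  padic_int_mulA padic_int_mulC padic_int_mul1 padic_int_mulDl padic_int_1neq0.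

Definition padic_int_unit : pred Zp := fun x => `[< exists y, y * x = 1 >].

Definition padic_int_inv (x : Zp) : Zp :=
  xget x [set y | y * x = 1].

Fact padic_int_mulV : {in padic_int_unit, left_inverse 1 padic_int_inv *%R}.
Proof.
move=> x /asboolP[y yx1]; rewrite /padic_int_inv.
by case: xgetP => [z _ //|/(_ y)].
Qed.
Fact padic_int_unitPl (x y : Zp) : y * x = 1 -> padic_int_unit x.
Proof. by move=> yx1; apply/asboolP; exists y. Qed.
Fact padic_int_inv_out : {in [predC padic_int_unit], padic_int_inv =1 id}.
Proof.
move=> x /asboolPn xN; rewrite /padic_int_inv.
by case: xgetP => // z _ zx1; case: xN; exists z.
Qed.

HB.instance Definition _ := GRing.ComNzRing_hasMulInverse.Build Zp
  padic_int_mulV padic_int_unitPl padic_int_inv_out.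

Let coherent_le (x : Zp) i n : (i <= n)%N ->
  (sval x n = sval x i %[mod p ^ i.+1])%N.
Proof.
elim: n => [|n IH]; first by rewrite leqn0 => /eqP ->.
rewrite leq_eqVlt => /predU1P[-> //|]; rewrite ltnS => lein.
rewrite -(IH lein) -(@modn_dvdm (p ^ n.+1) (sval x n.+1)) ?dvdn_exp2l//.
by rewrite (svalP x n) modn_dvdm// dvdn_exp2l.
Qed.

Let neq0_dvd (x : Zp) : x != 0 ->
  exists i, forall n, (i <= n)%N -> ~~ (p ^ i.+1 %| sval x n)%N.
Proof.
move=> x0; have [i xi] : exists i, sval x i != 0.
  apply: contrapT => xN; move/eqP: x0; apply; apply: padic_int_eq => n.
  by rewrite natE; apply/eqP; apply: contrapT => xn; apply: xN; exists n; apply/negP.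
exists i => n lein; apply: contra xi => xn; apply/eqP/val_inj => /=.
rewrite -[LHS](@modn_small _ (p ^ i.+1)); last first.
  by rewrite -[X in (_ < X)%N]Zp_truncE ltn_ord.
by rewrite -(coherent_le x lein) (eqP xn).
Qed.

Fact padic_int_idomain : GRing.integral_domain_axiom Zp.
Proof.
move=> x y xy0; apply: contrapT => /negP; rewrite negb_or => /andP[].
move=> /neq0_dvd[i xi] /neq0_dvd[j yj].
set n := (i + j).+1.
have xn : ~~ (p ^ i.+1 %| sval x n)%N by apply: xi; rewrite /n ltnW// ltnS leq_addr.
have yn : ~~ (p ^ j.+1 %| sval y n)%N by apply: yj; rewrite /n ltnW// ltnS leq_addl.
have x_gt0 : (0 < sval x n)%N by case: posnP xn => // ->; rewrite dvdn0.
have y_gt0 : (0 < sval y n)%N by case: posnP yn => // ->; rewrite dvdn0.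
have : (p ^ n.+1 %| sval x n * sval y n)%N.
  have := congr1 (fun z : Zp => val (sval z n)) xy0.
  by rewrite /= mod0n /dvdn {3}Zp_truncE => ->.
rewrite pfactor_dvdn ?muln_gt0 ?x_gt0// lognM//.
move: xn yn; rewrite !pfactor_dvdn// -!ltnNge !ltnS => xn yn.
by rewrite /n leqNgt ltnS (leq_trans (leq_add xn yn))// leqnSn.
Qed.

HB.instance Definition _ := GRing.ComUnitRing_isIntegral.Build Zp
  padic_int_idomain.

End PadicIntegers.

Definition padic (p : nat) (p_pr : prime p) : Type := {fraction (padic_int p_pr)}.

HB.instance Definition _ p (p_pr : prime p) := GRing.Field.on (padic p_pr).
HB.instance Definition _ p (p_pr : prime p) := isPointed.Build (padic p_pr) 0.

Section Padic.
Variables (p : nat) (p_pr : prime p).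
Local Notation Qp := (padic p_pr).

(* Every nonzero x is uniquely p^k u with k an integer and u a unit of Z_p;   *)
(* padic_ord x is that k (and 0 by default at x = 0).                         *)
Definition padic_ord (x : Qp) : int :=
  xget 0 [set k : int | exists2 u : padic_int p_pr,
    u \is a GRing.unit & x = p%:R ^ k * tofrac u].

Definition padic_norm {F : numFieldType} (x : Qp) : F :=
  if x == 0 then 0 else p%:R ^ (- padic_ord x).

Definition padic_ball (k : int) : set Qp :=
  [set x | (padic_norm x : rat) <= p%:R ^ k].

Definition padic_annulus (j k : int) : set Qp :=
  [set x | p%:R ^ j <= (padic_norm x : rat) <= p%:R ^ k].

Definition padic_co_ball (j : int) : set Qp :=
  [set x | p%:R ^ j <= (padic_norm x : rat)].

Definition padic_open (A : set Qp) : Prop :=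
  forall x, A x -> exists k, forall z, padic_ball k z -> A (x + z).

Fact padic_openT : padic_open setT.
Proof. by move=> x _; exists 0. Qed.

Fact padic_openI : setI_closed padic_open.
Proof.
move=> A B Ao Bo x [/Ao[j Aj] /Bo[k Bk]]; exists (Order.min j k) => z /= zjk.
have p1 : 1 <= p%:R :> rat by rewrite ler1n prime_gt0.
split; [apply: Aj|apply: Bk]; apply: (le_trans zjk); apply: ler_weXz2l => //.
  by rewrite ge_min lexx.
by rewrite ge_min lexx orbT.
Qed.

Fact padic_open_bigU (I : Type) (f : I -> set Qp) :
  (forall i, padic_open (f i)) -> padic_open (\bigcup_i f i).
Proof.
by move=> fo x [i _ /fo[k fk]]; exists k => z /fk fz; exists i.
Qed.

HB.instance Definition _ := isOpenTopological.Build Qp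
  padic_openT padic_openI padic_open_bigU.

HB.instance Definition _ := Measurable.copy Qp
  (g_sigma_algebraType (@open Qp)).

(* {x}_p is the element of Z[1/p] in [0, 1[ that is congruent to x mod Z_p.   *)
Definition padic_frac (x : Qp) : rat :=
  xget 0 [set r : rat | [/\ 0 <= r < 1,
    (exists n : nat, r * p%:R ^+ n \is a Num.int) &
    padic_ball 0 (x - ratr r)]].

Definition padic_char {R : realType} (x : Qp) : R[i] :=
  let theta : R := 2 * pi * ratr (padic_frac x) in
  (cos theta +i* sin theta)%C.

Definition is_haar {R : realType} (haar : {measure set Qp -> \bar R}) : Prop :=
  (forall (a : Qp) (A : set Qp), measurable A ->
     haar [set a + x | x in A] = haar A) /\
  haar (padic_ball 0) = 1%E.

End Padic.

Section ComplexIntegral.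
Context {d : measure_display} {T : measurableType d} {R : realType}.
Variables (nu : {measure set T -> \bar R}) (D : set T).

Definition cintegrable (f : T -> R[i]) : Prop :=
  nu.-integrable D (fun x => (complex.Re (f x))%:E) /\
  nu.-integrable D (fun x => (complex.Im (f x))%:E).

Definition cintegral (f : T -> R[i]) : R[i] :=
  (Rintegral nu D (fun x => complex.Re (f x)) +i*
   Rintegral nu D (fun x => complex.Im (f x)))%C.

Definition cnorm1 (f : T -> R[i]) : \bar R :=
  (\int[nu]_(x in D) (Normc.normc (f x))%:E)%E.

(* For a semigroup S on L^1(D), the graph of the operator A with              *)
(* S(t) = exp(-t A): u is in the domain of A and A u = v.                     *)
Definition neg_generator (S : R -> (T -> R[i]) -> (T -> R[i]))
    (u v : T -> R[i]) : Prop :=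
  [/\ cintegrable u, cintegrable v &
    cnorm1 (fun x => (t^-1)%:C%C * (u x - S t u x) - v x) @[t --> 0^'+]
      --> 0%E].

(* w = (A + mu I)^-1 u, for an operator A on L^1(D) given by its graph; the   *)
(* elements of L^1(D) are functions up to almost everywhere equality.         *)
Definition is_resolvent (A : (T -> R[i]) -> (T -> R[i]) -> Prop) (mu : R)
    (u w : T -> R[i]) : Prop :=
  let solution f := exists v, A f v /\
    ae_eq nu D (fun x => v x + mu%:C%C * f x) u in
  solution w /\ forall w', solution w' -> ae_eq nu D w' w.

End ComplexIntegral.

Section Operator.
Context {R : realType} {p : nat} {p_pr : prime p}.
Local Notation Qp := (padic p_pr).
Variables (haar : {measure set Qp -> \bar R}) (N : int) (alpha : R).

Definition lambda : R :=
  (p%:R - 1) / (p%:R `^ (alpha + 1) - 1) * p%:R `^ (alpha * (1 - N%:~R)).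

Definition heat_kernel (t : R) (x : Qp) : R[i] :=
  cintegral haar setT (fun xi =>
    padic_char (xi * x) * (expR (- t * padic_norm xi `^ alpha))%:C%C).

Definition heat_const (t : R) : R :=
  p%:R ^ (- N) - p%:R ^ (- N) * (1 - p%:R^-1) * expR (lambda * t) *
    limn (series (fun n : nat => (-1) ^+ n / n`!%:R * t ^+ n *
      (p%:R `^ (- N%:~R * alpha * n%:R) / (1 - p%:R `^ (- alpha * n%:R - 1))))).

Definition heat_kernelN (t : R) (x : Qp) : R[i] :=
  (expR (lambda * t))%:C%C * heat_kernel t x + (heat_const t)%:C%C.

Definition heat_semigroup (t : R) (u : Qp -> R[i]) (x : Qp) : R[i] :=
  if t == 0 then u x
  else cintegral haar (padic_ball N) (fun y => heat_kernelN t (x - y) * u y).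

Definition opA : (Qp -> R[i]) -> (Qp -> R[i]) -> Prop :=
  neg_generator haar (padic_ball N) heat_semigroup.

Definition resolvent_integrand (mu : R) (x eta : Qp) : R[i] :=
  padic_char (eta * x) * ((padic_norm eta `^ alpha - lambda + mu)^-1)%:C%C.

(* For x != 0 one has |x|_p = p^m with m = - padic_ord x. At x = 0 the kernel *)
(* is only meaningful (the integral only converges) for alpha > 1.            *)
Definition resolvent_kernel (mu : R) (x : Qp) : R[i] :=
  if x == 0 then cintegral haar (padic_co_ball (1 - N)) (resolvent_integrand mu x)
  else let m := - padic_ord x in
    cintegral haar (padic_annulus (1 - N) (1 - m)) (resolvent_integrand mu x).

End Operator.

(* Main.v *)
Require Import Defs.
From HB Require Import structures.
From mathcomp Require Import all_boot all_order all_algebra.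
From mathcomp Require Import zify ring lra.
From mathcomp Require Import fraction complex.
From mathcomp Require Import all_classical all_reals all_analysis.
From mathcomp Require Import measurable_realfun.

Set Implicit Arguments.
Unset Strict Implicit.
Unset Printing Implicit Defensive.

Import Order.TTheory GRing.Theory Num.Theory.
Import numFieldNormedType.Exports.

Local Open Scope ring_scope.
Local Open Scope classical_set_scope.

(* On B_N let E_n f be the average of f over the cosets of B_{N-n}, i.e. the
   convolution with the normalised indicator phi_n of B_{N-n}, and put
   lam_0 = 0, lam_n = p^(alpha (n - N)) - lambda for n >= 1.  Evaluating the
   oscillatory integrals sphere by sphere shows that for 0 <> x in B_N

     Z_N(t, x) = sum_n (e^(- t lam_n) - e^(- t lam_(n+1))) phi_n(x),
     K_mu(x) + mu^-1 p^-N = sum_n ((mu + lam_n)^-1 - (mu + lam_(n+1))^-1) phi_n(x),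

   which are finite sums with nonnegative coefficients; c(t) is exactly what
   makes the coefficient 1 appear at n = 0.  So both operators act as sums of
   the commuting averages E_n, with E_i E_j = E_min(i, j), and L^1 estimates
   follow from ||E_n f|| <= ||f|| and E_n f -> f.  For w = (K_mu + mu^-1 p^-N) * f,
   Abel summation turns (w - T_N(t) w) / t + mu w into the convex combination of
   the E_n f with weights q_n - q_(n+1), where
   q_n = (mu + (1 - e^(- t lam_n)) / t) / (mu + lam_n); since q_n -> 1 as t -> 0,
   the mass escapes to n -> oo, and (A_N + mu) w = f.  Uniqueness is the
   contractivity of T_N(t).  The sum for K_mu also gives its continuity and its
   growth at 0. *)

(** * p-adic integers and p-adic numbers *)

(** Two obstacles shape the details. First, a convolution may diverge on a null set of base points,
    where the integral takes the value 0. So the linearity of T_N(t), or moving the constant mu^-1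
    p^-N inside the convolution, is available only almost everywhere, and measurability has to be
    proved apart from the estimates. Second, T_N(t) w is a double infinite sum. Both kernels are
    therefore cut after M averages, where Abel summation is exact. The tail of a sum of (r_n -
    r_(n+1)) E_n has norm at most r_M, because its weights telescope. The resulting errors contain
    1/t, which is harmless since M is chosen after t. The weights q_n - q_(n+1) are nonnegative
    because g(l) = (1 - e^(-tl))/t is 1-Lipschitz and concave with g(0) = 0. Positivity of lam_1
    reduces to (p-1)/(p^(alpha+1)-1) < 1. The series H in c(t) satisfies H(s) = e^(-s) + p^-1 H(s
    p^-alpha), which is the recursion obtained by removing the outer sphere from a ball; this
    identifies c(t) with an integral over low frequencies. *)

Section PadicAlgebra.
Variables (p : nat) (p_pr : prime p).
Local Notation Zp := (padic_int p_pr).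
Local Notation Qp := (padic p_pr).

Let p_gt0 : (0 < p)%N. Proof. exact: prime_gt0. Qed.
Let p_gt1 : (1 < p)%N. Proof. exact: prime_gt1. Qed.

Let Zp_truncE n : (Zp_trunc (p ^ n.+1)).+2 = (p ^ n.+1)%N.
Proof. by apply: Zp_cast; rewrite -(exp1n n.+1) ltn_exp2r. Qed.

Lemma padic_int_ltn (a : Zp) n : (sval a n < p ^ n.+1)%N.
Proof. by rewrite -[X in (_ < X)%N]Zp_truncE ltn_ord. Qed.

Lemma padic_int_valM (a b : Zp) n :
  (sval (a * b) n : nat) = ((sval a n * sval b n) %% p ^ n.+1)%N.
Proof. exact: (congr1 (modn _) (Zp_truncE n)). Qed.

Lemma padic_int_valD (a b : Zp) n :
  (sval (a + b) n : nat) = ((sval a n + sval b n) %% p ^ n.+1)%N.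
Proof. exact: (congr1 (modn _) (Zp_truncE n)). Qed.

Lemma padic_int_val0 n : (sval (0 : Zp) n : nat) = 0%N.
Proof. by rewrite /= mod0n. Qed.

Lemma padic_int_val_nat k n :
  (sval (k%:R : Zp) n : nat) = (k %% p ^ n.+1)%N.
Proof.
elim: k => [|k IH]; first by rewrite mulr0n padic_int_val0 mod0n.
by rewrite -natr1 padic_int_valD IH -[1]/(padic_int_nat p_pr 1) /= (congr1 (modn 1) (Zp_truncE n)) modnDm addn1.
Qed.

Lemma padic_int_ofE (f : nat -> nat)
    (fc : forall n, f n.+1 = f n %[mod p ^ n.+1]) n :
  (sval (padic_int_of p_pr fc) n : nat) = (f n %% p ^ n.+1)%N.
Proof. exact: (congr1 (modn _) (Zp_truncE n)). Qed.

Lemma padic_int_valP (a b : Zp) :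
  (forall n, (sval a n : nat) = sval b n) -> a = b.
Proof. by move=> ab; apply: padic_int_eq => n; apply: val_inj; exact: ab. Qed.

Lemma padic_int_val_mod (a : Zp) i n : (i <= n)%N ->
  (sval a n %% p ^ i.+1)%N = sval a i.
Proof.
move=> /subnKC <-; elim: (n - i)%N => [|k IH].
  by rewrite addn0 modn_small// padic_int_ltn.
rewrite addnS -(@modn_dvdm (p ^ (i + k).+1)) ?dvdn_exp2l ?ltnS ?leq_addr//.
by rewrite (svalP a) modn_dvdm ?dvdn_exp2l ?ltnS ?leq_addr.
Qed.

Lemma padic_int_neq0 (a : Zp) : a != 0 -> exists n, (sval a n : nat) != 0%N.
Proof.
move=> a0; apply: contrapT => aN; move/eqP: a0; apply; apply: padic_int_valP => n.
by rewrite padic_int_val0; apply/eqP; apply: contrapT => /negP an; apply: aN; exists n.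
Qed.

(** The quotient is built level by level: its residue modulo p^(n+1) is the residue of [a] at level
    n+k+1 divided by p^(k+1). The shift of level makes this division exact and the result
    coherent. *)
Lemma padic_int_dvd (a : Zp) k :
  (sval a k : nat) = 0%N -> exists b : Zp, a = p%:R ^+ k.+1 * b.
Proof.
move=> ak0.
have dvd n : (p ^ k.+1 %| sval a (n + k.+1))%N.
  by rewrite /dvdn padic_int_val_mod ?ak0// (leq_trans _ (leq_addl _ _)).
pose f n := (sval a (n + k.+1)%N %/ p ^ k.+1)%N.
have pk : (0 < p ^ k.+1)%N by rewrite expn_gt0 p_gt0.
have fE n : (f n * p ^ k.+1)%N = sval a (n + k.+1)%N by rewrite divnK.
have fc n : f n.+1 = f n %[mod p ^ n.+1].
  apply/eqP; rewrite -(eqn_pmul2r pk) !muln_modl !fE addSn -expnD.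
  by apply/eqP; exact: (svalP a (n + k.+1)%N).
exists (padic_int_of p_pr fc); apply: padic_int_valP => n.
rewrite -natrX padic_int_valM padic_int_val_nat padic_int_ofE modnMm mulnC fE.
by rewrite padic_int_val_mod ?leq_addr.
Qed.

(** Invertibility modulo p lifts to every level: Bezout coefficients invert [a] modulo each p^(n+1),
    and uniqueness of inverses makes them coherent. *)
Lemma padic_int_unit_val0 (a : Zp) :
  (a \is a GRing.unit) = ((sval a 0%N : nat) != 0%N).
Proof.
apply/idP/idP => [/unitrPr[b ab1]|a0].
  apply/eqP => a0; have := congr1 (fun z : Zp => sval z 0%N : nat) ab1.
  by rewrite padic_int_valM a0 mul0n mod0n -[1]/(1%:R) padic_int_val_nat modn_small.
have an_gt0 n : (0 < sval a n)%N.
  rewrite lt0n; apply: contra a0 => /eqP an0.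
  by rewrite -(padic_int_val_mod a (leq0n n)) an0 mod0n.
have cop n : coprime (sval a n) (p ^ n.+1).
  rewrite coprime_sym coprime_pexpl// prime_coprime//.
  apply: contra a0; rewrite -[X in (X %| _)%N]expn1 /dvdn.
  by rewrite (padic_int_val_mod a (leq0n n)).
pose f n := (egcdn (sval a n) (p ^ n.+1)).1.
have fE n : (f n * sval a n = 1 %[mod p ^ n.+1])%N.
  rewrite /f; case: egcdnP => //= u v + _; rewrite (eqP (cop n)) => ->.
  by rewrite modnMDl.
have fc n : f n.+1 = f n %[mod p ^ n.+1].
  (* Modulo p^(n+1): f_(n+1) = f_(n+1) (f_n a_n) = (f_(n+1) a_(n+1)) f_n = f_n. *)
  rewrite -[f n.+1]muln1 -modnMmr -(fE n) modnMmr.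
  rewrite [(f n * _)%N]mulnC mulnA -modnMml -modnMmr.
  rewrite -(padic_int_val_mod a (leqnSn n)) modnMmr [X in (X %% _ * _)%N]mulnC.
  rewrite modnMml -mulnA modnMml mulnA -modnMml -[in RHS](mul1n (f n)) -[in RHS]modnMml.
  congr ((_ * _) %% _)%N; rewrite mulnC.
  by rewrite -(@modn_dvdm (p ^ n.+2)) ?dvdn_exp2l// fE modn_dvdm// dvdn_exp2l.
apply/unitrPr; exists (padic_int_of p_pr fc); apply: padic_int_valP => n.
rewrite padic_int_valM padic_int_ofE modnMmr mulnC fE.
by rewrite -[1]/(1%:R) padic_int_val_nat.
Qed.

Lemma padic_int_natp_neq0 : (p%:R : Zp) != 0.
Proof.
apply/eqP => /(congr1 (fun z : Zp => sval z 1%N : nat)).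
rewrite padic_int_val0 padic_int_val_nat modn_small//.
  by move=> p0; move: p_gt0; rewrite p0.
by rewrite -{1}(expn1 p) ltn_exp2l.
Qed.

Lemma padic_natp_neq0 : (p%:R : Qp) != 0.
Proof.
have := padic_int_natp_neq0; rewrite -tofrac_eq0.
by rewrite rmorph_nat.
Qed.

(** The exponent is the least level at which the residue of [a] is nonzero. Vanishing one level
    earlier gives the power of p; a cofactor divisible by p would contradict the nonzero residue. *)
Lemma padic_int_decomp (a : Zp) : a != 0 ->
  exists k : nat, exists2 u : Zp, u \is a GRing.unit & a = p%:R ^+ k * u.
Proof.
move=> /padic_int_neq0 aN; case: (ex_minnP aN) => -[|k] ak0 kmin.
  by exists 0%N, a; rewrite ?padic_int_unit_val0// expr0 mul1r.
have [|b ab] := @padic_int_dvd a k.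
  by apply/eqP; apply: contraT => /kmin; rewrite ltnn.
exists k.+1, b => //; rewrite padic_int_unit_val0; apply: contra ak0 => /eqP b0.
rewrite ab -natrX padic_int_valM padic_int_val_nat modnMml.
have [//|c ->] := @padic_int_dvd b 0%N.
rewrite -natrX padic_int_valM padic_int_val_nat modnMml modnMmr.
by rewrite mulnA -expnD addn1 modnMr.
Qed.

Lemma padic_fracP (x : Qp) : exists a b : Zp, b != 0 /\ x = tofrac a / tofrac b.
Proof.
suff [a [b [b0 e]]] : exists a b : Zp, b != 0 /\ (x : {fraction Zp}) * tofrac b = tofrac a.
  by exists a, b; split=> //; rewrite -e mulfK// tofrac_eq0.
elim/quotW: (x : {fraction Zp}) => r; exists (frac r).1, (frac r).2.
split; first exact: denom_ratioP.
unlock FracField.tofrac; rewrite -[LHS]FracField.pi_mul.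
apply/eqP; rewrite /FracField.mulf FracField.equivf_def.
by rewrite !numden_Ratio ?mulf_neq0 ?oner_neq0 ?denom_ratioP// !mulr1 mulrC.
Qed.
End PadicAlgebra.

(** * Valuation, balls and the ultrametric inequality *)

Section PadicValuation.
Variables (p : nat) (p_pr : prime p).
Local Notation Zp := (padic_int p_pr).
Local Notation Qp := (padic p_pr).
Implicit Types (x y z : Qp) (j k l : int).

Let p0 : (p%:R : Qp) != 0 := padic_natp_neq0 p_pr.
Lemma padic_decomp x : x != 0 ->
  exists k : int, exists2 u : Zp, u \is a GRing.unit & x = p%:R ^ k * tofrac u.
Proof.
have [a [b [b0 ->]]] := padic_fracP x => ab0.
have a0 : a != 0 by apply: contraNneq ab0 => ->; rewrite tofrac0 mul0r.
have [i [u uu ->]] := padic_int_decomp a0.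
have [j [v vu ->]] := padic_int_decomp b0.
exists (i%:Z - j%:Z), (u / v); first by rewrite unitrM uu unitrV.
rewrite !tofracM !tofracXn !rmorph_nat expfzDr// -exprnN -exprnP.
rewrite rmorphV//= invfM -!mulrA; congr (_ * _).
by rewrite mulrCA.
Qed.

Lemma padic_decomp_inj j k (u v : Zp) :
  u \is a GRing.unit -> v \is a GRing.unit ->
  p%:R ^ j * tofrac u = p%:R ^ k * tofrac v :> Qp -> j = k.
Proof.
wlog jk : j k u v / j <= k => [W uu vu e|uu vu e].
  by case/orP: (le_total j k) => h; [exact: (W _ _ _ _ h uu vu)|
    exact: esym (W _ _ _ _ h vu uu (esym e))].
have [n kn] : exists n : nat, k = j + n%:Z.
  by exists `|(k - j)%R|%N; rewrite gez0_abs ?subr_ge0// addrC subrK.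
move: e; rewrite kn expfzDr// -mulrA => /(mulfI (expfz_neq0 _ p0)) e.
case: n => [|n] in kn e *; first by rewrite addr0.
have : u = p%:R ^+ n.+1 * v.
  by apply/eqP; rewrite -tofrac_eq tofracM tofracXn rmorph_nat e.
move=> uE; move: uu; rewrite padic_int_unit_val0 uE -natrX padic_int_valM.
have h : (p ^ n.+1 %% p ^ 1 = 0)%N by rewrite expn1 expnS modnMr.
by rewrite padic_int_val_nat h mul0n mod0n.
Qed.

Lemma padic_ordE k (u : Zp) : u \is a GRing.unit ->
  padic_ord (p%:R ^ k * tofrac u : Qp) = k.
Proof.
move=> uu; rewrite /padic_ord; case: xgetP => [l _ [v vu]|/(_ k)].
  by move=> /padic_decomp_inj e; rewrite (e uu vu).
by case; exists u.
Qed.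

Lemma padic_ordP x : x != 0 ->
  exists2 u : Zp, u \is a GRing.unit & x = p%:R ^ padic_ord x * tofrac u.
Proof. by move=> /padic_decomp[k [u uu ->]]; exists u => //; rewrite padic_ordE. Qed.

Lemma padic_norm_le (F : realFieldType) x k :
  ((padic_norm x : F) <= p%:R ^ k) = (x == 0) || (- k <= padic_ord x).
Proof.
rewrite /padic_norm; case: eqVneq => [_|x0] /=.
  by rewrite exprz_ge0// ler0n.
by rewrite ler_eXz2l ?ltr1n ?prime_gt1// lerNl.
Qed.

Lemma padic_norm_ge (F : realFieldType) x k :
  (p%:R ^ k <= (padic_norm x : F)) = (x != 0) && (padic_ord x <= - k).
Proof.
rewrite /padic_norm; case: eqVneq => [_|x0] /=.
  by apply: lt_geF; rewrite exprz_gt0// ltr0n prime_gt0.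
by rewrite ler_eXz2l ?ltr1n ?prime_gt1// lerNr.
Qed.

Lemma padic_ball_ordP k x : padic_ball k x <-> (x == 0) || (- k <= padic_ord x).
Proof. by rewrite /padic_ball /= padic_norm_le. Qed.

(** Replaces the norm condition by membership in the lattice p^(-k) Z_p, so that stability of balls
    under sums, opposites and products is inherited from the ring Z_p. *)
Lemma padic_ballP k x :
  padic_ball k x <-> exists a : Zp, x = p%:R ^ (- k) * tofrac a.
Proof.
rewrite padic_ball_ordP; split=> [/predU1P[->|]|[a ->]].
- by exists 0; rewrite tofrac0 mulr0.
- have [->|x0] := eqVneq x 0; first by exists 0; rewrite tofrac0 mulr0.
  have [u uu xE] := padic_ordP x0.
  move=> h; have [n nE] : exists n : nat, padic_ord x = - k + n%:Z.
    by exists `|(padic_ord x + k)%R|%N; rewrite gez0_abs; lia.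
  exists (p%:R ^+ n * u).
  by rewrite tofracM tofracXn rmorph_nat mulrA {1}xE nE expfzDr.
- have [->|a0] := eqVneq a 0; first by rewrite tofrac0 mulr0 eqxx.
  have [n [u uu ->]] := padic_int_decomp a0.
  rewrite tofracM tofracXn rmorph_nat mulrA exprnP -expfzDr// padic_ordE//.
  by rewrite lerDl orbT.
Qed.

Lemma padic_ball_center k : padic_ball k (0 : Qp).
Proof. by apply/padic_ballP; exists 0; rewrite tofrac0 mulr0. Qed.

Lemma padic_ballD k x y : padic_ball k x -> padic_ball k y -> padic_ball k (x + y).
Proof.
move=> /padic_ballP[a ->] /padic_ballP[b ->]; apply/padic_ballP; exists (a + b).
by rewrite tofracD mulrDr.
Qed.

Lemma padic_ballN k x : padic_ball k (- x) <-> padic_ball k x.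
Proof.
suff H y : padic_ball k y -> padic_ball k (- y) by split=> /H //; rewrite opprK.
move=> /padic_ballP[a ->]; apply/padic_ballP; exists (- a).
by rewrite tofracN mulrN.
Qed.

Lemma padic_ballB k x y : padic_ball k x -> padic_ball k y -> padic_ball k (x - y).
Proof. by move=> xk yk; apply: padic_ballD => //; apply/padic_ballN. Qed.

Lemma padic_ball_addl k x y : padic_ball k x -> padic_ball k (x + y) <-> padic_ball k y.
Proof.
move=> xk; split=> h; last exact: padic_ballD.
by rewrite -(addKr x y) addrC; apply: padic_ballB.
Qed.

Lemma padic_ball_addr k x y : padic_ball k y -> padic_ball k (x + y) <-> padic_ball k x.
Proof. by rewrite addrC; exact: padic_ball_addl. Qed.

Lemma padic_ball_subC k x y : padic_ball k (x - y) <-> padic_ball k (y - x).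
Proof. by rewrite -[X in X <-> _]padic_ballN opprB. Qed.

Lemma padic_ball_le j k x : j <= k -> padic_ball j x -> padic_ball k x.
Proof.
move=> jk /padic_ball_ordP/predU1P[->|h]; first exact: padic_ball_center.
by apply/padic_ball_ordP; rewrite (le_trans _ h) ?orbT// lerN2.
Qed.

Lemma padic_ballM j k x y :
  padic_ball j x -> padic_ball k y -> padic_ball (j + k) (x * y).
Proof.
move=> /padic_ballP[a ->] /padic_ballP[b ->]; apply/padic_ballP; exists (a * b).
by rewrite tofracM opprD expfzDr// mulrACA.
Qed.

Lemma padic_ball_expz k : padic_ball (- k) (p%:R ^ k : Qp).
Proof. by apply/padic_ballP; exists 1; rewrite opprK tofrac1 mulr1. Qed.

Lemma padic_ball_nat n : padic_ball 0 (n%:R : Qp).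
Proof. by apply/padic_ballP; exists n%:R; rewrite oppr0 expr0z mul1r rmorph_nat. Qed.

Lemma padic_ball_dvd (n k : nat) : padic_ball (- n%:Z) (k%:R : Qp) <-> (p ^ n %| k)%N.
Proof.
split=> [/padic_ballP[a]|/dvdnP[i ->]].
  rewrite opprK -exprnP => e.
  have : k%:R = p%:R ^+ n * a by apply/eqP; rewrite -tofrac_eq tofracM tofracXn !rmorph_nat e.
  case: n e => [//|n] e /(congr1 (fun z : Zp => sval z n : nat)).
  rewrite padic_int_val_nat -natrX padic_int_valM padic_int_val_nat modnn mul0n mod0n.
  by move=> /eqP.
rewrite natrM natrX -(add0r (- _)); apply: padic_ballM; first exact: padic_ball_nat.
by rewrite exprnP; apply: padic_ball_expz.
Qed.

Lemma padic_nat_neq0 n : (0 < n)%N -> (n%:R : Qp) != 0.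
Proof.
move=> n0; apply/eqP => e; have := padic_ball_center (- n%:Z).
rewrite -e => /padic_ball_dvd /(dvdn_leq n0).
by rewrite leqNgt ltn_expl// prime_gt1.
Qed.

(** Writing x = p^(-k) a, the label [i] is the residue of [a] modulo p^n. Together with
    [padic_ball_coset_inj] this cuts a ball into exactly p^n disjoint cosets, which is the source of
    the volume formula. *)
Lemma padic_ball_coset k n x : padic_ball k x ->
  exists2 i : nat, (i < p ^ n)%N & padic_ball (k - n%:Z) (x - p%:R ^ (- k) * i%:R).
Proof.
move=> /padic_ballP[a ->].
have [i ip [b ab]] : exists2 i : nat, (i < p ^ n)%N & exists b, a - i%:R = p%:R ^+ n * b.
  case: n => [|n]; first by exists 0%N => //; exists a; rewrite expr0 mul1r subr0.
  exists (sval a n : nat); first exact: padic_int_ltn.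
  apply: padic_int_dvd.
  have : (sval (a - (sval a n)%:R + (sval a n)%:R) n : nat) = sval a n by rewrite subrK.
  rewrite padic_int_valD padic_int_val_nat (modn_small (padic_int_ltn _ _)).
  rewrite -[RHS](modn_small (padic_int_ltn a n)) -[X in _ = X %[mod _]]add0n.
  by move/eqP; rewrite eqn_modDr mod0n modn_small ?padic_int_ltn// => /eqP.
exists i => //; apply/padic_ballP; exists b.
rewrite -mulrBr opprD opprK expfzDr// -mulrA; congr (_ * _).
by rewrite -exprnP -(rmorph_nat (@FracField.tofrac Zp)) -(rmorph_nat (@FracField.tofrac Zp)) -tofracXn -tofracM -tofracB ab.
Qed.

Lemma padic_ball_coset_inj k n (i j : nat) : (i < p ^ n)%N -> (j < p ^ n)%N ->
  padic_ball (k - n%:Z) (p%:R ^ (- k) * i%:R - p%:R ^ (- k) * j%:R : Qp) -> i = j.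
Proof.
wlog ij : i j / (j <= i)%N => [W ip jp h|ip jp].
  by case/orP: (leq_total j i) => h'; [|symmetry]; apply: W => //; apply/padic_ball_subC.
rewrite -mulrBr -natrB// => h.
have : padic_ball (- n%:Z) ((i - j)%:R : Qp).
  rewrite -[X in padic_ball _ X](mulKf (expfz_neq0 (- k) p0)) -(@addKr _ k (- _)).
  by apply: padic_ballM => //; rewrite invr_expz opprK; apply: padic_ball_expz.
move=> /padic_ball_dvd/dvdn_leq; case: posnP => [/eqP|_ /(_ isT)].
  by rewrite subn_eq0 => ji _; apply/eqP; rewrite eqn_leq ji ij.
by rewrite leqNgt (leq_ltn_trans (leq_subr _ _)).
Qed.

Lemma padic_ord_ballP k x : x != 0 ->
  padic_ord x = - k <-> padic_ball k x /\ ~ padic_ball (k - 1) x.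
Proof.
move=> x0; rewrite !padic_ball_ordP (negPf x0) /= opprB; split=> [->|[h1 /negP]].
  by rewrite lexx; split=> //; apply/negP; rewrite -ltNge addrC ltrDl.
rewrite -ltNge => h2; apply/eqP; rewrite eq_le h1 andbT.
by move: h2; rewrite [1 - k]addrC ltzD1.
Qed.

(** The first hypothesis amounts to x != 0; adding an element of the ball just inside the sphere of
    x does not leave that sphere. *)
Lemma padic_ord_add x z : ~ padic_ball (- padic_ord x - 1) x ->
  padic_ball (- padic_ord x - 1) z -> padic_ord (x + z) = padic_ord x.
Proof.
move=> xN zk.
have x0 : x != 0 by apply/eqP => x0; apply: xN; rewrite {2}x0; apply: padic_ball_center.
have xzN : ~ padic_ball (- padic_ord x - 1) (x + z) by move=> /(padic_ball_addr _ zk).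
have xz0 : x + z != 0 by apply/eqP => x1; apply: xzN; rewrite {1}x1; apply: padic_ball_center.
rewrite -[RHS]opprK; apply/padic_ord_ballP => //; split=> //.
apply: padic_ballD; first by apply/padic_ball_ordP; rewrite opprK lexx orbT.
by apply: padic_ball_le zk; rewrite gerBl.
Qed.

Lemma padic_ord_add_lt k x z : ~ padic_ball k x -> padic_ball k z ->
  padic_ord (x + z) = padic_ord x.
Proof.
move=> xk zk.
have x0 : x != 0 by apply/eqP => x0; apply: xk; rewrite x0; apply: padic_ball_center.
have [_ xN] := (padic_ord_ballP (- padic_ord x) x0).1 (esym (opprK _)).
apply: padic_ord_add => //; apply: padic_ball_le zk.
move: xk; rewrite padic_ball_ordP (negPf x0) /= => /negP; rewrite -ltNge.
by rewrite ltrNr -lezD1 lerBrDr.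
Qed.

Lemma padic_add_neq0 k x z : ~ padic_ball k x -> padic_ball k z -> x + z != 0.
Proof.
move=> xk zk; apply/eqP => xz0; apply: xk; apply/(padic_ball_addr _ zk).
by rewrite xz0; apply: padic_ball_center.
Qed.

Lemma padic_norm_add_lt (F : realFieldType) k x z : ~ padic_ball k x -> padic_ball k z ->
  padic_norm (x + z) = padic_norm x :> F.
Proof.
move=> xk zk; rewrite /padic_norm (negPf (padic_add_neq0 xk zk)) (padic_ord_add_lt xk zk).
by case: eqVneq => // x0; case: xk; rewrite x0; apply: padic_ball_center.
Qed.

Lemma padic_annulusP j k x : padic_annulus j k x <-> padic_ball k x /\ ~ padic_ball (j - 1) x.
Proof.
rewrite /padic_annulus /= andbC; split.
  move=> /andP[h1]; rewrite padic_norm_ge => /andP[x0 h2]; split=> //.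
  rewrite padic_ball_ordP (negPf x0) /=; apply/negP; rewrite -ltNge opprB.
  by rewrite (le_lt_trans h2)// addrC ltrDl.
move=> [h1 h2]; rewrite h1/= padic_norm_ge.
move: h2; rewrite padic_ball_ordP => /negP; rewrite negb_or => /andP[-> /=].
by rewrite -ltNge opprB addrC ltzD1.
Qed.

Lemma padic_co_ballP j x : padic_co_ball j x <-> ~ padic_ball (j - 1) x.
Proof.
rewrite /padic_co_ball /= padic_norm_ge; split.
  move=> /andP[x0 h2].
  rewrite padic_ball_ordP (negPf x0) /=; apply/negP; rewrite -ltNge opprB.
  by rewrite (le_lt_trans h2)// addrC ltrDl.
rewrite padic_ball_ordP => /negP; rewrite negb_or => /andP[-> /=].
by rewrite -ltNge opprB addrC ltzD1.
Qed.

End PadicValuation.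

(** * Fractional part and additive character *)

Section PadicCharacter.
Variables (p : nat) (p_pr : prime p).
Local Notation Zp := (padic_int p_pr).
Local Notation Qp := (padic p_pr).
Implicit Types (x y : Qp).

Let p0 : (p%:R : Qp) != 0 := padic_natp_neq0 p_pr.

(** On Z[1/p] the cast into Q_p can be computed from any representation with denominator p^n. A
    common n for two arguments then gives additivity of the cast on Z[1/p]. *)
Lemma padic_ratrE (r : rat) (n : nat) (m : int) :
  r * p%:R ^+ n = m%:~R -> ratr r = m%:~R / p%:R ^+ n :> Qp.
Proof.
move=> e; have d0 : ((denq r)%:~R : Qp) != 0.
  have : (0 < `|denq r|)%N by rewrite absz_gt0.
  by move=> /(padic_nat_neq0 p_pr); rewrite -(gez0_abs (ltW (denq_gt0 r))).
apply/eqP; rewrite /ratr (eqr_div _ _ d0 (expf_neq0 n p0)) -natrX -[(p ^ n)%:R]/((p ^ n)%:Z%:~R) -!intrM.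
apply/eqP; congr (_%:~R); apply: (@intr_inj rat); rewrite !intrM numqE -e.
by rewrite (natrX _ p n : (p ^ n)%:Z%:~R = _) mulrAC.
Qed.

Lemma padic_ratr0 : ratr 0 = 0 :> Qp.
Proof. exact: (ratr_nat Qp 0). Qed.

Lemma padic_ball_int n (m : int) :
  padic_ball (- n%:Z) (m%:~R : Qp) <-> (p ^ n %| `|m|)%N.
Proof.
rewrite -padic_ball_dvd; by case: m => k; rewrite ?NegzE ?mulrNz ?padic_ballN ?abszN; exact: iff_refl.
Qed.

(** This is Z[1/p] ∩ Z_p = Z: the integer m = r p^n lies in the ball of radius p^(-n), hence is
    divisible by p^n. It is what makes the fractional part additive modulo 1. *)
Lemma padic_ball0_ratr (r : rat) (n : nat) : r * p%:R ^+ n \is a Num.int ->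
  padic_ball 0 (ratr r : Qp) -> r \is a Num.int.
Proof.
move=> /intrP[m e]; rewrite (padic_ratrE e) => h.
have : padic_ball (- n%:Z) (m%:~R : Qp).
  rewrite -[X in padic_ball _ X](divfK (expf_neq0 n p0)) -[X in padic_ball X _]add0r.
  by apply: padic_ballM => //; apply: padic_ball_expz.
move=> /padic_ball_int pm.
have : ((p ^ n)%:Z %| m)%Z by [].
move=> /dvdzP[q mE]; apply/intrP; exists q.
have pn : (p%:R : rat) ^+ n != 0 by rewrite expf_neq0// pnatr_eq0 -lt0n prime_gt0.
by apply: (mulIf pn); rewrite e mE intrM (natrX _ p n : (p ^ n)%:Z%:~R = _).
Qed.

Lemma padic_frac_exists x : exists r : rat, [/\ 0 <= r < 1,
    (exists n : nat, r * p%:R ^+ n \is a Num.int) & padic_ball 0 (x - ratr r)].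
Proof.
have [n xn] : exists n : nat, padic_ball n%:Z x.
  have [->|x0] := eqVneq x 0; first by exists 0%N; apply: padic_ball_center.
  by exists `|padic_ord x|%N; apply/padic_ball_ordP; rewrite (negPf x0); lia.
have [i ip xi] := padic_ball_coset n xn.
have pn : (0 : rat) < p%:R ^+ n by rewrite exprn_gt0// ltr0n prime_gt0.
have e : i%:R / p%:R ^+ n * p%:R ^+ n = i%:Z%:~R :> rat by rewrite divfK// gt_eqF.
exists (i%:R / p%:R ^+ n); split.
- by rewrite divr_ge0 ?ler0n ?(ltW pn)//= ltr_pdivrMr// mul1r -natrX ltr_nat.
- by exists n; rewrite e intr_int.
- by move: xi; rewrite subrr (padic_ratrE e) mulrC exprnN.
Qed.

Lemma padic_fracE x : [/\ 0 <= padic_frac x < 1,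
    (exists n : nat, padic_frac x * p%:R ^+ n \is a Num.int) &
    padic_ball 0 (x - ratr (padic_frac x))].
Proof.
rewrite /padic_frac; case: xgetP => [r _ //|/= h].
by have [r /h] := padic_frac_exists x.
Qed.

Lemma ratr_padicD (r s : rat) (n : nat) :
  r * p%:R ^+ n \is a Num.int -> s * p%:R ^+ n \is a Num.int ->
  ratr (r + s) = ratr r + ratr s :> Qp.
Proof.
move=> /intrP[a ra] /intrP[b sb]; rewrite (padic_ratrE ra) (padic_ratrE sb).
by rewrite -mulrDl -intrD; apply: padic_ratrE; rewrite mulrDl ra sb intrD.
Qed.

Lemma padic_frac_int_exp (r : rat) (m n : nat) :
  r * p%:R ^+ m \is a Num.int -> (m <= n)%N -> r * p%:R ^+ n \is a Num.int.
Proof.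
by move=> h /subnKC <-; rewrite exprD mulrA rpredM// rpredX// rpred_nat.
Qed.

(** The difference {x} + {y} - {x+y} lies both in Z[1/p] and in Z_p, so it is an integer; it is
    strictly between -1 and 2. *)
Lemma padic_fracD x y :
  padic_frac (x + y) = padic_frac x + padic_frac y \/
  padic_frac (x + y) + 1 = padic_frac x + padic_frac y.
Proof.
have [/andP[x1 x2] [k xk] xb] := padic_fracE x.
have [/andP[y1 y2] [l yl] yb] := padic_fracE y.
have [/andP[z1 z2] [m zm] zb] := padic_fracE (x + y).
pose n := maxn k (maxn l m).
have xn : padic_frac x * p%:R ^+ n \is a Num.int.
  by apply: padic_frac_int_exp xk _; rewrite leq_max leqnn.
have yn : padic_frac y * p%:R ^+ n \is a Num.int.
  by apply: padic_frac_int_exp yl _; rewrite !leq_max leqnn orbT.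
have zn : padic_frac (x + y) * p%:R ^+ n \is a Num.int.
  by apply: padic_frac_int_exp zm _; rewrite !leq_max leqnn !orbT.
have N1 : ratr (- padic_frac (x + y)) = - ratr (padic_frac (x + y)) :> Qp.
  have zn' : - padic_frac (x + y) * p%:R ^+ n \is a Num.int by rewrite mulNr rpredN.
  by apply/eqP; rewrite -addr_eq0 -(ratr_padicD zn' zn) addNr padic_ratr0.
pose s := padic_frac x + padic_frac y - padic_frac (x + y).
have sn : s * p%:R ^+ n \is a Num.int by rewrite /s mulrBl rpredB// mulrDl rpredD.
have /padic_ball0_ratr : padic_ball 0 (ratr s : Qp).
  have zn' : - padic_frac (x + y) * p%:R ^+ n \is a Num.int by rewrite mulNr rpredN.
  have xyn : (padic_frac x + padic_frac y) * p%:R ^+ n \is a Num.int.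
    by rewrite mulrDl rpredD.
  rewrite /s (ratr_padicD xyn zn') N1 (ratr_padicD xn yn).
  set a := ratr _ in xb *; set b := ratr _ in yb *; set c := ratr _ in zb *.
  rewrite (_ : _ - _ = (x + y - c) - (x - a) - (y - b)); last by ring.
  by apply: padic_ballB => //; apply: padic_ballB.
move=> /(_ _ sn)/intrP[q sq].
have q1 : (q < 2)%R by rewrite -(ltr_int rat) -sq /s; lra.
have q2 : (- 1 < q)%R by rewrite -(ltr_int rat) -sq /s; lra.
have : q = 0 \/ q = 1 by clear -q1 q2; lia.
by move=> [qE|qE]; [left|right]; move: sq; rewrite qE /s => e; lra.
Qed.

Lemma padic_frac_ball0 x : padic_ball 0 x <-> padic_frac x = 0.
Proof.
have [/andP[x1 x2] [k xk] xb] := padic_fracE x; split=> [x0|e].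
  have : padic_frac x \is a Num.int.
    apply: padic_ball0_ratr xk _.
    by rewrite -(subKr x (ratr _)); apply: padic_ballB.
  move=> /intrP[m e]; rewrite e in x1 x2 *.
  by rewrite ler0z ltrz1 in x1 x2 *; have -> : m = 0 by clear -x1 x2; lia.
by move: xb; rewrite e padic_ratr0 subr0.
Qed.

Context {R : realType}.
Local Notation chi := (@padic_char p p_pr R).

Lemma padic_char_ball0 x : padic_ball 0 x -> chi x = 1.
Proof.
by move=> /padic_frac_ball0 e; rewrite /padic_char e raddf0 mulr0 cos0 sin0.
Qed.

Lemma padic_charD x y : chi (x + y) = chi x * chi y.
Proof.
rewrite /padic_char.
set a := 2 * pi * _; set b := 2 * pi * ratr (padic_frac x).
set c := 2 * pi * ratr (padic_frac y).
have [<- <-] : cos (b + c) = cos a /\ sin (b + c) = sin a.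
  have [e|e] := padic_fracD x y.
    by rewrite /a e raddfD mulrDr.
  have -> : b + c = a + pi *+ 2.
    by rewrite /a /b /c -mulrDr -raddfD -e raddfD/= rmorph1; ring.
  by rewrite cosD2pi sinD2pi.
by rewrite cosD sinD/=; congr (_ +i* _)%C; rewrite addrC mulrC [X in _ + X]mulrC.
Qed.

(** With t = {x} in ]0, 1[, the real part is cos(2 pi t) = 1 - 2 sin(pi t)^2, and sin(pi t) > 0. *)
Lemma padic_char_neq1 x : ~ padic_ball 0 x -> chi x != 1.
Proof.
move=> xN; have [/andP[x1 x2] _ _] := padic_fracE x.
have f0 : 0 < padic_frac x.
  by rewrite lt_def x1 andbT; apply/eqP => /padic_frac_ball0.
apply/eqP => /(congr1 (@complex.Re R)); rewrite /padic_char /=.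
set t := ratr _ => e.
have t0 : 0 < t by rewrite ltr0q.
have t1 : t < 1 by rewrite -(rmorph1 (@ratr R)) ltr_rat.
have : 0 < sin (pi * t).
  by apply: sin_gt0_pi; rewrite mulr_gt0 ?pi_gt0//= gtr_pMr// pi_gt0.
move: e; rewrite (_ : 2 * pi * t = pi * t + pi * t); last by ring.
rewrite cosD -!expr2 cos2sin2 => e s0.
have : sin (pi * t) ^+ 2 > 0 by rewrite exprn_gt0.
by lra.
Qed.

End PadicCharacter.

(** * Haar measure *)

Section PadicMeasurable.
Variables (p : nat) (p_pr : prime p).
Local Notation Qp := (padic p_pr).
Implicit Types (x y z : Qp) (A : set Qp) (k : int).

Lemma padic_open_measurable A : padic_open A -> measurable A.
Proof. by move=> Ao; apply: sub_sigma_algebra. Qed.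

Lemma padic_ball_stable_open A k :
  (forall x z, A x -> padic_ball k z -> A (x + z)) -> padic_open A.
Proof. by move=> Ak x Ax; exists k => z; exact: Ak. Qed.

Lemma padic_ball_measurable k : measurable (padic_ball k : set Qp).
Proof.
apply: padic_open_measurable; apply: (@padic_ball_stable_open _ k) => x z.
exact: padic_ballD.
Qed.

Lemma padic_coset_measurable k x : measurable [set y | padic_ball k (y - x)].
Proof.
apply: padic_open_measurable; apply: (@padic_ball_stable_open _ k) => y z /= h zk.
by rewrite addrAC; apply: padic_ballD.
Qed.

Lemma padic_coset'_measurable k x : measurable [set y | padic_ball k (x - y)].
Proof.
rewrite (_ : [set y | _] = [set y | padic_ball k (y - x)]).
  exact: padic_coset_measurable.
by apply/seteqP; split=> y /=; apply: (padic_ball_subC _ _ _).1.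
Qed.

Lemma padic_co_ball_measurable k : measurable (padic_co_ball k : set Qp).
Proof.
rewrite (_ : padic_co_ball k = ~` padic_ball (k - 1)).
  by apply: measurableC; apply: padic_ball_measurable.
by apply/seteqP; split=> x; rewrite padic_co_ballP.
Qed.

Lemma padic_annulus_measurable j k : measurable (padic_annulus j k : set Qp).
Proof.
rewrite (_ : padic_annulus j k = padic_ball k `\` padic_ball (j - 1)).
  by apply: measurableD; apply: padic_ball_measurable.
by apply/seteqP; split=> x; rewrite padic_annulusP.
Qed.

Lemma padic_ball_exists x : exists k, padic_ball k x.
Proof.
exists (- padic_ord x); apply/padic_ball_ordP.
by rewrite opprK lexx orbT.
Qed.

Lemma padic_notin_ball x : x != 0 -> exists k, ~ padic_ball k x.
Proof.
move=> x0; exists (- padic_ord x - 1).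
exact: ((padic_ord_ballP (- padic_ord x) x0).1 (esym (opprK _))).2.
Qed.

Lemma padic_set1_measurable x : measurable [set x].
Proof.
rewrite -(setCK [set x]); apply: measurableC; apply: padic_open_measurable => y /= yx.
have /padic_notin_ball[k yk] : y - x != 0 by rewrite subr_eq0; apply/eqP.
exists k => z zk /= e; apply: yk; rewrite -e opprD addNKr.
exact/padic_ballN.
Qed.

(** The exceptional point is there for the kernels, which are locally constant away from 0 but may
    be singular at 0. Splitting it off is allowed because singletons are closed. *)
Lemma padic_locally_constant_measurable d (T : measurableType d) (f : Qp -> T) (a : Qp) :
  (forall x, x != a -> exists k, forall z, padic_ball k z -> f (x + z) = f x) ->
  measurable_fun setT f.
Proof.
move=> flc _ Y mY; rewrite setTI.
rewrite -[X in measurable X]setIT -(setUv [set a]) setIUr.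
apply: measurableU.
  have [fa|fa] := pselect (Y (f a)).
    rewrite (_ : _ `&` _ = [set a]); first exact: padic_set1_measurable.
    by apply/seteqP; split=> x /= => [[]//|->].
  rewrite (_ : _ `&` _ = set0); first exact: measurable0.
  by apply/seteqP; split=> x //= [fx xa]; apply: fa; rewrite -xa.
apply: padic_open_measurable => x /= [Yx /eqP xa].
have [k fk] := flc _ xa.
have [j xj] : exists j, ~ padic_ball j (x - a).
  by apply: padic_notin_ball; rewrite subr_eq0.
exists (Order.min k j) => z zkj; split.
  by rewrite fk//; apply: padic_ball_le zkj; rewrite ge_min lexx.
move=> xza; apply: xj; rewrite -xza opprD addNKr; apply/padic_ballN.
by apply: padic_ball_le zkj; rewrite ge_min lexx orbT.
Qed.

Lemma padic_isometry_measurable (f : Qp -> Qp) :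
  (forall x z k, padic_ball k z -> padic_ball k (f (x + z) - f x)) ->
  measurable_fun setT f.
Proof.
move=> fk; apply: (@measurability _ _ _ _ _ _ (@open Qp)) => //.
move=> _ [A Ao <-]; rewrite setTI; apply: padic_open_measurable => x Ax.
have [k Ak] := Ao _ Ax; exists k => z zk /=.
by rewrite -(subrK (f x) (f (x + z))) addrC; apply: Ak; apply: fk.
Qed.

Lemma padic_translation_measurable (a : Qp) : measurable_fun setT (+%R a).
Proof.
apply: padic_isometry_measurable => x z k zk.
by rewrite (_ : a + (x + z) - (a + x) = z)//; ring.
Qed.

Lemma padic_reflection_measurable (a : Qp) : measurable_fun setT (fun x => a - x).
Proof.
apply: padic_isometry_measurable => x z k zk.
by rewrite (_ : a - (x + z) - (a - x) = - z); [apply/padic_ballN|ring].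
Qed.

End PadicMeasurable.

Section Haar.
Variables (R : realType) (p : nat) (p_pr : prime p).
Local Notation Qp := (padic p_pr).
Variables (haar : {measure set Qp -> \bar R}) (h_haar : is_haar haar).
Implicit Types (x y z : Qp) (A D : set Qp) (k : int).

Let haar_translate (a : Qp) A : measurable A -> haar (+%R a @^-1` A) = haar A.
Proof.
move=> mA; rewrite -(h_haar.1 (- a) _ mA); congr (haar _).
apply/seteqP; split=> x /=; first by move=> ax; exists (a + x) => //; rewrite addKr.
by move=> [y Ay <-]; rewrite addNKr.
Qed.

Lemma haar_pushforward (a : Qp) A : measurable A -> pushforward haar (+%R a) A = haar A.
Proof. exact: haar_translate. Qed.

Lemma haar_coset k x : haar [set y | padic_ball k (y - x)] = haar (padic_ball k).
Proof.
rewrite -(haar_translate (- x) (padic_ball_measurable k)); congr (haar _).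
by apply/seteqP; split=> y /=; rewrite addrC.
Qed.

Lemma padic_ball_bigsetU k n : padic_ball k = \big[setU/set0]_(i < p ^ n)
  [set y : Qp | padic_ball (k - n%:Z) (y - p%:R ^ (- k) * (i : nat)%:R)].
Proof.
rewrite -(bigcup_mkord _ (fun i : nat =>
  [set y : Qp | padic_ball (k - n%:Z) (y - p%:R ^ (- k) * i%:R)])).
apply/seteqP; split=> [x|x [i /= ip xi]].
  by move=> /(@padic_ball_coset _ _ _ n)[i ip xi]; exists i.
rewrite -(subrK (p%:R ^ (- k) * i%:R) x); apply: padic_ballD.
  by apply: padic_ball_le xi; rewrite gerBl.
have := padic_ballM (padic_ball_expz p_pr (- k)) (padic_ball_nat p_pr i).
by rewrite opprK addr0.
Qed.

Lemma padic_coset_trivIset k n : trivIset `I_(p ^ n)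
  (fun i : nat => [set y : Qp | padic_ball (k - n%:Z) (y - p%:R ^ (- k) * i%:R)]).
Proof.
apply/trivIsetP => i j /= ip jp ij; apply/seteqP; split=> // y [/= yi yj].
apply: (negP ij); apply/eqP.
apply: (padic_ball_coset_inj ip jp (p_pr := p_pr) (k := k)).
rewrite -(subrKA y); apply: padic_ballD; last exact: yj.
by apply: (padic_ball_subC _ _ _).1; exact: yi.
Qed.

Lemma sume_const_ord (m : nat) (c : \bar R) : (0 <= c)%E ->
  (\sum_(i < m) c = m%:R%:E * c)%E.
Proof.
move=> c0; elim: m => [|m IH]; first by rewrite big_ord0 mul0e.
by rewrite big_ord_recr/= IH -natr1 EFinD ge0_muleDl ?mul1e// lee_fin.
Qed.

Lemma haar_ball_mul k n :
  haar (padic_ball k) = ((p ^ n)%:R%:E * haar (padic_ball (k - n%:Z)))%E.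
Proof.
rewrite (padic_ball_bigsetU k n).
rewrite (measure_semi_additive_ord_I haar (fun i _ => padic_coset_measurable _ _) (@padic_coset_trivIset k n)).
- by rewrite -sume_const_ord//; apply: eq_bigr => i _; exact: haar_coset.
- by apply: bigsetU_measurable => i _; apply: padic_coset_measurable.
Qed.

(** For k >= 0 the ball is cut into p^k cosets of Z_p; for k < 0 it is Z_p that is cut into cosets
    of the ball. *)
Lemma haar_ball k : haar (padic_ball k) = (p%:R ^ k)%:E.
Proof.
have p0 : p%:R != 0 :> R by rewrite pnatr_eq0 -lt0n prime_gt0.
case: k => n.
  by rewrite (haar_ball_mul n%:Z n) subrr h_haar.2 mule1 natrX.
(* [Negz n] stands for -(n+1), hence the exponent n+1. *)
have := haar_ball_mul 0 n.+1; rewrite h_haar.2 sub0r -NegzE natrX => e.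
have pn : (0 : R) < p%:R ^+ n.+1 by rewrite exprn_gt0// ltr0n prime_gt0.
have -> : haar (padic_ball (Negz n)) =
    ((p%:R ^+ n.+1)^-1%:E * ((p%:R ^+ n.+1)%:E * haar (padic_ball (Negz n))))%E.
  by rewrite muleA -EFinM mulVf ?gt_eqF// mul1e.
by rewrite -e mule1 NegzE exprnN.
Qed.

Lemma haar_set1 x : haar [set x] = 0%E.
Proof.
have p1 : 1 < p%:R :> R by rewrite ltr1n prime_gt1.
apply/eqP; rewrite eq_le measure_ge0 andbT; apply/lee_addgt0Pr => e e0.
rewrite add0e; have [n pn] : exists n : nat, (p%:R ^- n : R) < e.
  have : (p%:R^-1 : R) ^+ n @[n --> \oo] --> (0 : R).
    by apply: cvg_expr; rewrite ger0_norm ?invr_ge0 ?ler0n// invf_lt1// ltr0n prime_gt0.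
  move=> /cvgrPdist_lt /(_ _ e0)[n _ /(_ n (leqnn n))] /=.
  rewrite sub0r normrN ger0_norm ?exprn_ge0 ?invr_ge0 ?ler0n// exprVn.
  by exists n.
apply: (@le_trans _ _ (haar [set y | padic_ball (- n%:Z) (y - x)])).
  apply: le_measure; rewrite ?inE; [exact: padic_set1_measurable|exact: padic_coset_measurable|].
  by move=> _ ->; rewrite /= subrr; apply: padic_ball_center.
by rewrite haar_coset haar_ball lee_fin -exprnN ltW.
Qed.

Lemma ge0_integral_haar_translate D (f : Qp -> \bar R) (a : Qp) :
  measurable D -> measurable_fun D f -> (forall y, D y -> 0 <= f y)%E ->
  (\int[haar]_(x in +%R a @^-1` D) f (a + x)%R = \int[haar]_(x in D) f x)%E.
Proof.
move=> mD mf f0.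
have ma := padic_translation_measurable (p_pr := p_pr) a.
rewrite -(@ge0_integral_pushforward _ _ _ _ _ _ ma haar D f mD mf); last first.
  by move=> y; rewrite inE; exact: f0.
by apply: eq_measure_integral => A mA _; exact: haar_pushforward.
Qed.

Lemma integral_haar_translate D (f : Qp -> \bar R) (a : Qp) :
  measurable D -> measurable_fun D f ->
  (\int[haar]_(x in +%R a @^-1` D) f (a + x)%R = \int[haar]_(x in D) f x)%E.
Proof.
move=> mD mf; rewrite [LHS]integralE [RHS]integralE; congr (_ - _)%E.
  by rewrite -(ge0_integral_haar_translate a mD (measurable_funepos mf))//; apply: eq_integral => x _;
    exact: (congr1 (@^~ x) (funepos_comp f (+%R a))).
by rewrite -(ge0_integral_haar_translate a mD (measurable_funeneg mf))//; apply: eq_integral => x _;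
  exact: (congr1 (@^~ x) (funeneg_comp f (+%R a))).
Qed.

End Haar.

(** * Averages over cosets *)

Section L1norm.
Context d (T : measurableType d) (R : realType).
Variables (mu : {measure set T -> \bar R}) (D : set T) (mD : measurable D).
Implicit Types f g : T -> R.

Definition L1norm f : R := \int[mu]_(x in D) `|f x|.

Local Notation integ f := (mu.-integrable D (EFin \o f)).

Lemma integrable_normr f : integ f -> integ (fun x => `|f x|).
Proof. exact: integrable_norm. Qed.

Lemma integrableDr f g : integ f -> integ g -> integ (fun x => f x + g x).
Proof. by move=> fi gi; exact: (integrableD mD fi gi). Qed.

Lemma integrableBr f g : integ f -> integ g -> integ (fun x => f x - g x).
Proof. by move=> fi gi; exact: (integrableB mD fi gi). Qed.

Lemma integrableZlr c f : integ f -> integ (fun x => c * f x).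
Proof. by move=> fi; exact: (integrableZl mD c fi). Qed.

Lemma integrable_sumr (I : Type) (s : seq I) (F : I -> T -> R) :
  (forall i, integ (F i)) -> integ (fun x => \sum_(i <- s) F i x).
Proof.
move=> Fi; have := @integrable_sum _ _ _ mu D mD _ s predT (fun i => EFin \o F i) (fun i _ => Fi i).
by congr integrable; apply/funext => x /=; rewrite sumEFin.
Qed.

Lemma L1norm_ge0 f : 0 <= L1norm f.
Proof. exact: Rintegral_ge0. Qed.

Lemma L1normD f g : integ f -> integ g ->
  L1norm (fun x => f x + g x) <= L1norm f + L1norm g.
Proof.
move=> fi gi; rewrite -RintegralD//; [|exact: integrable_normr..].
apply: le_Rintegral => //.
- exact/integrable_normr/integrableDr.
- by apply: integrableDr; apply: integrable_normr.
- by move=> x _; exact: ler_normD.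
Qed.

Lemma L1normZ c f : integ f -> L1norm (fun x => c * f x) = `|c| * L1norm f.
Proof.
move=> fi; rewrite -RintegralZl//; last exact: integrable_normr.
by apply: eq_Rintegral => x _; rewrite normrM.
Qed.

Lemma L1normN f : L1norm (fun x => - f x) = L1norm f.
Proof. by apply: eq_Rintegral => x _; rewrite normrN. Qed.

Lemma L1normB f g : integ f -> integ g ->
  L1norm (fun x => f x - g x) <= L1norm f + L1norm g.
Proof.
move=> fi gi; rewrite -(L1normN g); apply: L1normD => //.
by have := integrableZlr (-1) gi; congr integrable; apply/funext => x /=; rewrite mulN1r.
Qed.

Lemma L1norm_triangle f g h : integ f -> integ g -> integ h ->
  L1norm (fun x => f x - h x) <= L1norm (fun x => f x - g x) + L1norm (fun x => g x - h x).
Proof.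
move=> fi gi hi; have := L1normD (integrableBr fi gi) (integrableBr gi hi).
by congr (_ <= _); apply: eq_Rintegral => x _; congr `| _ |; ring.
Qed.

Lemma L1normC f g : L1norm (fun x => f x - g x) = L1norm (fun x => g x - f x).
Proof. by apply: eq_Rintegral => x _; rewrite distrC. Qed.

Lemma L1norm_sum (I : Type) (s : seq I) (F : I -> T -> R) :
  (forall i, integ (F i)) ->
  L1norm (fun x => \sum_(i <- s) F i x) <= \sum_(i <- s) L1norm (F i).
Proof.
move=> Fi; elim: s => [|a s IH].
  rewrite big_nil /L1norm; under eq_Rintegral do rewrite big_nil normr0.
  by rewrite Rintegral_cst// mul0r.
rewrite big_cons; apply: le_trans (lerD (lexx _) IH).
apply: le_trans (L1normD (Fi a) (integrable_sumr s Fi)).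
by rewrite le_eqVlt; apply/orP; left; apply/eqP; apply: eq_Rintegral => x _; rewrite big_cons.
Qed.

Lemma ae_eq_L1norm f g : integ f -> integ g -> ae_eq mu D f g -> L1norm f = L1norm g.
Proof.
move=> fi gi fg; rewrite /L1norm /Rintegral; congr fine.
apply: ae_eq_integral => //.
- exact: measurable_int (integrable_normr fi).
- exact: measurable_int (integrable_normr gi).
- by apply: filterS fg => x fgx Dx; rewrite fgx.
Qed.

Lemma L1norm_eq0 f : integ f -> L1norm f = 0 -> ae_eq mu D f (cst 0).
Proof.
move=> fi f0; have : (\int[mu]_(x in D) `|(f x)%:E| = 0)%E.
  have := integrable_fin_num mD (integrable_normr fi).
  by move=> /fineK /= <-; move: f0; rewrite /L1norm /Rintegral => ->.
move=> /(ae_eq_integral_abs mu mD (measurable_int _ fi)); apply: filterS => x h Dx.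
by have [] := h Dx.
Qed.

Lemma L1normE f : integ f -> (L1norm f)%:E = (\int[mu]_(x in D) `|f x|%:E)%E.
Proof.
by move=> fi; rewrite /L1norm /Rintegral fineK// (integrable_fin_num mD (integrable_normr fi)).
Qed.

Lemma eq_L1norm f g : (forall x, D x -> f x = g x) -> L1norm f = L1norm g.
Proof. by move=> fg; apply: eq_Rintegral => x; rewrite inE => /fg ->. Qed.

End L1norm.

Lemma eq_in_integrable d (T : measurableType d) (R : realType)
    (mu : {measure set T -> \bar R}) (D : set T) (f g : T -> R) :
  measurable D -> (forall x, D x -> f x = g x) ->
  mu.-integrable D (EFin \o f) -> mu.-integrable D (EFin \o g).
Proof. by move=> mD fg; apply: eq_integrable => // x; rewrite inE /= => /fg ->. Qed.

Section Average.
Variables (R : realType) (p : nat) (p_pr : prime p).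
Local Notation Qp := (padic p_pr).
Variables (haar : {measure set Qp -> \bar R}) (h_haar : is_haar haar) (N : int).
Implicit Types (x y z : Qp) (f g h : Qp -> R) (n : nat).

Local Notation BN := (padic_ball N : set Qp).
Local Notation integ f := (haar.-integrable BN (EFin \o f)).
Local Notation nrm := (L1norm haar BN).

Definition coset n x : set Qp := [set y | padic_ball (N - n%:Z) (x - y)].

Definition average n f x : R := p%:R ^ (n%:Z - N) * \int[haar]_(y in coset n x) f y.

Definition coset_invariant n f :=
  forall x z, padic_ball (N - n%:Z) z -> f (x + z) = f x.

Let mBN : measurable BN. Proof. exact: padic_ball_measurable. Qed.
Let pX_gt0 k : 0 < p%:R ^ k :> R.
Proof. by rewrite exprz_gt0// ltr0n prime_gt0. Qed.

Lemma coset_measurable n x : measurable (coset n x).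
Proof. exact: padic_coset'_measurable. Qed.

Lemma coset_sub n x : BN x -> coset n x `<=` BN.
Proof.
move=> xN y xy; rewrite -(subKr x y); apply: padic_ballB => //.
by apply: padic_ball_le xy; rewrite gerBl.
Qed.

Lemma coset_refl n x : coset n x x.
Proof. by rewrite /coset /= subrr; apply: padic_ball_center. Qed.

Lemma coset_add n x z : padic_ball (N - n%:Z) z -> coset n (x + z) = coset n x.
Proof.
move=> zn; apply/seteqP; split=> y; rewrite /coset /= addrAC.
  by move=> /(padic_ball_addr _ zn).
by move=> h; apply/(padic_ball_addr _ zn).
Qed.

Lemma haar_coset' n x : haar (coset n x) = (p%:R ^ (N - n%:Z))%:E.
Proof.
rewrite -(haar_ball h_haar) -(haar_coset h_haar _ x); congr (haar _).
by apply/seteqP; split=> y /=; apply: (padic_ball_subC _ _ _).1.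
Qed.

Lemma haar_BN_lty : (haar BN < +oo)%E.
Proof. by rewrite (haar_ball h_haar) ltry. Qed.

Lemma average_invariant n f : coset_invariant n (average n f).
Proof. by move=> x z zn; rewrite /average coset_add. Qed.

Lemma coset_invariantS m n f : (m <= n)%N -> coset_invariant m f -> coset_invariant n f.
Proof.
by move=> mn fm x z zn; apply: fm; apply: padic_ball_le zn; rewrite lerB// lez_nat.
Qed.

Lemma coset_invariantE n f x y : coset_invariant n f -> coset n x y -> f y = f x.
Proof.
by move=> fn /padic_ball_subC xy; rewrite -(fn x _ xy) addrC subrK.
Qed.

Lemma coset_invariant_measurable n f (A : set Qp) : coset_invariant n f ->
  measurable_fun A f.
Proof.
move=> fn; apply: measurable_funTS.
apply: (@padic_locally_constant_measurable _ _ _ _ _ 0) => x _.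
by exists (N - n%:Z) => z; exact: fn.
Qed.

Lemma integ_coset n x f : BN x -> integ f -> haar.-integrable (coset n x) (EFin \o f).
Proof.
move=> xN; apply: integrableS => //; [exact: coset_measurable|exact: coset_sub].
Qed.

Lemma Rintegral_coset_cst n x (c : R) :
  \int[haar]_(_ in coset n x) c = c * p%:R ^ (N - n%:Z).
Proof. by rewrite Rintegral_cst ?haar_coset'//; exact: coset_measurable. Qed.

Lemma average_id n f x : coset_invariant n f -> average n f x = f x.
Proof.
move=> fn; rewrite /average.
rewrite (@eq_Rintegral _ _ _ _ _ (fun=> f x)); last first.
  by move=> y; rewrite inE => xy; apply: coset_invariantE fn xy.
by rewrite Rintegral_coset_cst mulrCA -expfzDr ?pnatr_eq0 -?lt0n ?prime_gt0// addrA subrK subrr expr0z mulr1.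
Qed.

Let rep n (i : nat) : Qp := p%:R ^ (- N) * i%:R.

Lemma BN_cosets n : BN = \big[setU/set0]_(i <- iota 0 (p ^ n)) coset n (rep n i).
Proof.
rewrite (padic_ball_bigsetU p_pr N n) -(big_mkord predT (fun i : nat =>
  [set y : Qp | padic_ball (N - n%:Z) (y - p%:R ^ (- N) * i%:R)])).
rewrite /index_iota subn0; apply: eq_bigr => i _.
by apply/seteqP; split=> y /=; apply: (padic_ball_subC _ _ _).1.
Qed.

Lemma cosets_trivIset n : trivIset [set` iota 0 (p ^ n)] (fun i => coset n (rep n i)).
Proof.
have := @padic_coset_trivIset _ p_pr N n.
rewrite (_ : [set` _] = `I_(p ^ n)); last first.
  by apply/seteqP; split=> i /=; rewrite mem_iota add0n.
congr trivIset; apply/funext => i.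
by apply/seteqP; split=> y /=; apply: (padic_ball_subC _ _ _).1.
Qed.

Lemma rep_BN n i : (i < p ^ n)%N -> BN (rep n i).
Proof.
move=> ip; rewrite (BN_cosets n) -bigcup_seq; exists i; last exact: coset_refl.
by rewrite /= mem_iota.
Qed.

Lemma Rintegral_cosets n f : integ f ->
  \int[haar]_(x in BN) f x = \sum_(i < p ^ n) \int[haar]_(x in coset n (rep n i)) f x.
Proof.
move=> fi; apply: EFin_inj; rewrite -sumEFin /Rintegral fineK; last first.
  exact: integrable_fin_num.
rewrite {1}(BN_cosets n) integral_bigsetU_EFin.
- have -> : iota 0 (p ^ n) = index_iota 0 (p ^ n) by rewrite /index_iota subn0.
  rewrite big_mkord.
  apply: eq_bigr => i _; rewrite fineK// integrable_fin_num//.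
    exact: coset_measurable.
  exact: integ_coset (rep_BN (ltn_ord i)) fi.
- by move=> i; exact: coset_measurable.
- exact: iota_uniq.
- exact: cosets_trivIset.
- by rewrite -BN_cosets; exact: measurable_int fi.
Qed.

(** Such a function takes at most p^n values on B_N; the sum of their absolute values serves as the
    bound. *)
Lemma coset_invariant_bounded n f : coset_invariant n f ->
  exists M : R, forall x, BN x -> `|f x| <= M.
Proof.
move=> fn; exists (\sum_(i < p ^ n) `|f (rep n i)|) => x.
rewrite (BN_cosets n) -bigcup_seq => -[i /=]; rewrite mem_iota add0n /= => ip xi.
rewrite (coset_invariantE fn xi) (bigD1 (Ordinal ip))//= lerDl.
by apply: sumr_ge0.
Qed.

Lemma bounded_integ f (M : R) : measurable_fun BN f ->
  (forall x, BN x -> `|f x| <= M) -> integ f.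
Proof.
move=> mf fM; apply: measurable_bounded_integrable => //; first exact: haar_BN_lty.
exists `|M|; split; first exact: num_real.
move=> e Me x xN; apply: le_trans (fM x xN) _.
by rewrite (le_trans (ler_norm _))// ltW.
Qed.

Lemma coset_invariant_integ n f : coset_invariant n f -> integ f.
Proof.
move=> fn; have [M fM] := coset_invariant_bounded fn.
by apply: bounded_integ fM; apply: coset_invariant_measurable fn.
Qed.

Lemma average_integ n f : integ (average n f).
Proof. exact/coset_invariant_integ/average_invariant. Qed.

Lemma invariant_mul_integ n f h : integ f -> coset_invariant n h -> integ (fun x => f x * h x).
Proof.
move=> fi hn; have [M hM] := coset_invariant_bounded hn.
apply: (@le_integrable _ _ _ _ _ mBN _ (fun x => (`|M| * f x)%:E)) => //.
- apply/measurable_EFinP; apply: measurable_funM.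
    by apply/measurable_EFinP; exact: measurable_int fi.
  exact: coset_invariant_measurable hn.
- move=> x xN /=; rewrite lee_fin !normrM mulrC normr_id ler_wpM2r//.
  by rewrite (le_trans (hM _ xN))// ler_norm.
- exact: integrableZlr.
Qed.

(** Averaging can be moved off a product whenever the other factor is constant on the same cosets.
    Preservation of the integral is the case h = 1, and the composition rule for averages is the
    case of an indicator. *)
Lemma Rintegral_average_mul n f h : integ f -> coset_invariant n h ->
  \int[haar]_(x in BN) (average n f x * h x) = \int[haar]_(x in BN) (f x * h x).
Proof.
move=> fi hn.
rewrite (Rintegral_cosets n); last exact: invariant_mul_integ (average_integ _ _) hn.
rewrite (Rintegral_cosets n); last exact: invariant_mul_integ hn.
apply: eq_bigr => i _; set c := rep n i.
rewrite (@eq_Rintegral _ _ _ _ _ (fun=> average n f c * h c)); last first.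
  move=> y; rewrite inE => cy.
  by rewrite (coset_invariantE hn cy) (coset_invariantE (@average_invariant n f) cy).
rewrite Rintegral_coset_cst.
rewrite [RHS](@eq_Rintegral _ _ _ _ _ (fun x => f x * h c)); last first.
  by move=> y; rewrite inE => cy; rewrite (coset_invariantE hn cy).
rewrite RintegralZr; [|exact: coset_measurable|]; last first.
  by apply: integ_coset => //; apply: rep_BN.
rewrite /average mulrC !mulrA -expfzDr ?pnatr_eq0 -?lt0n ?prime_gt0//.
by rewrite addrA subrK subrr expr0z mul1r.
Qed.

Lemma averageB n f g x : BN x -> integ f -> integ g ->
  average n (fun y => f y - g y) x = average n f x - average n g x.
Proof.
move=> xN fi gi; rewrite /average RintegralB ?mulrBr//.
- exact: coset_measurable.
- exact: integ_coset.
- exact: integ_coset.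
Qed.

Lemma averageZ n c f x : BN x -> integ f ->
  average n (fun y => c * f y) x = c * average n f x.
Proof.
move=> xN fi; rewrite /average RintegralZl 1?mulrCA//.
- exact: coset_measurable.
- exact: integ_coset.
Qed.

Lemma average_sum (I : Type) (s : seq I) (F : I -> Qp -> R) n x : BN x ->
  (forall i, integ (F i)) ->
  average n (fun y => \sum_(i <- s) F i y) x = \sum_(i <- s) average n (F i) x.
Proof.
move=> xN Fi; elim: s => [|a s IH].
  rewrite big_nil /average; under eq_Rintegral do rewrite big_nil.
  by rewrite Rintegral_cst ?mul0r ?mulr0//; exact: coset_measurable.
rewrite big_cons -IH /average -mulrDr -RintegralD.
- by under eq_Rintegral do rewrite big_cons.
- exact: coset_measurable.
- exact: integ_coset.
- by apply: integ_coset => //; exact: integrable_sumr.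
Qed.

Lemma average_normr n f x : BN x -> integ f ->
  `|average n f x| <= average n (fun y => `|f y|) x.
Proof.
move=> xN fi; rewrite normrM gtr0_norm// ler_wpM2l ?(ltW (pX_gt0 _))//.
by apply: le_normr_Rintegral; [exact: coset_measurable|exact: integ_coset].
Qed.

Lemma Rintegral_average n f : integ f ->
  \int[haar]_(x in BN) average n f x = \int[haar]_(x in BN) f x.
Proof.
move=> fi; have := @Rintegral_average_mul n f (fun=> 1) fi (fun _ _ _ => erefl).
under eq_Rintegral do rewrite mulr1.
by under [RHS]eq_Rintegral do rewrite mulr1.
Qed.

Lemma L1norm_average n f : integ f -> nrm (average n f) <= nrm f.
Proof.
move=> fi; rewrite -[leRHS](Rintegral_average n (integrable_normr fi)).
apply: le_Rintegral => //; first exact/integrable_normr/average_integ.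
  exact: average_integ.
by move=> x xN; exact: average_normr.
Qed.

Lemma indic_coset_invariant m n x : (m <= n)%N ->
  coset_invariant n (\1_(coset m x) : Qp -> R).
Proof.
move=> mn; apply: (coset_invariantS mn) => y z zm; rewrite !indicE.
congr (_%:R); congr nat_of_bool; apply/idP/idP; rewrite !inE /coset /= opprD addrA.
  by move=> /(padic_ball_addr _ ((padic_ballN _ _).2 zm)).
by move=> h; apply/(padic_ball_addr _ ((padic_ballN _ _).2 zm)).
Qed.

Lemma averageE n f x : BN x ->
  average n f x = p%:R ^ (n%:Z - N) * \int[haar]_(y in BN) (f y * \1_(coset n x) y).
Proof.
move=> xN; congr (_ * _).
rewrite -{1}(setIidr (@coset_sub n x xN)) Rintegral_mkcondr.
by apply: eq_Rintegral => y _; rewrite patch_indic.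
Qed.

(** If i <= j, the indicator of an i-coset is constant on j-cosets, so the inner averaging does not
    change its integral. If j < i, the inner average is already constant on i-cosets. *)
Lemma average_average i j f x : BN x -> integ f ->
  average i (average j f) x = average (minn i j) f x.
Proof.
move=> xN fi; case: (leqP i j) => ij; last first.
  by rewrite average_id//; apply: (coset_invariantS (ltnW ij)); exact: average_invariant.
rewrite !averageE// Rintegral_average_mul//; exact: indic_coset_invariant.
Qed.

Definition average_cvg f := forall e : R, 0 < e -> exists n0 : nat,
  forall n, (n0 <= n)%N -> nrm (fun x => average n f x - f x) <= e.

Lemma average_dist_integ n f : integ f -> integ (fun x => average n f x - f x).
Proof. by move=> fi; apply: integrableBr => //; exact: average_integ. Qed.

(** Since averages are L^1 contractions, the set of f with E_n f -> f is closed in L^1; this is the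
    usual argument with three terms. *)
Lemma average_cvg_approx f : integ f ->
  (forall e : R, 0 < e -> exists g, [/\ integ g, nrm (fun x => f x - g x) <= e & average_cvg g]) ->
  average_cvg f.
Proof.
move=> fi fa e e0; have e3 : 0 < e / 3 by rewrite divr_gt0.
have [g [gi fg /(_ _ e3)[n0 gn]]] := fa _ e3; exists n0 => n nn.
have h1 := L1norm_triangle mBN (average_integ n f) (average_integ n g) fi.
have h2 := L1norm_triangle mBN (average_integ n g) gi fi.
have h3 : nrm (fun x => average n f x - average n g x) <= nrm (fun x => f x - g x).
  apply: le_trans (L1norm_average n (integrableBr mBN fi gi)).
  rewrite le_eqVlt; apply/orP; left; apply/eqP; apply: eq_L1norm => x xN.
  by rewrite averageB.
have h4 := gn _ nn; rewrite L1normC in fg.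
by move: h1 h2 h3 h4 fg; rewrite (L1normC _ _ f g); lra.
Qed.

Lemma average_cvg_invariant m f : coset_invariant m f -> average_cvg f.
Proof.
move=> fm e e0; exists m => n mn.
rewrite (@eq_L1norm _ _ _ _ _ _ (fun=> 0)).
  by rewrite /L1norm normr0 Rintegral_cst// mul0r ltW.
by move=> x xN; rewrite average_id ?subrr//; apply: (coset_invariantS mn).
Qed.

Lemma average_cvgB f g : integ f -> integ g ->
  average_cvg f -> average_cvg g -> average_cvg (fun x => f x - g x).
Proof.
move=> fi gi fc gc e e0; have e2 : 0 < e / 2 by rewrite divr_gt0.
have [n1 h1] := fc _ e2; have [n2 h2] := gc _ e2; exists (maxn n1 n2) => n.
rewrite geq_max => /andP[/h1{}h1 /h2{}h2].
have := L1normB mBN (average_dist_integ n fi) (average_dist_integ n gi).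
rewrite (@eq_L1norm _ _ _ _ _ _ (fun x => average n (fun y => f y - g y) x - (f x - g x))).
  by lra.
by move=> x xN; rewrite averageB//; ring.
Qed.

Lemma average_cvgZ c f : integ f -> average_cvg f -> average_cvg (fun x => c * f x).
Proof.
move=> fi fc e e0; have e2 : 0 < e / (`|c| + 1) by rewrite divr_gt0// ltr_wpDl.
have [n0 h] := fc _ e2; exists n0 => n /h{}h.
rewrite (@eq_L1norm _ _ _ _ _ _ (fun x => c * (average n f x - f x))).
  rewrite L1normZ//; last exact: average_dist_integ.
  apply: (@le_trans _ _ (`|c| * (e / (`|c| + 1)))); first by rewrite ler_wpM2l.
  by rewrite mulrA ler_pdivrMr ?ltr_wpDl// mulrC ler_wpM2l ?(ltW e0)// lerDl.
by move=> x xN; rewrite averageZ// mulrBr.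
Qed.

Lemma average_cvg_sum (I : Type) (s : seq I) (F : I -> Qp -> R) :
  (forall i, integ (F i)) -> (forall i, average_cvg (F i)) ->
  average_cvg (fun x => \sum_(i <- s) F i x).
Proof.
move=> Fi Fc; elim: s => [|a s IH].
  apply: (@average_cvg_invariant 0) => x z _; by rewrite !big_nil.
have -> : (fun x => \sum_(i <- a :: s) F i x) =
    (fun x => F a x - (-1) * \sum_(i <- s) F i x).
  by apply/funext => x; rewrite big_cons mulN1r opprK.
apply: average_cvgB => //; first exact/integrableZlr/integrable_sumr.
by apply: average_cvgZ => //; exact: integrable_sumr.
Qed.

Lemma indic_integ (A : set Qp) : measurable A -> integ (\1_A : Qp -> R).
Proof.
move=> mA; apply: (@bounded_integ _ 1).
  by apply: measurable_funTS; exact: measurable_indic.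
by move=> x _; rewrite indicE ger0_norm ?ler0n// lern1; case: (_ \in _).
Qed.

(** Continuity from above, available because B_N has finite measure. *)
Lemma decreasing_indic_small (A : (set Qp)^nat) :
  (forall n, measurable (A n)) -> (forall m n, (m <= n)%N -> A n `<=` A m) ->
  \bigcap_n A n = set0 ->
  forall e : R, 0 < e -> exists n, nrm (\1_(A n)) <= e.
Proof.
move=> mA dA A0 e e0.
have : haar (BN `&` A n) @[n --> \oo] --> haar (\bigcap_n (BN `&` A n)).
  apply: nonincreasing_cvg_mu.
  - by apply: le_lt_trans haar_BN_lty; apply: le_measure; rewrite ?inE//; exact: measurableI.
  - by move=> n; exact: measurableI.
  - by apply: bigcap_measurable => // n _; exact: measurableI.
  - by move=> m n mn; apply/subsetPset; apply: setIS; exact: dA.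
rewrite (_ : \bigcap_n _ = set0) ?measure0; last first.
  apply/seteqP; split=> // x h.
  by rewrite -A0 => n _; have [] := h n I.
move=> /fine_cvgP[fn /cvgrPdist_le /(_ _ e0)].
move=> /(filterI fn)[n _ /(_ n (leqnn n))] [nfin /= ne]; exists n.
have -> : nrm (\1_(A n)) = fine (haar (BN `&` A n)).
  rewrite /L1norm /Rintegral; congr fine.
  under eq_integral => x _ do rewrite ger0_norm ?indicE ?ler0n//.
  by under eq_integral => x _ do rewrite -indicE; rewrite integral_indic// setIC.
by move: ne; rewrite sub0r normrN ger0_norm// fine_ge0.
Qed.

Lemma average_cvg_open (U : set Qp) : padic_open U -> average_cvg (\1_U : Qp -> R).
Proof.
move=> Uo; have mU := padic_open_measurable Uo.
apply: average_cvg_approx; first exact: indic_integ.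
move=> e e0.
(* [U] is the increasing union of the sets of points whose [n]-coset lies in [U]. *)
pose V n := [set x : Qp | forall z, padic_ball (N - n%:Z) z -> U (x + z)].
have Vz n x z : padic_ball (N - n%:Z) z -> V n (x + z) <-> V n x.
  move=> zn; split=> h y yn.
    by rewrite -(subrK z y) [y - z + z]addrC addrA; apply: h; apply: padic_ballB.
  by rewrite -addrA; apply: h; apply: padic_ballD.
have mV n : measurable (V n).
  apply: padic_open_measurable; apply: (@padic_ball_stable_open _ _ _ (N - n%:Z)) => x z Vx zn.
  by apply/Vz.
have VU n : V n `<=` U.
  by move=> x /(_ _ (padic_ball_center _ _)); rewrite addr0.
have [||| n nV] := @decreasing_indic_small (fun n => U `\` V n) _ _ _ e e0.
- by move=> n; apply: measurableD.
- move=> m n mn x [Ux Vx]; split=> // Vm; apply: Vx => z zn; apply: Vm.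
  by apply: padic_ball_le zn; rewrite lerB// lez_nat.
- apply/seteqP; split=> // x UV; have [Ux _] := UV 0%N I.
  have [k Uk] := Uo _ Ux.
  have [_ ] := UV `|N - k|%N I; apply=> z zn; apply: Uk; apply: padic_ball_le zn.
  by rewrite lerBlDr -lerBlDl; exact: ler_norm.
exists (\1_(V n)); split; first exact: indic_integ.
- rewrite (@eq_L1norm _ _ _ _ _ _ (\1_(U `\` V n)))// => x _.
  rewrite !indicE in_setD; case: (boolP (x \in V n)) => xV /=; last by rewrite andbT subr0.
  by rewrite andbF (mem_set (VU _ _ (set_mem xV))) subrr.
- apply: (@average_cvg_invariant n) => x z zn; rewrite !indicE; congr (_%:R); congr nat_of_bool.
  by apply/idP/idP; rewrite !inE => /(Vz _ _ _ zn).
Qed.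

Lemma average_cvg_indic (A : set Qp) : measurable A -> average_cvg (\1_A : Qp -> R).
Proof.
move: A; apply: (@dynkin_induction _ _ (@open Qp)) => //.
- by move=> A B Ao Bo; exact: openI.
- by apply: average_cvg_open; exact: padic_openT.
- by move=> U Uo; exact: average_cvg_open.
- move=> A mA Ac; have -> : (\1_(~` A) : Qp -> R) = (fun x => 1 - \1_A x).
    by apply/funext => x; rewrite !indicE in_setC; case: (_ \in _); rewrite ?subrr ?subr0.
  apply: average_cvgB => //; [|exact: indic_integ|].
    by apply: (@coset_invariant_integ 0).
  exact: (@average_cvg_invariant 0).
(* A disjoint countable union is approximated by its first n members; the remainder is the indicator
   of the union of the others, and these tails decrease to the empty set. *)
- move=> F mF tF Fc; apply: average_cvg_approx.
    by apply: indic_integ; exact: bigcupT_measurable.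
  move=> e e0.
  have [||| n nV] := @decreasing_indic_small (fun n => \bigcup_(k in [set k | (n <= k)%N]) F k) _ _ _ e e0.
  + by move=> n; exact: bigcup_measurable.
  + by move=> m n mn x [k /= nk xk]; exists k => //=; exact: leq_trans nk.
  + apply/seteqP; split=> // x h; have [k _ xk] := h 0%N I.
    have [j /= kj xj] := h k.+1 I.
    move/trivIsetP : tF => /(_ k j I I); rewrite neq_ltn kj /= => /(_ isT)/seteqP[+ _].
    by move=> /(_ x); apply.
  exists (fun x => \sum_(k < n) \1_(F k) x); split.
  + by apply: integrable_sumr => // k; exact: indic_integ.
  + rewrite (@eq_L1norm _ _ _ _ _ _ (\1_(\bigcup_(k in [set k | (n <= k)%N]) F k)))// => x _.
    (* By disjointness a point of the union belongs to exactly one F_k, so the difference at x is 0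
       or 1 according to whether k < n. *)
    have [[k _ xk]|xF] := pselect ((\bigcup_k F k) x); last first.
      rewrite !indicE !memNset//; last by move=> [k _ xk]; apply: xF; exists k.
      rewrite big1 ?subr0// => k _; rewrite indicE memNset// => xk; apply: xF.
      by exists k.
    have uniqk j : F j x -> j = k.
      move=> xj; apply: contrapT => /eqP jk; move/trivIsetP : tF => /(_ j k I I jk)/seteqP[+ _].
      by move=> /(_ x); apply.
    rewrite indicE mem_set; last by exists k.
    case: (ltnP k n) => kn.
      rewrite (bigD1 (Ordinal kn))//= indicE mem_set// big1 ?addr0 ?subrr; last first.
        move=> j jk; rewrite indicE memNset// => /uniqk jk'.
        by move: jk; rewrite -val_eqE /= jk' eqxx.
      by rewrite indicE memNset// => -[j /= nj /uniqk jk]; move: kn; rewrite -jk ltnNge nj.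
    rewrite big1 ?subr0; last first.
      move=> j _; rewrite indicE memNset// => /uniqk jk.
      by move: (ltn_ord j); rewrite jk ltnNge kn.
    by rewrite indicE mem_set//; exists k.
  + by apply: average_cvg_sum => k; [exact: indic_integ|exact: Fc].
Qed.

Import HBSimple.

(** Density of simple functions in L^1 reduces the claim to indicators. *)
Lemma average_cvgT f : integ f -> average_cvg f.
Proof.
move=> fi; apply: average_cvg_approx => // e e0.
have [g [gi _ gl1]] := approximation_sfun_integrable mBN fi.
move/fine_cvgP : gl1 => [gfin /cvgrPdist_le /(_ _ e0)].
move=> /(filterI gfin)[n _ /(_ n (leqnn n))] [nfin /= ne].
exists (g n); split; first exact: gi.
  move: ne; rewrite sub0r normrN => ne; apply: le_trans ne.
  by rewrite ler_norm.
have [s ->] : exists s : seq R, (g n : Qp -> R) =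
    (fun x => \sum_(y <- s) y * \1_(g n @^-1` [set y]) x).
  by eexists; apply/funext => x; rewrite {1}fimfunE fsbig_finite.
have mg (y : R) : measurable (g n @^-1` [set y]).
  by rewrite -[X in measurable X]setTI; exact: measurable_funP.
apply: average_cvg_sum => y.
  by apply: integrableZlr => //; exact: indic_integ.
by apply: average_cvgZ; [exact: indic_integ|exact: average_cvg_indic].
Qed.

End Average.

(** * Convolution with radial kernels *)

Section NonnegSeries.
Variable R : realType.

Lemma nneseries_finite_support (u : nat -> R) (m : nat) :
  (forall n, (m <= n)%N -> u n = 0) ->
  (\sum_(n <oo) (u n)%:E = (\sum_(n < m) u n)%:E)%E.
Proof.
move=> u0; apply/cvg_lim => //; apply: cvg_near_cst.
exists m => // n /= mn.
have tail0 : (\sum_(m <= i < n) (u i)%:E = 0)%E.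
  by rewrite big_nat big1// => i /andP[mi _]; rewrite u0.
by rewrite (big_cat_nat (leq0n m) mn)/= tail0 adde0 sumEFin big_mkord.
Qed.

(** Partial sums telescope to r_M - r_(M+n). This is the only place where the size of a tail is
    computed, so every later tail bound is r_M. *)
Lemma telescope_tail_le (r : nat -> R) (M : nat) : (forall n, 0 <= r n) ->
  (forall n, r n.+1 <= r n) ->
  (\sum_(n <oo) (r (M + n)%N - r (M + n).+1)%:E <= (r M)%:E)%E.
Proof.
move=> r0 rS; apply: lime_le.
  by apply: is_cvg_nneseries => n _ _; rewrite lee_fin subr_ge0.
apply: nearW => n; rewrite sumEFin lee_fin big_mkord.
suff -> : \sum_(i < n) (r (M + i)%N - r (M + i).+1) = r M - r (M + n)%N.
  by rewrite gerBl.
elim: n => [|n IH]; first by rewrite big_ord0 addn0 subrr.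
by rewrite big_ord_recr/= IH addnS; ring.
Qed.

(* Hence a divergent convolution takes the junk value [0]; it must still be
   measurable as a function of the base point. *)
Lemma Rintegral_nonintegrable d (T : measurableType d) (mu : {measure set T -> \bar R})
    (D : set T) (f : T -> R) : measurable D -> measurable_fun D f ->
  ~ mu.-integrable D (EFin \o f) -> \int[mu]_(x in D) f x = 0.
Proof.
move=> mD mf nf.
have mf' : measurable_fun D (EFin \o f) by exact/measurable_EFinP.
rewrite /Rintegral; have [h|] := boolP ((\int[mu]_(x in D) (f x)%:E)%E \is a fin_num).
  exfalso; apply: nf; apply/integrableP; split=> //.
  have := h; rewrite (integral_fin_num_abs mu mD)//.
by rewrite fin_numE negb_and !negbK => /orP[] /eqP ->.
Qed.

End NonnegSeries.

Section RadialKernel.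
Variables (R : realType) (p : nat) (p_pr : prime p).
Local Notation Qp := (padic p_pr).
Variables (haar : {measure set Qp -> \bar R}) (h_haar : is_haar haar) (N : int).
Implicit Types (x y z : Qp) (f g h : Qp -> R) (n M : nat).

Local Notation BN := (padic_ball N : set Qp).
Local Notation integ f := (haar.-integrable BN (EFin \o f)).
Local Notation nrm := (L1norm haar BN).
Local Notation avg := (average haar N).

Definition ball_density n y : R := p%:R ^ (n%:Z - N) * \1_(padic_ball (N - n%:Z)) y.

(** A common model for the heat kernel and for the kernel of the resolvent. In [kE] any M with y
    outside B_(N-M) may be used, since the densities of index at least M vanish at y; the formula
    says nothing at y = 0. *)
Variable r : nat -> R.
Hypothesis r_ge0 : forall n, 0 <= r n.
Hypothesis r_nonincreasing : forall n, r n.+1 <= r n.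

Local Notation b n := (r n - r n.+1).

Variable k : Qp -> R.
Hypothesis kE : forall y M, BN y -> ~ padic_ball (N - M%:Z) y ->
  k y = \sum_(n < M) b n * ball_density n y.

Let b_ge0 n : 0 <= b n. Proof. by rewrite subr_ge0. Qed.
Let mBN : measurable BN. Proof. exact: padic_ball_measurable. Qed.
Let pX_gt0 j : 0 < p%:R ^ j :> R.
Proof. by rewrite exprz_gt0// ltr0n prime_gt0. Qed.

Lemma ball_density_ge0 n y : 0 <= ball_density n y.
Proof. by rewrite mulr_ge0 ?(ltW (pX_gt0 _))// indicE ler0n. Qed.

Let density_ge0 n y : 0 <= b n * ball_density n y.
Proof. by apply: mulr_ge0 => //; exact: ball_density_ge0. Qed.

Let density_mul_ge0 n y (c : R) : 0 <= b n * ball_density n y * `|c|.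
Proof. by apply: mulr_ge0. Qed.

Lemma ball_density_coset n x y :
  ball_density n (x - y) = p%:R ^ (n%:Z - N) * \1_(coset N n x) y.
Proof. by congr (_ * _); rewrite !indicE; congr ((nat_of_bool _)%:R); apply/idP/idP; rewrite !inE. Qed.

Lemma ball_density_eq0 n M y : ~ padic_ball (N - M%:Z) y -> (M <= n)%N -> ball_density n y = 0.
Proof.
move=> yM Mn; rewrite /ball_density indicE memNset ?mulr0// => yn; apply: yM.
by apply: padic_ball_le yn; rewrite lerB// lez_nat.
Qed.

Lemma notin_small_ball y : y != 0 -> exists M : nat, ~ padic_ball (N - M%:Z) y.
Proof.
move=> /padic_notin_ball[j yj]; exists `|N - j|%N => h; apply: yj.
apply: padic_ball_le h; rewrite lerBlDr -lerBlDl; exact: ler_norm.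
Qed.

Lemma kernel_tail y M : BN y -> y != 0 ->
  (\sum_(n <oo) (b (M + n)%N * ball_density (M + n) y)%:E =
   (k y - \sum_(n < M) b n * ball_density n y)%:E)%E.
Proof.
move=> yN /notin_small_ball[m ym].
rewrite (@nneseries_finite_support _ _ m); last first.
  by move=> n mn; rewrite (ball_density_eq0 ym) ?mulr0// (leq_trans mn)// leq_addl.
congr EFin; have yMm : ~ padic_ball (N - (M + m)%N%:Z) y.
  by move=> h; apply: ym; apply: padic_ball_le h; rewrite lerB// lez_nat leq_addl.
by rewrite (kE yN yMm) big_split_ord/= addrAC subrr add0r.
Qed.

(* The convolution of [`|f|] with the tail of the kernel from index [M] on; it is
   [+oo] exactly where the convolution integral diverges. *)
Definition kernel_series M f x : \bar R :=
  (\sum_(n <oo) (b (M + n)%N * avg (M + n) (fun y => `|f y|) x)%:E)%E.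

Let avg_norm_ge0 n f x : 0 <= avg n (fun y => `|f y|) x.
Proof. by rewrite mulr_ge0 ?(ltW (pX_gt0 _))//; apply: Rintegral_ge0. Qed.

Lemma kernel_series_ge0 M f x : (0 <= kernel_series M f x)%E.
Proof.
by apply: nneseries_ge0 => n _ _; rewrite lee_fin mulr_ge0.
Qed.

Lemma kernel_series_measurable M f (D : set Qp) : measurable_fun D (kernel_series M f).
Proof.
apply: ge0_emeasurable_sum => [n x _ _|n _].
  by rewrite lee_fin mulr_ge0.
apply/measurable_EFinP; apply: measurable_funM; first exact: measurable_cst.
by apply: (@coset_invariant_measurable _ _ _ N (M + n)%N); exact: average_invariant.
Qed.

Lemma integral_density_term n f x : BN x -> integ f ->
  (\int[haar]_(y in BN) (b n * ball_density n (x - y) * `|f y|)%:E =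
   (b n * avg n (fun y => `|f y|) x)%:E)%E.
Proof.
move=> xN fi; have fi' := integrable_normr fi.
rewrite averageE// mulrA -RintegralZl//; last first.
  apply: (@invariant_mul_integ _ _ _ _ N n) => //.
  exact: indic_coset_invariant.
rewrite /Rintegral fineK; last first.
  apply: integrable_fin_num => //.
  apply: (@integrableZlr _ _ _ haar BN mBN _ (fun y => `|f y| * \1_(coset N n x) y)).
  apply: (@invariant_mul_integ _ _ _ _ N n) => //.
  exact: indic_coset_invariant.
apply: eq_integral => y _; rewrite ball_density_coset; congr EFin; ring.
Qed.

Lemma density_term_measurable n f x : integ f ->
  measurable_fun BN (fun y => (b n * ball_density n (x - y) * `|f y|)%:E).
Proof.
move=> fi; apply/measurable_EFinP; apply: measurable_funM; last first.
  apply: measurableT_comp => //; apply/measurable_EFinP; exact: measurable_int fi.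
under eq_fun do rewrite ball_density_coset mulrA.
apply: measurable_funM; first exact: measurable_cst.
by apply: measurable_funTS; apply: measurable_indic; exact: coset_measurable.
Qed.

Lemma integral_density_series M f x : BN x -> integ f ->
  (\int[haar]_(y in BN) \sum_(n <oo) (b (M + n)%N * ball_density (M + n) (x - y) * `|f y|)%:E =
   kernel_series M f x)%E.
Proof.
move=> xN fi; rewrite integral_nneseries//.
- by apply: eq_eseriesr => n _; exact: integral_density_term.
- by move=> n; exact: density_term_measurable.
- by move=> n y _; rewrite lee_fin density_mul_ge0.
Qed.

(** Extended by 0 outside B_N, the kernel is locally constant away from 0: the same finite sum
    computes it at y and at every point of a small ball around y. *)
Lemma kernel_measurable : measurable_fun BN k.
Proof.
suff : measurable_fun setT (fun y => if y \in BN then k y else 0).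
  move=> /(measurable_funS measurableT (@subsetT _ BN)).
  by apply: eq_measurable_fun => y yN; rewrite yN.
apply: (@padic_locally_constant_measurable _ _ _ _ _ 0) => y /notin_small_ball[m ym].
exists (N - m%:Z) => z zm.
have zN : BN z by apply: padic_ball_le zm; rewrite gerBl.
have yzm : ~ padic_ball (N - m%:Z) (y + z) by move=> /(padic_ball_addr _ zm).
have -> : ((y + z) \in BN) = (y \in BN).
  by apply/idP/idP; rewrite !inE => h; apply/(padic_ball_addr _ zN).
case: ifPn => //; rewrite inE => yN.
rewrite (kE yN ym) (@kE (y + z) m)//; last exact: padic_ballD.
apply: eq_bigr => i _; congr (_ * (_ * _)); rewrite !indicE; congr ((nat_of_bool _)%:R).
have zi : padic_ball (N - (i : nat)%:Z) z.
  by apply: padic_ball_le zm; rewrite lerB// lez_nat ltnW.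
by apply/idP/idP; rewrite !inE => h; apply/(padic_ball_addr _ zi).
Qed.

Lemma reflected_kernel_measurable x : BN x -> measurable_fun BN (fun y => k (x - y)).
Proof.
move=> xN; apply: (@measurable_comp _ _ _ _ _ _ BN) => //.
- by move=> _ [y yN <-]; exact: padic_ballB.
- exact: kernel_measurable.
- apply: measurable_funTS; exact: padic_reflection_measurable.
Qed.

Lemma kernel_mul_measurable x f : BN x -> integ f ->
  measurable_fun BN (fun y => k (x - y) * f y).
Proof.
move=> xN fi; apply: measurable_funM; first exact: reflected_kernel_measurable.
by apply/measurable_EFinP; exact: measurable_int fi.
Qed.

Definition truncated M y := k y - \sum_(n < M) b n * ball_density n y.

Lemma truncated_mul_measurable M x f : BN x -> integ f ->
  measurable_fun BN (fun y => truncated M (x - y) * f y).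
Proof.
move=> xN fi; apply: measurable_funM; last first.
  by apply/measurable_EFinP; exact: measurable_int fi.
apply: measurable_funB; first exact: reflected_kernel_measurable.
apply: measurable_sum => n; under eq_fun do rewrite ball_density_coset mulrA.
apply: measurable_funM; first exact: measurable_cst.
by apply: measurable_funTS; apply: measurable_indic; exact: coset_measurable.
Qed.

(** Off the diagonal y = x, which is a null set, the truncated kernel equals the nonnegative tail of
    the series, so the absolute value only affects f. *)
Lemma integral_truncated M x f : BN x -> integ f ->
  (\int[haar]_(y in BN) `|truncated M (x - y) * f y|%:E = kernel_series M f x)%E.
Proof.
move=> xN fi; rewrite -integral_density_series//.
apply: ge0_ae_eq_integral => //.
- apply/measurable_EFinP; apply: measurableT_comp => //; exact: truncated_mul_measurable.
- apply: ge0_emeasurable_sum => [n y _ _|n _]; last exact: density_term_measurable.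
  by rewrite lee_fin density_mul_ge0.
- by move=> y _; apply: nneseries_ge0 => n _ _; rewrite lee_fin density_mul_ge0.
- exists [set x]; split; [exact: padic_set1_measurable|exact: haar_set1|].
  move=> y /=; apply: contra_notP => /eqP yx yN.
  have xy0 : x - y != 0 by rewrite subr_eq0 eq_sym.
  have tE := kernel_tail M (padic_ballB xN yN) xy0.
  transitivity ((\sum_(n <oo) (b (M + n)%N * ball_density (M + n) (x - y))%:E) * `|f y|%:E)%E.
    rewrite tE -EFinM normrM ger0_norm// -lee_fin -tE.
    by apply: nneseries_ge0 => n _ _; rewrite lee_fin density_ge0.
  rewrite muleC -nneseriesZl//; last first.
    by move=> n _; rewrite lee_fin density_ge0.
  by apply: eq_eseriesr => n _; rewrite -EFinM mulrC.
Qed.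

Lemma truncated0 y : truncated 0 y = k y.
Proof. by rewrite /truncated big_ord0 subr0. Qed.

Lemma kernel_integrableP x f : BN x -> integ f ->
  integ (fun y => k (x - y) * f y) <-> (kernel_series 0 f x < +oo)%E.
Proof.
move=> xN fi; rewrite -integral_truncated//.
under eq_integral do rewrite truncated0.
split=> [/integrableP[]//|h]; apply/integrableP; split=> //.
by apply/measurable_EFinP; exact: kernel_mul_measurable.
Qed.

(** By Tonelli the sum and the integral are exchanged; each average preserves the integral of |f|,
    and the remaining weights telescope. With M = 0 this shows that the convolution converges almost
    everywhere. *)
Lemma integral_kernel_series M f : integ f ->
  (\int[haar]_(x in BN) kernel_series M f x <= (r M * nrm f)%:E)%E.
Proof.
move=> fi; have fi' := integrable_normr fi.
rewrite integral_nneseries//.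
- apply: (@le_trans _ _ (\sum_(n <oo) (nrm f)%:E * (b (M + n)%N)%:E))%E.
    rewrite le_eqVlt; apply/orP; left; apply/eqP; apply: eq_eseriesr => n _.
    transitivity ((b (M + n)%N)%:E * \int[haar]_(x in BN) (avg (M + n) (fun y => `|f y|) x)%:E)%E.
      rewrite -(integralZl mBN (average_integ h_haar N (M + n) (fun y => `|f y|)) (b (M + n)%N)).
      by apply: eq_integral => x _; rewrite EFinM.
    rewrite -[X in (_ * X)%E]fineK; last first.
      by apply: integrable_fin_num => //; exact: (average_integ h_haar).
    by rewrite muleC; congr (_%:E * _)%E; exact: (Rintegral_average h_haar (M + n)%N fi').
  rewrite nneseriesZl//; last by move=> n _; rewrite lee_fin.
  rewrite mulrC EFinM; apply: lee_wpmul2l; first by rewrite lee_fin L1norm_ge0.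
  exact: telescope_tail_le.
- move=> n; apply/measurable_EFinP; apply: measurable_funM; first exact: measurable_cst.
  by apply: (@coset_invariant_measurable _ _ _ N (M + n)%N); exact: average_invariant.
- by move=> n x _; rewrite lee_fin mulr_ge0.
Qed.

Lemma kernel_series_lty f : integ f ->
  {ae haar, forall x, BN x -> (kernel_series 0 f x < +oo)%E}.
Proof.
move=> fi; have : haar.-integrable BN (kernel_series 0 f).
  apply/integrableP; split; first exact: kernel_series_measurable.
  under eq_integral do rewrite gee0_abs ?kernel_series_ge0//.
  by apply: le_lt_trans (integral_kernel_series 0 fi) _; rewrite ltry.
move=> /(integrable_ae mBN); apply: filterS => x h xN.
by have := h xN; rewrite fin_numElt => /andP[].
Qed.

Definition kernel_conv f x := \int[haar]_(y in BN) (k (x - y) * f y).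

Lemma kernel_conv_dist M f x : BN x -> integ f -> (kernel_series 0 f x < +oo)%E ->
  ((`|kernel_conv f x - \sum_(n < M) b n * avg n f x|)%:E <= kernel_series M f x)%E.
Proof.
move=> xN fi xlty; have ki : integ (fun y => k (x - y) * f y) by exact/kernel_integrableP.
have ti n : integ (fun y => b n * p%:R ^ (n%:Z - N) * (f y * \1_(coset N n x) y)).
  apply: (@integrableZlr _ _ _ haar BN mBN).
  apply: (@invariant_mul_integ _ _ _ _ N n) => //; exact: indic_coset_invariant.
have fci n : integ (fun y => f y * \1_(coset N n x) y).
  apply: (@invariant_mul_integ _ _ _ _ N n) => //; exact: indic_coset_invariant.
have si : integ (fun y => \sum_(n < M) b n * p%:R ^ (n%:Z - N) * (f y * \1_(coset N n x) y)).
  exact: (@integrable_sumr _ _ _ haar BN mBN _ (index_enum _) (fun n : 'I_M => _)).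
have -> : kernel_conv f x - \sum_(n < M) b n * avg n f x =
    \int[haar]_(y in BN) (truncated M (x - y) * f y).
  transitivity (\int[haar]_(y in BN) (k (x - y) * f y -
      \sum_(n < M) b n * p%:R ^ (n%:Z - N) * (f y * \1_(coset N n x) y))).
    rewrite RintegralB//; congr (_ - _).
    have : forall (s : seq 'I_M), \sum_(n <- s) b n * avg n f x =
        \int[haar]_(y in BN) \sum_(n <- s) b n * p%:R ^ (n%:Z - N) * (f y * \1_(coset N n x) y).
      elim=> [|a s IH].
        rewrite big_nil; under eq_Rintegral do rewrite big_nil.
        by rewrite Rintegral_cst// mul0r.
      rewrite big_cons IH; under [RHS]eq_Rintegral do rewrite big_cons.
      rewrite RintegralD//; last first.
        exact: (@integrable_sumr _ _ _ haar BN mBN _ s (fun n : 'I_M => _)).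
      by rewrite RintegralZl// averageE// mulrA.
    by move=> ->.
  apply: eq_Rintegral => y _; rewrite /truncated mulrBl mulr_suml; congr (_ - _).
  by apply: eq_bigr => n _; rewrite ball_density_coset; ring.
rewrite -integral_truncated//.
have ti' : integ (fun y => truncated M (x - y) * f y).
  have := integrableBr mBN ki si; apply: eq_in_integrable => // y yN.
  rewrite /truncated mulrBl mulr_suml; congr (_ - _).
  by apply: eq_bigr => n _; rewrite ball_density_coset; ring.
rewrite EFin_normr_Rintegral//; apply: le_abse_integral => //.
exact: measurable_int ti'.
Qed.

Lemma kernel_conv_cvg f x : BN x -> integ f -> (kernel_series 0 f x < +oo)%E ->
  \sum_(n < M) b n * avg n f x @[M --> \oo] --> kernel_conv f x.
Proof.
move=> xN fi xlty; apply/cvgrPdist_le => e e0.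
have ge0 n : (0 <= (b n * avg n (fun y => `|f y|) x)%:E)%E by rewrite lee_fin mulr_ge0.
have := @nneseries_tail_cvg _ (fun n => (b n * avg n (fun y => `|f y|) x)%:E) xpredT.
rewrite -[X in (X < +oo)%E -> _]/(kernel_series 0 f x) => /(_ xlty (fun n _ => ge0 n)).
move=> /fine_cvgP[tfin /cvgrPdist_le /(_ _ e0)] tle.
near=> M.
have tM : (\sum_(M <= n <oo) (b n * avg n (fun y => `|f y|) x)%:E)%E = kernel_series M f x.
  rewrite -{1}(add0n M) -nneseries_addn; last by move=> i; exact: ge0.
  by apply: eq_eseriesr => n _; rewrite addnC.
have : (\sum_(M <= n <oo) (b n * avg n (fun y => `|f y|) x)%:E)%E \is a fin_num.
  by near: M.
rewrite tM => fM; have := kernel_conv_dist M xN fi xlty.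
rewrite -(fineK fM) lee_fin => /le_trans; apply.
rewrite -tM; apply: le_trans (ler_norm _) _.
rewrite -normrN -sub0r; near: M; exact: tle.
Unshelve. all: by end_near. Qed.

(** Where the series of [|f|] is finite the convolution is a pointwise limit of measurable partial
    sums; elsewhere it is 0. Multiplying the partial sums by the indicator of the good set covers
    both cases with one limit. *)
Lemma kernel_conv_measurable f : integ f -> measurable_fun BN (kernel_conv f).
Proof.
move=> fi.
pose good := BN `&` [set x | (kernel_series 0 f x < +oo)%E].
have mgood : measurable good.
  by apply: emeasurable_fun_infty_o => //; exact: kernel_series_measurable.
apply: (@measurable_fun_cvg _ _ _ BN
  (fun M x => (\sum_(n < M) b n * avg n f x) * \1_good x)) => [M|x xN].
  apply: measurable_funM; last exact: measurable_indic.
  apply: measurable_sum => n; apply: measurable_funM; first exact: measurable_cst.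
  by apply: (@coset_invariant_measurable _ _ _ N n); exact: average_invariant.
have [xg|xg] := pselect (kernel_series 0 f x < +oo)%E.
  have -> : (fun M : nat => (\sum_(n < M) b n * avg n f x) * \1_good x) =
      (fun M => \sum_(n < M) b n * avg n f x).
    by apply/funext => M; rewrite indicE mem_set ?mulr1//; split.
  exact: kernel_conv_cvg.
have -> : (fun M : nat => (\sum_(n < M) b n * avg n f x) * \1_good x) = (fun=> 0).
  by apply/funext => M; rewrite indicE memNset ?mulr0// => -[].
rewrite /kernel_conv Rintegral_nonintegrable//; first exact: cvg_cst.
  exact: kernel_mul_measurable.
by move/kernel_integrableP => /(_ xN fi).
Qed.

Lemma kernel_conv_junk f x : BN x -> integ f -> ~ (kernel_series 0 f x < +oo)%E ->
  kernel_conv f x = 0.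
Proof.
move=> xN fi xg; apply: Rintegral_nonintegrable => //; first exact: kernel_mul_measurable.
by move/kernel_integrableP => /(_ xN fi).
Qed.

Lemma kernel_conv_sub_norm M f : integ f ->
  (\int[haar]_(x in BN) `|kernel_conv f x - \sum_(n < M) b n * avg n f x|%:E
     <= (r M * nrm f)%:E)%E.
Proof.
move=> fi; apply: le_trans (integral_kernel_series M fi).
apply: ae_ge0_le_integral => //.
- apply/measurable_EFinP; apply: measurableT_comp => //; apply: measurable_funB.
    exact: kernel_conv_measurable.
  apply: measurable_sum => n; apply: measurable_funM; first exact: measurable_cst.
  by apply: (@coset_invariant_measurable _ _ _ N n); exact: average_invariant.
- by move=> x _; exact: kernel_series_ge0.
- exact: kernel_series_measurable.
- by apply: filterS (kernel_series_lty fi) => x h xN; apply: kernel_conv_dist => //; exact: h.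
Qed.

Lemma kernel_conv_integ f : integ f -> integ (kernel_conv f).
Proof.
move=> fi; apply/integrableP; split.
  by apply/measurable_EFinP; exact: kernel_conv_measurable.
have := kernel_conv_sub_norm 0 fi.
under eq_integral do rewrite big_ord0 subr0.
by move=> /le_lt_trans; apply; rewrite ltry.
Qed.

Lemma L1norm_kernel_conv_sub M f : integ f ->
  nrm (fun x => kernel_conv f x - \sum_(n < M) b n * avg n f x) <= r M * nrm f.
Proof.
move=> fi; rewrite -lee_fin L1normE ?kernel_conv_sub_norm//.
apply: integrableBr => //; first exact: kernel_conv_integ.
apply: (@integrable_sumr _ _ _ haar BN mBN _ (index_enum _) (fun (n : 'I_M) x => b n * avg n f x)) => n.
by apply: integrableZlr => //; exact: average_integ.
Qed.

End RadialKernel.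

(** * Semigroup and resolvent as functions of the averages *)

Section ScalarEstimates.
Variable R : realType.

(** Group the pairs (i, j) by n = min(i, j): the pairs with both indices at least n have total
    weight (a_n - a_M)(b_n - b_M). For the operators this says that composing two sums of averages
    multiplies their multipliers, up to the cut at M. *)
Lemma abel_min_sum (a b F : nat -> R) M :
  \sum_(i < M) \sum_(j < M) (a i - a i.+1) * (b j - b j.+1) * F (minn i j) =
  \sum_(n < M) ((a n - a M) * (b n - b M) - (a n.+1 - a M) * (b n.+1 - b M)) * F n.
Proof.
elim: M => [|M IH]; first by rewrite !big_ord0.
rewrite big_ord_recr/= [in RHS]big_ord_recr/=.
have -> : \sum_(i < M) \sum_(j < M.+1) (a i - a i.+1) * (b j - b j.+1) * F (minn i j) =
    \sum_(i < M) \sum_(j < M) (a i - a i.+1) * (b j - b j.+1) * F (minn i j) +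
    \sum_(i < M) (a i - a i.+1) * (b M - b M.+1) * F i.
  rewrite -big_split/=; apply: eq_bigr => i _; rewrite big_ord_recr/=; congr (_ + _ * F _).
  by apply/minn_idPl; exact: ltnW.
rewrite IH big_ord_recr/= minnn addrA; congr (_ + _); last by ring.
rewrite -!big_split/=; apply: eq_bigr => i _.
have -> : minn M i = i by apply/minn_idPr; exact: ltnW.
by ring.
Qed.

Lemma telescope_ord (a : nat -> R) M : \sum_(i < M) (a i - a i.+1) = a 0%N - a M.
Proof.
elim: M => [|M IH]; first by rewrite big_ord0 subrr.
by rewrite big_ord_recr/= IH; ring.
Qed.

Lemma expRN_le1Bx (s : R) : 0 <= s -> 1 - expR (- s) <= s.
Proof. by move=> s0; have := expR_ge1Dx (- s); lra. Qed.

(** This is the monotonicity of (1 - e^(-s))/s with denominators cleared, so that s = 0 is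
    allowed. *)
Lemma expRN_concave (s s' : R) : 0 <= s -> s <= s' ->
  s * (1 - expR (- s')) <= s' * (1 - expR (- s)).
Proof.
move=> s0 ss'; have d0 : 0 <= s' - s by rewrite subr_ge0.
have h1 := expRN_le1Bx d0.
have -> : expR (- s') = expR (- s) * expR (- (s' - s)) by rewrite -expRD; congr expR; ring.
set E := expR (- s); set E' := expR (- (s' - s)).
have E0 : 0 < E by exact: expR_gt0.
have h2 : E * (1 + s) <= 1.
  have := expR_ge1Dx s; rewrite -(ler_pM2l E0) /E -expRD addNr expR0.
  by [].
have h3 : s * E * (1 - E') <= s * E * (s' - s) by rewrite ler_wpM2l// mulr_ge0// ltW.
have h4 : 0 <= (s' - s) * (1 - E * (1 + s)) by rewrite mulr_ge0// subr_ge0.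
rewrite -subr_ge0.
have -> : s' * (1 - E) - s * (1 - E * E') =
  (s * E * (s' - s) - s * E * (1 - E')) + (s' - s) * (1 - E * (1 + s)) by ring.
by rewrite addr_ge0// subr_ge0.
Qed.

Lemma expRN_ge_quad (s : R) : 0 <= s -> s - s ^+ 2 <= 1 - expR (- s).
Proof.
move=> s0; have s1 : 0 < 1 + s by rewrite ltr_wpDr.
have : expR (- s) <= (1 + s)^-1.
  by rewrite expRN lef_pV2 ?posrE ?expR_gt0// expR_ge1Dx.
suff : (1 + s)^-1 <= 1 - s + s ^+ 2 by lra.
rewrite -(ler_pM2r s1) mulVf ?gt_eqF//.
have : 0 <= s ^+ 3 by rewrite exprn_ge0.
have -> : (1 - s + s ^+ 2) * (1 + s) = 1 + s ^+ 3 by ring.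
by lra.
Qed.

(** Put g(l) = (1 - e^(-tl))/t, the eigenvalue of (1 - T_N(t))/t. After cross multiplication the
    claim is the sum of mu (g(l') - g(l)) <= mu (l' - l), since g is 1-Lipschitz, and l g(l') <= l'
    g(l), by concavity. *)
Lemma yosida_symbol_nonincreasing (mu t l l' : R) : 0 < mu -> 0 < t -> 0 <= l -> l <= l' ->
  (mu + (1 - expR (- (t * l'))) / t) / (mu + l') <= (mu + (1 - expR (- (t * l))) / t) / (mu + l).
Proof.
move=> mu0 t0 l0 ll'.
have l'0 := le_trans l0 ll'.
have tl0 : 0 <= t * l by rewrite mulr_ge0// ltW.
have tll' : t * l <= t * l' by rewrite ler_pM2l.
have [p1 p2] : 0 < mu + l /\ 0 < mu + l' by split; rewrite ltr_wpDr.
rewrite ler_pdivrMr// mulrAC ler_pdivlMr//.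
set g := (1 - expR (- (t * l))) / t; set g' := (1 - expR (- (t * l'))) / t.
have h1 : g' - g <= l' - l.
  rewrite -mulrBl ler_pdivrMr//.
  have -> : expR (- (t * l')) = expR (- (t * l)) * expR (- (t * (l' - l))).
    by rewrite -expRD; congr expR; ring.
  have h : 0 <= t * (l' - l) by rewrite mulr_ge0 ?subr_ge0// ltW.
  have := expRN_le1Bx h; set E' := expR (- (t * (l' - l))) => hE.
  have E1 : expR (- (t * l)) <= 1 by rewrite -expR0 ler_expR oppr_le0.
  have E0 : 0 <= expR (- (t * l)) by exact: expR_ge0.
  have E'1 : 0 <= 1 - E' by rewrite subr_ge0 -expR0 ler_expR oppr_le0.
  have := ler_wpM2r E'1 E1; lra.
have h2 : l * g' <= l' * g.
  rewrite !mulrA ler_pdivrMr// divfK ?gt_eqF//.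
  have := expRN_concave tl0 tll'; rewrite -!mulrA ler_pM2l//.
have := ler_wpM2l (ltW mu0) h1; nra.
Qed.

(** The left side is (l - g(l))/(mu + l), with l - g(l) <= t l^2 by the second order bound for the
    exponential. *)
Lemma yosida_symbol_near1 (mu t l : R) : 0 < mu -> 0 < t -> 0 <= l ->
  1 - (mu + (1 - expR (- (t * l))) / t) / (mu + l) <= t * (l ^+ 2 / mu).
Proof.
move=> mu0 t0 l0; have ml : 0 < mu + l by rewrite ltr_wpDr.
have tl0 : 0 <= t * l by rewrite mulr_ge0// ltW.
have -> : 1 - (mu + (1 - expR (- (t * l))) / t) / (mu + l) =
   (l - (1 - expR (- (t * l))) / t) / (mu + l) by field; rewrite !gt_eqF.
rewrite ler_pdivrMr//; apply: (@le_trans _ _ (t * l ^+ 2)).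
  have := expRN_ge_quad tl0; rewrite -[X in X <= _ -> _](divfK (lt0r_neq0 t0)) => h.
  rewrite lerBlDr -lerBlDl ler_pdivlMr//; apply: le_trans h; rewrite divfK ?gt_eqF//.
  by rewrite le_eqVlt; apply/orP; left; apply/eqP; ring.
rewrite -mulrA ler_wpM2l ?(ltW t0)// mulrAC -mulrA -[leLHS]mulr1 ler_wpM2l ?exprn_ge0//.
by rewrite ler_pdivlMr// mul1r lerDl.
Qed.

End ScalarEstimates.

Section RadialSemigroup.
Variables (R : realType) (p : nat) (p_pr : prime p).
Local Notation Qp := (padic p_pr).
Variables (haar : {measure set Qp -> \bar R}) (h_haar : is_haar haar) (N : int).
Implicit Types (x y z : Qp) (f g h : Qp -> R) (n M : nat) (t : R).

Local Notation BN := (padic_ball N : set Qp).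
Local Notation integ f := (haar.-integrable BN (EFin \o f)).
Local Notation nrm := (L1norm haar BN).
Local Notation avg := (average haar N).
Local Notation density := (@ball_density R p p_pr N).
Local Notation conv := (kernel_conv haar N).

Variables (mu : R) (mu_gt0 : 0 < mu) (lam : nat -> R).
Hypothesis lam0 : lam 0%N = 0.
Hypothesis lam_nondecreasing : forall n, lam n <= lam n.+1.
Hypothesis lam_pinfty : lam n @[n --> \oo] --> +oo.

(** Multipliers: a sum of (r_i - r_(i+1)) E_i acts on the range of E_n - E_(n-1) as the tail sum
    from i = n on, that is as r_n when r tends to 0. Thus [m t] belongs to the semigroup and [r] to
    the resolvent. *)
Let m t n : R := expR (- (t * lam n)).
Let r n : R := (mu + lam n)^-1.

Variables (heat : R -> Qp -> R) (green : Qp -> R).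
Hypothesis heatE : forall t y M, 0 < t -> BN y -> ~ padic_ball (N - M%:Z) y ->
  heat t y = \sum_(n < M) (expR (- (t * lam n)) - expR (- (t * lam n.+1))) * density n y.
Hypothesis greenE : forall y M, BN y -> ~ padic_ball (N - M%:Z) y ->
  green y = \sum_(n < M) ((mu + lam n)^-1 - (mu + lam n.+1)^-1) * density n y.

Let mBN : measurable BN. Proof. exact: padic_ball_measurable. Qed.

Let lam_ge0 n : 0 <= lam n.
Proof. by elim: n => [|n IH]; rewrite ?lam0// (le_trans IH). Qed.

Let mul_gt0 n : 0 < mu + lam n.
Proof. by rewrite ltr_wpDr. Qed.

Let r_ge0 n : 0 <= r n.
Proof. by rewrite invr_ge0 ltW. Qed.

Let r_nonincreasing n : r n.+1 <= r n.
Proof. by rewrite lef_pV2 ?posrE// lerD2l. Qed.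

Let m_ge0 t n : 0 <= m t n.
Proof. exact: expR_ge0. Qed.

Let m_nonincreasing t n : 0 < t -> m t n.+1 <= m t n.
Proof. by move=> t0; rewrite ler_expR lerN2 ler_pM2l. Qed.

Let m0 t : m t 0 = 1.
Proof. by rewrite /m lam0 mulr0 oppr0 expR0. Qed.

Let r_cvg0 : r n @[n --> \oo] --> (0 : R).
Proof.
apply/cvgrPdist_le => e e0.
have /cvgryPge/(_ e^-1) := lam_pinfty; apply: filterS => n le.
rewrite sub0r normrN ger0_norm// -[leRHS]invrK lef_pV2 ?posrE ?invr_gt0//.
by rewrite (le_trans le)// lerDr ltW.
Qed.

Let m_cvg0 t : 0 < t -> m t n @[n --> \oo] --> (0 : R).
Proof.
move=> t0; apply/cvgrPdist_le => e e0.
have /cvgryPge/(_ (t * e)^-1) := lam_pinfty; apply: filterS => n le.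
rewrite sub0r normrN ger0_norm// /m expRN -[leRHS]invrK lef_pV2 ?posrE ?invr_gt0 ?expR_gt0//.
apply: le_trans (expR_ge1Dx _); rewrite (@le_trans _ _ (t * lam n)) ?lerDr//.
move: le; rewrite -(ler_pM2l t0); apply: le_trans.
by rewrite invfM mulrA mulfV ?gt_eqF// mul1r.
Qed.

(** The remainder estimate with no average removed; the contraction constant is the first weight m_0
    = 1, which is where lam_0 = 0 enters. *)
Lemma L1norm_semigroup_le t f : 0 < t -> integ f -> nrm (conv (heat t) f) <= nrm f.
Proof.
move=> t0 fi; have := L1norm_kernel_conv_sub h_haar (m_ge0 t)
  (fun n => m_nonincreasing n t0) (fun y M => @heatE t y M t0) 0 fi.
rewrite m0 mul1r; congr (_ <= _); apply: eq_L1norm => x _.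
by rewrite big_ord0 subr0.
Qed.

Lemma semigroup_integ t f : 0 < t -> integ f -> integ (conv (heat t) f).
Proof.
move=> t0 fi; exact: (kernel_conv_integ h_haar (m_ge0 t)
  (fun n => m_nonincreasing n t0) (fun y M => @heatE t y M t0) fi).
Qed.

Lemma semigroup_ae_integrable t f : 0 < t -> integ f ->
  {ae haar, forall x, BN x -> integ (fun y => heat t (x - y) * f y)}.
Proof.
move=> t0 fi; apply: filterS (kernel_series_lty h_haar (m_ge0 t)
  (fun n => m_nonincreasing n t0) fi) => x h xN.
apply: (kernel_integrableP h_haar
  (fun n => m_nonincreasing n t0) (fun y M => @heatE t y M t0) xN fi).2.
exact: h.
Qed.

(** The contraction bound for f - g cannot be quoted directly: the convolution of the difference
    equals the difference of the convolutions only at points where both converge. *)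
Lemma L1norm_semigroupB t f g : 0 < t -> integ f -> integ g ->
  nrm (fun x => conv (heat t) f x - conv (heat t) g x) <= nrm (fun x => f x - g x).
Proof.
move=> t0 fi gi; apply: le_trans (L1norm_semigroup_le t0 (integrableBr mBN fi gi)).
rewrite le_eqVlt; apply/orP; left; apply/eqP; apply: ae_eq_L1norm => //.
- by apply: integrableBr => //; exact: semigroup_integ.
- by apply: semigroup_integ => //; exact: integrableBr.
- apply: filterS2 (semigroup_ae_integrable t0 fi) (semigroup_ae_integrable t0 gi) => x fx gx xN.
  rewrite /kernel_conv -RintegralB//; [|exact: fx|exact: gx].
  by apply: eq_Rintegral => y _; rewrite mulrBr.
Qed.

Section Resolvent.
Variable f : Qp -> R.
Hypothesis fi : integ f.

Let w := conv green f.
(** Truncations such as this one and [TwM] are finite sums, for which linearity and composition of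
    averages are exact at every point of B_N. *)
Let wM M x := \sum_(n < M) (r n - r n.+1) * avg n f x.

Let ai n : integ (avg n f). Proof. exact: average_integ. Qed.
Let cai c n : integ (fun x => c * avg n f x). Proof. exact: integrableZlr. Qed.
Let cai' c n i : integ (fun x => c * avg i (avg n f) x).
Proof. by apply: integrableZlr => //; exact: average_integ. Qed.

Let sum_integ (M : nat) (F : nat -> Qp -> R) : (forall n, integ (F n)) ->
  integ (fun x => \sum_(n < M) F n x).
Proof. by move=> Fi; exact: (@integrable_sumr _ _ _ haar BN mBN _ _ (fun n : 'I_M => F n)). Qed.

Let L1norm_ord_sum (M : nat) (F : nat -> Qp -> R) : (forall n, integ (F n)) ->
  nrm (fun x => \sum_(n < M) F n x) <= \sum_(n < M) nrm (F n).
Proof. by move=> Fi; exact: (@L1norm_sum _ _ _ haar BN mBN _ _ (fun n : 'I_M => F n)). Qed.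

Lemma resolvent_integ : integ w.
Proof. exact: (kernel_conv_integ h_haar r_ge0 r_nonincreasing greenE fi). Qed.

Let wMi M : integ (wM M). Proof. exact: (@sum_integ M (fun n x => (r n - r n.+1) * avg n f x)). Qed.

Let w_wM M : nrm (fun x => w x - wM M x) <= r M * nrm f.
Proof. exact: (L1norm_kernel_conv_sub h_haar r_ge0 r_nonincreasing greenE M fi). Qed.

Let nrm_combination M (c : nat -> R) : (forall n, 0 <= c n) ->
  nrm (fun x => \sum_(n < M) c n * avg n f x) <= (\sum_(n < M) c n) * nrm f.
Proof.
move=> c0; apply: le_trans (@L1norm_ord_sum M (fun n x => c n * avg n f x) _) _ => //.
rewrite mulr_suml; apply: ler_sum => n _; rewrite L1normZ// ger0_norm//.
by rewrite ler_wpM2l//; exact: L1norm_average.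
Qed.

Let nrm_wM M : nrm (wM M) <= r 0%N * nrm f.
Proof.
apply: le_trans (@nrm_combination M (fun n => r n - r n.+1) _) _; first by move=> n; rewrite subr_ge0.
by rewrite telescope_ord ler_wpM2r ?L1norm_ge0// gerBl.
Qed.

Let TwM t M x := \sum_(i < M) (m t i - m t i.+1) * avg i (wM M) x.

Let TwMi t M : integ (TwM t M).
Proof.
apply: (@sum_integ M (fun i x => (m t i - m t i.+1) * avg i (wM M) x)) => n.
by apply: integrableZlr => //; exact: average_integ.
Qed.

(** The term r_M comes from replacing w by its truncation under the contraction T_N(t), and m_M r_0
    from truncating the heat kernel, since the truncated w has norm at most r_0 times that of f. *)
Let Tw_TwM t M : 0 < t ->
  nrm (fun x => conv (heat t) w x - TwM t M x) <= (r M + m t M * r 0%N) * nrm f.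
Proof.
move=> t0.
have h1 := L1norm_triangle mBN (semigroup_integ t0 resolvent_integ)
  (semigroup_integ t0 (wMi M)) (TwMi t M).
have h2 := le_trans (L1norm_semigroupB t0 resolvent_integ (wMi M)) (w_wM M).
have h3 := L1norm_kernel_conv_sub h_haar (m_ge0 t)
  (fun n => m_nonincreasing n t0) (fun y M => @heatE t y M t0) M (wMi M).
apply: le_trans h1 _; rewrite mulrDl; apply: lerD; first exact: h2.
apply: le_trans h3 _; rewrite -mulrA ler_wpM2l//; exact: nrm_wM.
Qed.

Let TwME t M x : BN x -> TwM t M x =
  \sum_(n < M) ((m t n - m t M) * (r n - r M) - (m t n.+1 - m t M) * (r n.+1 - r M)) * avg n f x.
Proof.
move=> xN; rewrite -(abel_min_sum (m t) r (fun n => avg n f x)).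
apply: eq_bigr => i _.
rewrite /wM (@average_sum _ _ _ haar N 'I_M (index_enum _) (fun j y => (r j - r j.+1) * avg j f y))//.
rewrite mulr_sumr; apply: eq_bigr => j _.
by rewrite averageZ// average_average// mulrA.
Qed.

Let q t n : R := (mu + (1 - m t n) / t) / (mu + lam n).

Let q_nonincreasing t n : 0 < t -> q t n.+1 <= q t n.
Proof. by move=> t0; apply: yosida_symbol_nonincreasing. Qed.

Let q_ge0 t n : 0 < t -> 0 <= q t n.
Proof.
move=> t0; rewrite divr_ge0 ?(ltW (mul_gt0 _))// addr_ge0 ?(ltW mu_gt0)//.
rewrite divr_ge0 ?(ltW t0)// subr_ge0 -expR0 ler_expR oppr_le0 mulr_ge0//; exact: ltW.
Qed.

Let q0 t : q t 0 = 1.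
Proof. by rewrite /q m0 lam0 subrr mul0r !addr0 mulfV// gt_eqF. Qed.

Let VM t M x := t^-1 * (wM M x - TwM t M x) + mu * wM M x - f x.

(** The first sum is the combination of E_n f - f with weights q_n - q_(n+1), of total mass 1 - q_M.
    The other terms are the price of the cut at M: each carries a factor r_M, m_M or q_M. *)
Let VME t M x : 0 < t -> BN x -> VM t M x =
  \sum_(n < M) (q t n - q t n.+1) * (avg n f x - f x) +
  t^-1 * (\sum_(n < M) (r M * (m t n - m t n.+1) + m t M * (r n - r n.+1)) * avg n f x)
  - q t M * f x.
Proof.
move=> t0 xN; rewrite /VM TwME// /wM.
have -> : \sum_(n < M) (q t n - q t n.+1) * (avg n f x - f x) =
    \sum_(n < M) (q t n - q t n.+1) * avg n f x - (1 - q t M) * f x.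
  rewrite -(q0 t) -telescope_ord mulr_suml -sumrB.
  by apply: eq_bigr => n _; rewrite mulrBr.
rewrite -sumrB !mulr_sumr.
have -> (a b c d : R) : a - (1 - b) * c + d - b * c = a + d - c by ring.
congr (_ - _); rewrite -!big_split/=; apply: eq_bigr => n _.
by rewrite /q /r; field; rewrite !gt_eqF.
Qed.

Let VM_norm t M : 0 < t -> nrm (VM t M) <=
  \sum_(n < M) (q t n - q t n.+1) * nrm (fun x => avg n f x - f x) +
  (t^-1 * (r M + m t M * r 0%N) + q t M) * nrm f.
Proof.
move=> t0.
pose F1 x := \sum_(n < M) (q t n - q t n.+1) * (avg n f x - f x).
pose F2 x := \sum_(n < M) (r M * (m t n - m t n.+1) + m t M * (r n - r n.+1)) * avg n f x.
have di n : integ (fun x => avg n f x - f x) by exact: integrableBr.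
have F1i : integ F1.
  apply: (@sum_integ M (fun n x => (q t n - q t n.+1) * (avg n f x - f x))) => n.
  exact: integrableZlr.
have F2i : integ F2.
  exact: (@sum_integ M (fun n x => (r M * (m t n - m t n.+1) + m t M * (r n - r n.+1)) * avg n f x)).
have tF2i : integ (fun x => t^-1 * F2 x) by exact: integrableZlr.
have qfi : integ (fun x => q t M * f x) by exact: integrableZlr.
rewrite (@eq_L1norm _ _ _ _ _ _ (fun x => (F1 x + t^-1 * F2 x) - q t M * f x)); last first.
  by move=> x xN; rewrite VME.
apply: le_trans (L1normB mBN (integrableDr mBN F1i tF2i) qfi) _.
rewrite L1normZ// ger0_norm ?q_ge0// mulrDl addrA lerD2r.
apply: le_trans (L1normD mBN F1i tF2i) _; apply: lerD.
  apply: le_trans (@L1norm_ord_sum M (fun n x => (q t n - q t n.+1) * (avg n f x - f x)) _) _.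
    by move=> n; exact: integrableZlr.
  by apply: ler_sum => n _; rewrite L1normZ// ger0_norm// subr_ge0 q_nonincreasing.
rewrite L1normZ// ger0_norm ?invr_ge0 ?(ltW t0)// -mulrA ler_wpM2l ?invr_ge0 ?(ltW t0)//.
apply: le_trans (@nrm_combination M
    (fun n => r M * (m t n - m t n.+1) + m t M * (r n - r n.+1)) _) _ => [n|].
  by rewrite addr_ge0// mulr_ge0// subr_ge0// m_nonincreasing.
rewrite ler_wpM2r ?L1norm_ge0// big_split/= -!mulr_sumr !telescope_ord m0.
by apply: lerD; rewrite ?ler_piMr ?ler_wpM2l// gerBl.
Qed.

Let V t x := t^-1 * (w x - conv (heat t) w x) + mu * w x - f x.

(** Passing from the truncations back to w and T_N(t) w costs (1/t + mu) r_M and (r_M + m_M r_0)/t,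
    the cut in [VM_norm] costs the latter once more, and q_M <= (mu + 1/t) r_M. Adding these up
    gives the coefficients 2 mu + 4/t and 2 r_0/t. *)
Let V_norm t M : 0 < t -> nrm (V t) <=
  \sum_(n < M) (q t n - q t n.+1) * nrm (fun x => avg n f x - f x) +
  ((2 * mu + 4 / t) * r M + 2 * r 0%N / t * m t M) * nrm f.
Proof.
move=> t0; have wi := resolvent_integ; have Twi := semigroup_integ t0 wi.
have ti0 : 0 <= t^-1 by rewrite invr_ge0 ltW.
pose D1 x := w x - wM M x; pose D2 x := conv (heat t) w x - TwM t M x.
have D1i : integ D1 by exact: integrableBr.
have D2i : integ D2 by exact: integrableBr.
have VMi : integ (VM t M).
  apply: integrableBr => //; apply: integrableDr => //; apply: integrableZlr => //.
  exact: integrableBr.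
have Ei : integ (fun x => (t^-1 + mu) * D1 x) by exact: integrableZlr.
have Ei' : integ (fun x => t^-1 * D2 x) by exact: integrableZlr.
rewrite (@eq_L1norm _ _ _ _ _ _ (fun x => (VM t M x + (t^-1 + mu) * D1 x) - t^-1 * D2 x)); last first.
  by move=> x xN; rewrite /V /VM /D1 /D2; ring.
apply: le_trans (L1normB mBN (integrableDr mBN VMi Ei) Ei') _.
have h1 := L1normD mBN VMi Ei.
rewrite !L1normZ// in h1 *; rewrite !ger0_norm ?addr_ge0 ?(ltW mu_gt0)// in h1 *.
have h2 := VM_norm M t0.
have h3 := ler_wpM2l (addr_ge0 ti0 (ltW mu_gt0)) (w_wM M).
have h4 := ler_wpM2l ti0 (Tw_TwM M t0).
have h5 : q t M <= (mu + t^-1) * r M.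
  rewrite /q; apply: ler_wpM2r; first exact: r_ge0.
  by rewrite lerD2l ler_piMl// gerBl.
have nf := L1norm_ge0 haar BN f.
have h6 := ler_wpM2r nf h5.
apply: (le_trans (lerD (le_trans h1 (lerD h2 h3)) h4)).
rewrite -!addrA lerD2l; rewrite -subr_ge0 in h6; rewrite -subr_ge0.
have <- : (mu + t^-1) * r M * nrm f - q t M * nrm f =
  ((2 * mu + 4 / t) * r M + 2 * r 0 / t * m t M) * nrm f -
  ((t^-1 * (r M + m t M * r 0) + q t M) * nrm f +
   ((t^-1 + mu) * (r M * nrm f) + t^-1 * ((r M + m t M * r 0) * nrm f))) by ring.
exact: h6.
Qed.

(** The order of choices matters: n0 depends on f and e only, then d on n0, and M is taken after t,
    because the truncation error blows up like 1/t. *)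
Lemma resolvent_equation (e : R) : 0 < e -> exists2 d : R, 0 < d &
  forall t, 0 < t -> t < d -> nrm (V t) <= e.
Proof.
move=> e0; have e3 : 0 < e / 3 by rewrite divr_gt0.
have [n0 hn0] := average_cvgT h_haar fi e3.
have nf := L1norm_ge0 haar BN f.
(* The weight 1 - q_(n0) in front of the first n0 terms is at most t lam_(n0)^2/mu, and each of
   their norms is at most 2 [nrm f]. The bound d uses K + 1 to avoid dividing by 0. *)
pose K := 2 * nrm f * (lam n0 ^+ 2 / mu).
have K0 : 0 <= K by rewrite !mulr_ge0// ?exprn_ge0// invr_ge0 ltW.
exists (e / 3 / (K + 1)); first by rewrite divr_gt0// ltr_wpDl.
move=> t t0 td.
have tK : t * K <= e / 3.
  rewrite ltr_pdivlMr ?ltr_wpDl// in td; apply: le_trans (ltW td).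
  by rewrite ler_pM2l// lerDl.
have cvg0 : ((2 * mu + 4 / t) * r M + 2 * r 0%N / t * m t M) * nrm f @[M --> \oo] --> (0 : R).
  have := cvgM (cvgD (cvgM (cvg_cst (2 * mu + 4 / t)) r_cvg0)
    (cvgM (cvg_cst (2 * r 0%N / t)) (m_cvg0 t0))) (cvg_cst (nrm f)).
  by rewrite !mulr0 addr0 mul0r; apply.
move/cvgrPdist_le : cvg0 => /(_ _ e3)[M0 _ hM0].
pose M := maxn n0 M0.
have hM : ((2 * mu + 4 / t) * r M + 2 * r 0%N / t * m t M) * nrm f <= e / 3.
  have := hM0 M (leq_maxr _ _); rewrite /= sub0r normrN; apply: le_trans; exact: ler_norm.
apply: le_trans (V_norm M t0) _.
suff : \sum_(n < M) (q t n - q t n.+1) * nrm (fun x => avg n f x - f x) <= e / 3 + e / 3 by lra.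
have dq n : 0 <= q t n - q t n.+1 by rewrite subr_ge0 q_nonincreasing.
(* Before n0 the total weight is small; from n0 on the total weight is at most 1 and the norms are
   at most e/3. *)
have -> : M = (n0 + (M - n0))%N by rewrite subnKC// leq_maxl.
rewrite big_split_ord/=; apply: lerD.
  apply: (@le_trans _ _ (\sum_(n < n0) (q t n - q t n.+1) * (2 * nrm f))).
    apply: ler_sum => n _; rewrite ler_wpM2l//.
    apply: le_trans (L1normB mBN (ai n) fi) _.
    by have := L1norm_average h_haar n fi; lra.
  rewrite -mulr_suml telescope_ord q0; apply: le_trans tK.
  have := yosida_symbol_near1 mu_gt0 t0 (lam_ge0 n0).
  have nf2 : 0 <= 2 * nrm f by rewrite mulr_ge0.
  rewrite -/(m t n0) -/(q t n0) => /(ler_wpM2r nf2) h.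
  by apply: le_trans h _; rewrite le_eqVlt; apply/orP; left; apply/eqP; rewrite /K; ring.
apply: (@le_trans _ _ (\sum_(n < M - n0) (q t (n0 + n)%N - q t (n0 + n).+1) * (e / 3))).
  by apply: ler_sum => n _; rewrite ler_wpM2l// hn0// leq_addr.
rewrite -mulr_suml.
have := telescope_ord (fun n => q t (n0 + n)%N) (M - n0).
under eq_bigr do rewrite addnS.
move=> ->; rewrite ler_piMl ?(ltW e3)// addn0.
have q1 : q t n0 <= 1.
  by elim: n0 {hn0 K K0 td tK M hM} => [|n IH]; rewrite ?q0// (le_trans _ IH)// q_nonincreasing.
by have := q_ge0 (n0 + (M - n0)) t0; lra.
Qed.

End Resolvent.

(** Since (1 + t mu) f = t ((f - T_N(t) f)/t + mu f) + T_N(t) f, contractivity gives t mu [nrm f] <=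
    t mu e. One suitable t for each e is enough. *)
Lemma resolvent_injective f : integ f ->
  (forall e : R, 0 < e -> exists2 t, 0 < t &
    nrm (fun x => t^-1 * (f x - conv (heat t) f x) + mu * f x) <= e) ->
  nrm f = 0.
Proof.
move=> fi h; apply/eqP; rewrite eq_le L1norm_ge0 andbT; apply/ler_addgt0Pr => e e0.
rewrite add0r; have [t t0 ht] := h (mu * e) (mulr_gt0 mu_gt0 e0).
have Ti := semigroup_integ t0 fi.
have Di : integ (fun x => t^-1 * (f x - conv (heat t) f x) + mu * f x).
  by apply: integrableDr => //; apply: integrableZlr => //; exact: integrableBr.
have tDi := integrableZlr mBN t Di.
have := L1normD mBN tDi Ti.
rewrite (@eq_L1norm _ _ _ _ _ _ (fun x => (1 + t * mu) * f x)); last first.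
  by move=> x _; field; rewrite gt_eqF.
have tmu : 0 < t * mu by rewrite mulr_gt0.
rewrite !L1normZ// !gtr0_norm ?addr_gt0// => h1.
have h2 := L1norm_semigroup_le t0 fi.
have h3 := ler_wpM2l (ltW t0) ht.
have : t * mu * nrm f <= t * mu * e by move: h1 h2 h3; rewrite mulrDl mul1r -!mulrA; lra.
by rewrite ler_pM2l.
Qed.

End RadialSemigroup.

(** * Fourier integrals of radial functions *)

Section ComplexIntegralTheory.
Context d (T : measurableType d) (R : realType) (nu : {measure set T -> \bar R}).
Implicit Types (D : set T) (f : T -> R[i]).
Local Notation Re := complex.Re.
Local Notation Im := complex.Im.

Lemma complex_eqP (z w : R[i]) : Re z = Re w -> Im z = Im w -> z = w.
Proof. by case: z w => [a b] [c d'] /= -> ->. Qed.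

Lemma cReM (z w : R[i]) : Re (z * w) = Re z * Re w - Im z * Im w.
Proof. by case: z w => [a b] [c d']. Qed.

Lemma cImM (z w : R[i]) : Im (z * w) = Re z * Im w + Im z * Re w.
Proof. by case: z w => [a b] [c d']. Qed.

Lemma cReD (z w : R[i]) : Re (z + w) = Re z + Re w.
Proof. by case: z w => [a b] [c d']. Qed.

Lemma cImD (z w : R[i]) : Im (z + w) = Im z + Im w.
Proof. by case: z w => [a b] [c d']. Qed.

Lemma cReB (z w : R[i]) : Re (z - w) = Re z - Re w.
Proof. by case: z w => [a b] [c d']. Qed.

Lemma cImB (z w : R[i]) : Im (z - w) = Im z - Im w.
Proof. by case: z w => [a b] [c d']. Qed.

Lemma cintegrableP D f : cintegrable nu D f <->
  nu.-integrable D (EFin \o (fun x => Re (f x))) /\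
  nu.-integrable D (EFin \o (fun x => Im (f x))).
Proof. by []. Qed.

Lemma Re_cintegral D f : Re (cintegral nu D f) = \int[nu]_(x in D) Re (f x).
Proof. by []. Qed.

Lemma Im_cintegral D f : Im (cintegral nu D f) = \int[nu]_(x in D) Im (f x).
Proof. by []. Qed.

Lemma cintegralZ D (z : R[i]) f : measurable D -> cintegrable nu D f ->
  cintegral nu D (fun x => z * f x) = z * cintegral nu D f.
Proof.
move=> mD /cintegrableP[f1 f2]; apply: complex_eqP.
  rewrite cReM !Re_cintegral Im_cintegral -!RintegralZl// -RintegralB//.
  - by apply: eq_Rintegral => x _; rewrite cReM.
  - exact: integrableZlr.
  - exact: integrableZlr.
rewrite cImM !Im_cintegral Re_cintegral -!RintegralZl// -RintegralD//.
- by apply: eq_Rintegral => x _; rewrite cImM.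
- exact: integrableZlr.
- exact: integrableZlr.
Qed.

Lemma cintegral_setU (A B : set T) f : measurable A -> measurable B ->
  cintegrable nu (A `|` B) f -> [disjoint A & B] ->
  cintegral nu (A `|` B) f = cintegral nu A f + cintegral nu B f.
Proof.
move=> mA mB /cintegrableP[f1 f2] AB; apply: complex_eqP.
  by rewrite cReD !Re_cintegral Rintegral_setU.
by rewrite cImD !Im_cintegral Rintegral_setU.
Qed.

Lemma eq_cintegral D f g : (forall x, D x -> f x = g x) ->
  cintegral nu D f = cintegral nu D g.
Proof.
by move=> fg; apply: complex_eqP; apply: eq_Rintegral => x; rewrite inE => /fg ->.
Qed.

Lemma cintegral_real D (g : T -> R) :
  cintegral nu D (fun x => (g x)%:C%C) = (\int[nu]_(x in D) g x)%:C%C.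
Proof.
apply: complex_eqP => //; rewrite Im_cintegral /=.
by rewrite /Rintegral integral0_eq.
Qed.

End ComplexIntegralTheory.

Section CharacterIntegral.
Variables (R : realType) (p : nat) (p_pr : prime p).
Local Notation Qp := (padic p_pr).
Variables (haar : {measure set Qp -> \bar R}) (h_haar : is_haar haar).
Implicit Types (x y z eta : Qp) (D : set Qp) (j k : int) (g : Qp -> R).
Local Notation chi := (@padic_char p p_pr R).
Local Notation sphere j := (padic_annulus j j : set Qp).

Lemma padic_char_mul_measurable x (F : R[i] -> R) :
  measurable_fun setT (fun eta => F (chi (eta * x))).
Proof.
apply: (@padic_locally_constant_measurable _ _ _ _ _ 0) => eta _.
have [k xk] := padic_ball_exists x.
exists (- k) => z zk; congr F; rewrite mulrDl padic_charD.
rewrite (@padic_char_ball0 _ _ _ (z * x)) ?mulr1// -(addNr k).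
exact: padic_ballM.
Qed.

Lemma char_cintegrable D x g : measurable D -> haar.-integrable D (EFin \o g) ->
  cintegrable haar D (fun eta => chi (eta * x) * (g eta)%:C%C).
Proof.
move=> mD gi.
have mg : measurable_fun D g by apply/measurable_EFinP; exact: measurable_int gi.
have H (F : R[i] -> R) : (forall eta, `|F (chi eta)| <= 1) ->
    haar.-integrable D (EFin \o (fun eta => F (chi (eta * x)) * g eta)).
  move=> F1; apply: le_integrable gi => //.
    apply/measurable_EFinP; apply: measurable_funM.
      by apply: measurable_funTS; exact: (padic_char_mul_measurable x F).
    exact: mg.
  by move=> eta _ /=; rewrite lee_fin normrM ler_piMl.
split.
  have : forall eta, `|complex.Re (chi eta)| <= 1 by move=> eta; exact: cos_max.
  by move/H; apply: eq_in_integrable => // eta _; rewrite cReM /= mulr0 subr0.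
have : forall eta, `|complex.Im (chi eta)| <= 1 by move=> eta; exact: sin_max.
by move/H; apply: eq_in_integrable => // eta _; rewrite cImM /= mulr0 add0r.
Qed.

(* Translating by [a] multiplies the integral by [chi (a * x) != 1]. *)
Lemma char_integral_eq0 D (a x : Qp) g : measurable D ->
  (forall eta, D (a + eta) <-> D eta) -> (forall eta, D eta -> g (a + eta) = g eta) ->
  haar.-integrable D (EFin \o g) -> ~ padic_ball 0 (a * x) ->
  cintegral haar D (fun eta => chi (eta * x) * (g eta)%:C%C) = 0.
Proof.
move=> mD Da ga gi ax; set F := fun eta => _.
have Fi : cintegrable haar D F := char_cintegrable x mD gi.
have [F1 F2] := (cintegrableP _ _ _).1 Fi.
have DE : +%R a @^-1` D = D by apply/seteqP; split=> eta /Da.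
have tr (f : Qp -> R) : haar.-integrable D (EFin \o f) ->
    \int[haar]_(eta in D) f (a + eta) = \int[haar]_(eta in D) f eta.
  move=> fi; rewrite /Rintegral; congr fine.
  by rewrite -[RHS](integral_haar_translate h_haar a mD (measurable_int _ fi)) DE.
have e : cintegral haar D F = chi (a * x) * cintegral haar D F.
  rewrite -cintegralZ//.
  transitivity (cintegral haar D (fun eta => F (a + eta))).
    by apply: complex_eqP; rewrite ?Re_cintegral ?Im_cintegral; symmetry;
      [exact: (tr (fun eta => complex.Re (F eta)))|exact: (tr (fun eta => complex.Im (F eta)))].
  apply: eq_cintegral => eta Deta.
  by rewrite /F mulrDl padic_charD mulrA ga.
apply/eqP; have := @padic_char_neq1 _ _ R _ ax; apply: contraNT => I0.
by apply/eqP; apply: (mulIf I0); rewrite mul1r -e.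
Qed.

Lemma padic_escape j x : ~ padic_ball j x -> exists2 a, padic_ball (- j) a & ~ padic_ball 0 (a * x).
Proof.
move=> xj; exists (p%:R ^ j); first exact: padic_ball_expz.
move=> h; apply: xj; have := padic_ballM (padic_ball_expz p_pr (- j)) h.
rewrite opprK addr0 mulrA -expfzDr ?padic_natp_neq0// addNr expr0z mul1r.
exact.
Qed.

Lemma padic_ball_finite k : (haar (padic_ball k) < +oo)%E.
Proof. by rewrite (haar_ball h_haar) ltry. Qed.

Lemma char_integral_ball k x (c : R) : ~ padic_ball (- k) x ->
  cintegral haar (padic_ball k) (fun eta => chi (eta * x) * c%:C%C) = 0.
Proof.
move=> /padic_escape[a]; rewrite opprK => ak ax.
apply: (@char_integral_eq0 _ a x (fun=> c)) => //; first exact: padic_ball_measurable.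
  by move=> eta; apply: padic_ball_addl.
apply: measurable_bounded_integrable => //; first exact: padic_ball_measurable.
  exact: padic_ball_finite.
exact: bounded_cst.
Qed.

(** Translation by an element of B_(j-1) preserves the complement of that ball, and x lies outside
    B_(1-j), so some such translation is detected by the character. *)
Lemma char_integral_co_ball j x g : ~ padic_ball (1 - j) x ->
  (forall a eta, padic_ball (j - 1) a -> padic_co_ball j eta -> g (a + eta) = g eta) ->
  haar.-integrable (padic_co_ball j) (EFin \o g) ->
  cintegral haar (padic_co_ball j) (fun eta => chi (eta * x) * (g eta)%:C%C) = 0.
Proof.
move=> /padic_escape[a]; rewrite opprB => aj ax ga gi.
apply: (@char_integral_eq0 _ a x g) => //; first exact: padic_co_ball_measurable.
  by move=> eta; rewrite !padic_co_ballP (padic_ball_addl _ aj).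
by move=> eta; apply: ga.
Qed.

Lemma haar_sphere j : haar (sphere j) = (p%:R ^ j - p%:R ^ (j - 1))%:E.
Proof.
have -> : sphere j = padic_ball j `\` padic_ball (j - 1).
  by apply/seteqP; split=> eta; rewrite padic_annulusP.
rewrite measureD; [|exact: padic_ball_measurable..|exact: padic_ball_finite].
have -> : padic_ball j `&` padic_ball (j - 1) = padic_ball (j - 1) :> set Qp.
  by apply: setIidr => eta; apply: padic_ball_le; rewrite gerBl.
exact: (congr2 (fun a b => a - b)%E (haar_ball h_haar j) (haar_ball h_haar (j - 1))).
Qed.

Lemma Rintegral_sphere_cst j (c : R) g : (forall eta, sphere j eta -> g eta = c) ->
  \int[haar]_(eta in sphere j) g eta = c * (p%:R ^ j - p%:R ^ (j - 1)).
Proof.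
move=> gc; rewrite (@eq_Rintegral _ _ _ _ _ (fun=> c)); last first.
  by move=> eta; rewrite inE => /gc.
by rewrite Rintegral_cst ?haar_sphere//; exact: padic_annulus_measurable.
Qed.

Lemma padic_sphereP j eta : sphere j eta <-> eta != 0 /\ padic_ord eta = - j.
Proof.
rewrite padic_annulusP; split=> [[h1 h2]|[e0 /(padic_ord_ballP _ e0)]//].
have e0 : eta != 0 by apply/eqP => e; apply: h2; rewrite e; exact: padic_ball_center.
by split=> //; apply/padic_ord_ballP.
Qed.

Lemma padic_norm_sphere j eta : sphere j eta -> padic_norm eta = p%:R ^ j :> R.
Proof. by move=> /padic_sphereP[e0 eo]; rewrite /padic_norm (negPf e0) eo opprK. Qed.

End CharacterIntegral.

Section RadialFourier.
Variables (R : realType) (p : nat) (p_pr : prime p).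
Local Notation Qp := (padic p_pr).
Variables (haar : {measure set Qp -> \bar R}) (h_haar : is_haar haar) (N : int).
Implicit Types (x y z eta : Qp) (j : int) (n M k : nat).
Local Notation chi := (@padic_char p p_pr R).
Local Notation sphere j := (padic_annulus j j : set Qp).
Local Notation density := (@ball_density R p p_pr N).

(** The value of [g] on the sphere of radius p^(n-N) is r_n for n >= 1. The entry r_0 belongs to the
    constant functions; it enters only in [density_sum], as a boundary term. *)
Variables (r : nat -> R) (g : Qp -> R).
Hypothesis mg : measurable_fun setT g.
Hypothesis gE : forall n eta, sphere (n.+1%:Z - N) eta -> g eta = r n.+1.

Local Notation shell k := (padic_annulus (1 - N) (k%:Z - N) : set Qp).

Lemma shell_sphere k eta : shell k eta -> exists2 n, (n < k)%N & sphere (n.+1%:Z - N) eta.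
Proof.
rewrite padic_annulusP => -[h1 h2].
have e0 : eta != 0 by apply/eqP => e; apply: h2; rewrite e; exact: padic_ball_center.
move: h1 h2; rewrite !padic_ball_ordP (negPf e0) /= => h1 /negP h2.
set o := padic_ord eta in h1 h2 *.
have [n [nk on]] : exists n : nat, (n < k)%N /\ o = - (n.+1%:Z - N).
  by exists `|(- o + N - 1)%R|%N; clear -h1 h2; lia.
by exists n => //; apply/padic_sphereP.
Qed.

Lemma co_ball_sphere eta : padic_co_ball (1 - N) eta -> exists n, sphere (n.+1%:Z - N) eta.
Proof.
rewrite padic_co_ballP => h2.
have e0 : eta != 0 by apply/eqP => e; apply: h2; rewrite e; exact: padic_ball_center.
move: h2; rewrite padic_ball_ordP (negPf e0) /= => /negP h2.
set o := padic_ord eta in h2 *.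
have [n on] : exists n : nat, o = - (n.+1%:Z - N).
  by exists `|(- o + N - 1)%R|%N; clear -h2; lia.
by exists n; apply/padic_sphereP.
Qed.

Lemma shellS k : shell k.+1 = shell k `|` sphere (k.+1%:Z - N).
Proof.
have e : k.+1%:Z - N - 1 = k%:Z - N by lia.
apply/seteqP; split=> eta.
  rewrite /= !padic_annulusP e => -[h1 h2].
  by have [h|h] := pselect (padic_ball (k%:Z - N) eta); [left|right].
rewrite /= !padic_annulusP e => -[[h1 h2]|[h1 h2]]; split=> //.
- by apply: padic_ball_le h1; lia.
- by move=> h; apply: h2; apply: padic_ball_le h; lia.
Qed.

Lemma shell_disj k : [disjoint shell k & sphere (k.+1%:Z - N)].
Proof.
have e : k.+1%:Z - N - 1 = k%:Z - N by lia.
rewrite disj_set2E; apply/eqP/seteqP; split=> // eta [] /=.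
by rewrite !padic_annulusP e => -[h1 _] [_].
Qed.

Lemma shell0 : shell 0 = set0.
Proof.
apply/seteqP; split=> // eta /=; rewrite padic_annulusP => -[h1 h2]; apply: h2.
by apply: padic_ball_le h1; lia.
Qed.

Lemma shell_measurable k : measurable (shell k).
Proof. exact: padic_annulus_measurable. Qed.

Lemma shell_integrable k : haar.-integrable (shell k) (EFin \o g).
Proof.
apply: measurable_bounded_integrable.
- exact: shell_measurable.
- apply: le_lt_trans (padic_ball_finite h_haar (k%:Z - N)).
  apply: le_measure; rewrite ?inE; [exact: shell_measurable|exact: padic_ball_measurable|].
  by move=> eta /padic_annulusP[].
- exact: measurable_funTS.
- exists (\sum_(n < k) `|r n.+1|); split; first exact: num_real.
  move=> c lec eta /shell_sphere[n nk etan] /=; rewrite (gE etan); apply: le_trans (ltW lec).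
  by rewrite (bigD1 (Ordinal nk))//= lerDl sumr_ge0.
Qed.

Lemma Rintegral_shell k : \int[haar]_(eta in shell k) g eta =
  \sum_(n < k) r n.+1 * (p%:R ^ (n.+1%:Z - N) - p%:R ^ (n%:Z - N)).
Proof.
elim: k => [|k IH]; first by rewrite shell0 Rintegral_set0 big_ord0.
have := shell_integrable k.+1; rewrite shellS => si.
rewrite Rintegral_setU//; [|exact: shell_measurable|exact: padic_annulus_measurable|exact: shell_disj].
rewrite IH big_ord_recr/= (Rintegral_sphere_cst h_haar (@gE k)).
by have -> : k.+1%:Z - N - 1 = k%:Z - N by lia.
Qed.

Variables (x : Qp) (M : nat).
Hypothesis xM : padic_ball (N - M%:Z) x.
Hypothesis xM' : ~ padic_ball (N - M.+1%:Z) x.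

Let char_shell eta : padic_ball (M%:Z - N) eta -> chi (eta * x) = 1.
Proof.
move=> h; apply: padic_char_ball0; have := padic_ballM h xM.
by have -> : M%:Z - N + (N - M%:Z) = 0 by lia.
Qed.

(** Here |x| = p^(N-M). The character is 1 on every sphere of radius at most p^(M-N); on the next
    sphere its integral is 0 - p^(M-N), the difference of the integrals over two consecutive
    balls. *)
Lemma char_integral_shell : cintegral haar (shell M.+1) (fun eta => chi (eta * x) * (g eta)%:C%C) =
  (\sum_(n < M) r n.+1 * (p%:R ^ (n.+1%:Z - N) - p%:R ^ (n%:Z - N))
    - r M.+1 * p%:R ^ (M%:Z - N))%:C%C.
Proof.
have := char_cintegrable x (@shell_measurable M.+1) (shell_integrable M.+1).
rewrite shellS => si.
rewrite cintegral_setU//; [|exact: shell_measurable|exact: padic_annulus_measurable|exact: shell_disj].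
have -> : cintegral haar (shell M) (fun eta => chi (eta * x) * (g eta)%:C%C) =
    (\sum_(n < M) r n.+1 * (p%:R ^ (n.+1%:Z - N) - p%:R ^ (n%:Z - N)))%:C%C.
  rewrite -Rintegral_shell -cintegral_real; apply: eq_cintegral => eta /padic_annulusP[h _].
  by rewrite char_shell// mul1r.
have e : M.+1%:Z - N - 1 = M%:Z - N by lia.
rewrite (@eq_cintegral _ _ _ _ _ _ (fun eta => chi (eta * x) * (r M.+1)%:C%C)); last first.
  by move=> eta /gE ->.
have ballU : padic_ball (M.+1%:Z - N) = padic_ball (M%:Z - N) `|` sphere (M.+1%:Z - N) :> set Qp.
  apply/seteqP; split=> eta /=; rewrite padic_annulusP e.
    by move=> h; have [h'|h'] := pselect (padic_ball (M%:Z - N) eta); [left|right].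
  by move=> [h|[]//]; apply: padic_ball_le h; lia.
have ball0 : cintegral haar (padic_ball (M.+1%:Z - N)) (fun eta => chi (eta * x) * (r M.+1)%:C%C) = 0.
  by apply: char_integral_ball => //; rewrite opprB.
have ri (j : int) : haar.-integrable (padic_ball j) (EFin \o (fun=> r M.+1)).
  apply: measurable_bounded_integrable => //; first exact: padic_ball_measurable.
    exact: padic_ball_finite.
  exact: bounded_cst.
have mb : measurable (padic_ball (M.+1%:Z - N) : set Qp) by exact: padic_ball_measurable.
have := char_cintegrable x mb (ri (M.+1%:Z - N)).
rewrite ballU => bi; move: ball0; rewrite ballU cintegral_setU//.
- rewrite addrC => /eqP; rewrite addr_eq0 => /eqP ->.
  rewrite (@eq_cintegral _ _ _ _ _ _ (fun=> (r M.+1)%:C%C)); last first.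
    by move=> eta h; rewrite char_shell// mul1r.
  rewrite cintegral_real Rintegral_cst; last exact: padic_ball_measurable.
  by rewrite (haar_ball h_haar)/= -rmorphB.
- exact: padic_ball_measurable.
- exact: padic_annulus_measurable.
- rewrite disj_set2E; apply/eqP/seteqP; split=> // eta [] /=.
  by rewrite padic_annulusP e => h [_].
Qed.

(** Spheres beyond the radius p^(M+1-N) contribute nothing, so an integral over all high frequencies
    reduces to a finite shell. *)
Lemma char_integral_co_ball_shell :
  (forall a eta, padic_ball (M.+1%:Z - N) a -> padic_co_ball (M.+2%:Z - N) eta ->
    g (a + eta) = g eta) ->
  haar.-integrable (padic_co_ball (1 - N)) (EFin \o g) ->
  cintegral haar (padic_co_ball (1 - N)) (fun eta => chi (eta * x) * (g eta)%:C%C) =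
  cintegral haar (shell M.+1) (fun eta => chi (eta * x) * (g eta)%:C%C).
Proof.
move=> ginv gi.
have e : M.+2%:Z - N - 1 = M.+1%:Z - N by lia.
have U : padic_co_ball (1 - N) = shell M.+1 `|` padic_co_ball (M.+2%:Z - N) :> set Qp.
  apply/seteqP; split=> eta /=; rewrite !padic_co_ballP padic_annulusP e.
    by move=> h; have [h'|h'] := pselect (padic_ball (M.+1%:Z - N) eta); [left|right].
  by move=> [[]//|h] h'; apply: h; apply: padic_ball_le h'; lia.
have mco j : measurable (padic_co_ball j : set Qp) by exact: padic_co_ball_measurable.
have ci := char_cintegrable x (mco _) gi; rewrite [X in cintegrable _ X _]U in ci.
rewrite U cintegral_setU//; [|exact: shell_measurable|].
- rewrite (@char_integral_co_ball _ _ _ _ h_haar (M.+2%:Z - N)) ?addr0//.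
  + by rewrite opprB addrCA; have -> : 1 - M.+2%:Z = - M.+1%:Z by lia.
  + by rewrite e.
  + apply: (integrableS (mco (1 - N))) gi => //.
    by rewrite U; exact: subsetUr.
- rewrite disj_set2E; apply/eqP/seteqP; split=> // eta [] /=.
  by rewrite padic_annulusP padic_co_ballP e => -[h _].
Qed.

(** Abel summation, with only the densities of index at most M alive at x. The boundary term r_0
    p^(-N) is exactly the constant that has to be added to a high frequency integral: mu^-1 p^-N for
    the resolvent and p^-N for the heat kernel. *)
Lemma density_sum M' : ~ padic_ball (N - M'%:Z) x ->
  \sum_(n < M') (r n - r n.+1) * density n x =
  r 0%N * p%:R ^ (- N) + (\sum_(n < M) r n.+1 * (p%:R ^ (n.+1%:Z - N) - p%:R ^ (n%:Z - N))
    - r M.+1 * p%:R ^ (M%:Z - N)).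
Proof.
move=> xM2; have MM' : (M < M')%N.
  rewrite ltnNge; apply/negP => h; apply: xM2; apply: padic_ball_le xM; lia.
have -> : \sum_(n < M') (r n - r n.+1) * density n x =
    \sum_(n < M.+1) (r n - r n.+1) * p%:R ^ (n%:Z - N).
  rewrite -(subnKC MM') big_split_ord/= [X in _ + X]big1 ?addr0; last first.
    by move=> i _; rewrite (ball_density_eq0 _ xM') ?mulr0// leq_addr.
  apply: eq_bigr => i _; rewrite /ball_density indicE mem_set ?mulr1//.
  by apply: padic_ball_le xM; have := ltn_ord i; lia.
elim: (M) => [|k IH]; first by rewrite big_ord_recr !big_ord0/= (_ : 0%:Z - N = - N) ?sub0r//; ring.
by rewrite big_ord_recr/= IH big_ord_recr/=; ring.
Qed.

End RadialFourier.

(** * Real powers of integer powers and geometric sums *)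

Section PowersOfP.
Variables (R : realType) (q : R).
Hypothesis q_gt1 : 1 < q.
Implicit Types (j : int) (a : R).

Let q_gt0 : 0 < q. Proof. exact: lt_trans ltr01 q_gt1. Qed.

Lemma powR_gt1 a : 0 < a -> 1 < q `^ a.
Proof.
move=> a0; have := @gt0_ltr_powR R a a0 1 q; rewrite powR1; apply => //.
  by rewrite nnegrE.
by rewrite nnegrE ltW.
Qed.

Lemma powR_exprz j a : (q ^ j) `^ a = q `^ (j%:~R * a).
Proof. by rewrite -powR_intmul ?(ltW q_gt0)// powRrM. Qed.

Lemma powR_exprzC j a : (q ^ j) `^ a = (q `^ a) ^ j.
Proof. by rewrite -(powR_intmul _ (powR_ge0 q a)) -powRrM powR_exprz mulrC. Qed.

Lemma powR_exprzS j a : (q ^ (j + 1)) `^ a = q `^ a * (q ^ j) `^ a.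
Proof. by rewrite !powR_exprzC expfzDr ?expr1z 1?mulrC// gt_eqF// powR_gt0. Qed.

Lemma powR_exprz_gt0 j a : 0 < (q ^ j) `^ a.
Proof. by rewrite powR_gt0// exprz_gt0. Qed.

Lemma powR_exprz_ratio j a : ((q ^ j) `^ a)^-1 * q ^ j = (q ^ j) `^ (1 - a).
Proof.
have qj : 0 < q ^ j by rewrite exprz_gt0.
by rewrite -powRN -[X in _ * X](powRr1 (ltW qj)) -powRD ?(gt_eqF qj) ?implybT// addrC.
Qed.

Lemma geometric_weight_sum j a k : 0 < a ->
  \sum_(n < k) (q ^ (n%:Z + j)) `^ (- a) <= (q ^ j) `^ (- a) / (1 - q `^ (- a)).
Proof.
move=> a0; have rho1 : q `^ (- a) < 1 by rewrite powRN invf_lt1 ?powR_gt1// powR_gt0.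
have rho0 : 0 < q `^ (- a) by rewrite powR_gt0.
apply: le_trans (geometric_le_lim k (powR_ge0 (q ^ j) (- a)) rho0 _).
  rewrite le_eqVlt; apply/orP; left; apply/eqP; rewrite /series/= big_mkord.
  apply: eq_bigr => n _; rewrite !powR_exprzC expfzDr 1?mulrC//.
  by rewrite gt_eqF.
by rewrite ger0_norm// ltW.
Qed.

End PowersOfP.

Section HeatSeries.
Variables (R : realType) (q alpha : R).
Hypotheses (q_gt1 : 1 < q) (alpha_gt0 : 0 < alpha).
Implicit Types (s : R) (n : nat).

Let q_gt0 : 0 < q. Proof. exact: lt_trans ltr01 q_gt1. Qed.

(* [heat_const] involves the series of these coefficients at
   [s = t * p ^ (- N * alpha)]. *)
Definition heat_coeff s n : R := exp_coeff (- s) n / (1 - q `^ (- alpha * n%:R - 1)).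

Let den_ge n : 1 - q^-1 <= 1 - q `^ (- alpha * n%:R - 1).
Proof.
rewrite lerD2l lerN2 -[leRHS](powR_inv1 (ltW q_gt0)).
apply: ler_powR; rewrite ?(ltW q_gt1)// mulNr gerDr oppr_le0.
by rewrite mulr_ge0// ltW.
Qed.

Let den0_gt0 : 0 < 1 - q^-1.
Proof. by rewrite subr_gt0 invf_lt1. Qed.

Let den_gt0 n : 0 < 1 - q `^ (- alpha * n%:R - 1).
Proof. exact: lt_le_trans den0_gt0 (den_ge n). Qed.

Lemma heat_coeff_norm_le s n : 0 <= s -> `|heat_coeff s n| <= ((1 - q^-1)^-1 *: exp_coeff s) n.
Proof.
move=> s0; rewrite /heat_coeff normrM normfV (gtr0_norm (den_gt0 n)).
rewrite [leRHS](_ : _ = (1 - q^-1)^-1 * (s ^+ n / n`!%:R))// [leRHS]mulrC.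
rewrite /exp_coeff/= normrM normrX normrN normfV (ger0_norm s0) normr_nat.
apply: ler_wpM2l; first by rewrite mulr_ge0 ?exprn_ge0// invr_ge0.
by rewrite lef_pV2 ?posrE.
Qed.

Lemma is_cvg_heat_normed s : 0 <= s -> cvgn [normed series (heat_coeff s)].
Proof.
move=> s0; apply: (@series_le_cvg _ _ ((1 - q^-1)^-1 *: exp_coeff s)).
- by move=> n; exact: normr_ge0.
- by move=> n; apply: le_trans (heat_coeff_norm_le n s0); exact: normr_ge0.
- by move=> n; exact: heat_coeff_norm_le.
- exact: (is_cvg_seriesZ (is_cvg_series_exp_coeff s)).
Qed.

Lemma is_cvg_heat s : 0 <= s -> cvgn (series (heat_coeff s)).
Proof. by move=> s0; apply: normed_cvg; exact: is_cvg_heat_normed. Qed.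

Definition heat_series s : R := limn (series (heat_coeff s)).

Lemma heat_series_norm_le s : 0 <= s -> `|heat_series s| <= (1 - q^-1)^-1 * expR s.
Proof.
move=> s0; apply: le_trans (lim_series_norm (is_cvg_heat_normed s0)) _.
have -> : (1 - q^-1)^-1 * expR s = limn (series ((1 - q^-1)^-1 *: exp_coeff s)).
  by rewrite lim_seriesZ//; exact: is_cvg_series_exp_coeff.
apply: lim_series_le; first exact: is_cvg_heat_normed.
  exact: (is_cvg_seriesZ (is_cvg_series_exp_coeff s)).
by move=> n; exact: heat_coeff_norm_le.
Qed.

(** Replacing s by s q^(-alpha) multiplies the n-th coefficient by q^(-alpha n), so the difference
    carries the factor 1 - q^(-alpha n - 1), which cancels the denominator and leaves the
    exponential series. *)
Lemma heat_series_rec s : 0 <= s ->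
  heat_series s = expR (- s) + q^-1 * heat_series (s * q `^ (- alpha)).
Proof.
move=> s0; have s'0 : 0 <= s * q `^ (- alpha) by rewrite mulr_ge0// powR_ge0.
apply/eqP; rewrite -subr_eq; apply/eqP; rewrite /heat_series.
rewrite [X in _ - X](_ : _ = limn (series (q^-1 *: heat_coeff (s * q `^ (- alpha))))); last first.
  by rewrite lim_seriesZ//; exact: is_cvg_heat.
rewrite -lim_seriesB; [|exact: is_cvg_heat|exact/is_cvg_seriesZ/is_cvg_heat].
rewrite /expR; congr (limn (series _)); apply/funext => n.
rewrite [LHS](_ : _ = heat_coeff s n - q^-1 * heat_coeff (s * q `^ (- alpha)) n)//.
rewrite /heat_coeff /exp_coeff/= -[- (s * _)]mulNr exprMn.
have e : q `^ (- alpha * n%:R - 1) = q `^ (- alpha) ^+ n * q^-1.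
  rewrite powRD ?(gt_eqF q_gt0) ?implybT// powRrM powR_mulrn ?powR_ge0//.
  by rewrite powR_inv1// ltW.
have := den_gt0 n; rewrite e => h.
have n0 : n`!%:R != 0 :> R by rewrite pnatr_eq0 -lt0n fact_gt0.
have dq : q - q `^ (- alpha) ^+ n != 0.
  have -> : q - q `^ (- alpha) ^+ n = q * (1 - q `^ (- alpha) ^+ n / q) by field; rewrite gt_eqF.
  by rewrite gt_eqF// mulr_gt0.
by field; rewrite n0 dq gt_eqF.
Qed.

End HeatSeries.

Section HeatBall.
Variables (R : realType) (p : nat) (p_pr : prime p).
Local Notation Qp := (padic p_pr).
Variables (haar : {measure set Qp -> \bar R}) (h_haar : is_haar haar).
Variables (alpha : R) (alpha_gt0 : 0 < alpha).
Implicit Types (x eta : Qp) (j k : int) (t : R).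
Local Notation q := (p%:R : R).
Local Notation sphere j := (padic_annulus j j : set Qp).

Let q_gt1 : 1 < q. Proof. by rewrite ltr1n prime_gt1. Qed.
Let q_gt0 : 0 < q. Proof. exact: lt_trans ltr01 q_gt1. Qed.

Lemma padic_norm_measurable (F : R -> R) : measurable_fun setT (fun eta : Qp => F (padic_norm eta)).
Proof.
apply: (@padic_locally_constant_measurable _ _ _ _ _ 0) => eta /padic_notin_ball[k ek].
by exists k => z zk; rewrite (padic_norm_add_lt _ ek zk).
Qed.

Let heat_fun t eta : R := expR (- t * padic_norm eta `^ alpha).

Let heat_fun_le1 t eta : 0 < t -> heat_fun t eta <= 1.
Proof.
by move=> t0; rewrite -expR0 ler_expR mulNr oppr_le0 mulr_ge0 ?powR_ge0// ltW.
Qed.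

Lemma heat_fun_integrable t k : 0 < t -> haar.-integrable (padic_ball k) (EFin \o heat_fun t).
Proof.
move=> t0; apply: measurable_bounded_integrable; first exact: padic_ball_measurable.
- exact: padic_ball_finite.
- by apply: measurable_funTS; exact: (padic_norm_measurable (fun v => expR (- t * v `^ alpha))).
- exists 1; split => [|c c1 eta _ /=]; first exact: num_real.
  by rewrite ger0_norm ?expR_ge0// (le_trans (heat_fun_le1 _ t0))// ltW.
Qed.

Let heat_ball_bound t k : 0 < t ->
  0 <= \int[haar]_(eta in padic_ball k) heat_fun t eta <= q ^ k.
Proof.
move=> t0; apply/andP; split; first by apply: Rintegral_ge0 => eta _; exact: expR_ge0.
have -> : q ^ k = \int[haar]_(eta in padic_ball k) (fun=> 1) eta.
  by rewrite Rintegral_cst ?mul1r ?(haar_ball h_haar)//; exact: padic_ball_measurable.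
apply: le_Rintegral; [exact: padic_ball_measurable|exact: heat_fun_integrable| |].
  apply: measurable_bounded_integrable => //; first exact: padic_ball_measurable.
    exact: padic_ball_finite.
  exact: bounded_cst.
by move=> eta _; exact: heat_fun_le1.
Qed.

Let heat_ball_rec t k : 0 < t ->
  \int[haar]_(eta in padic_ball k) heat_fun t eta =
  expR (- (t * (q ^ k) `^ alpha)) * (q ^ k - q ^ (k - 1)) +
  \int[haar]_(eta in padic_ball (k - 1)) heat_fun t eta.
Proof.
move=> t0.
have U : padic_ball k = sphere k `|` padic_ball (k - 1) :> set Qp.
  apply/seteqP; split=> eta /=; rewrite padic_annulusP.
    by move=> h; have [h'|h'] := pselect (padic_ball (k - 1) eta); [right|left].
  by move=> [[]//|h]; apply: padic_ball_le h; rewrite gerBl.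
have := heat_fun_integrable k t0; rewrite U => hi.
rewrite Rintegral_setU//; [|exact: padic_annulus_measurable|exact: padic_ball_measurable|].
  rewrite (@Rintegral_sphere_cst _ _ _ _ h_haar k (expR (- (t * (q ^ k) `^ alpha))))//.
  by move=> eta /(@padic_norm_sphere R) e; rewrite /heat_fun e mulNr.
rewrite disj_set2E; apply/eqP/seteqP; split=> // eta [] /=.
by rewrite padic_annulusP => -[].
Qed.

Let defect t k : R := \int[haar]_(eta in padic_ball k) heat_fun t eta -
  q ^ k * (1 - q^-1) * heat_series q alpha (t * (q ^ k) `^ alpha).

(** Passing from k to k-1 removes the same term from both expressions: the value of the exponential
    on the outer sphere times the volume q^k (1 - q^-1) of that sphere. *)
Let defect_rec t k : 0 < t -> defect t k = defect t (k - 1).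
Proof.
move=> t0; have tk : 0 <= t * (q ^ k) `^ alpha by rewrite mulr_ge0 ?powR_ge0// ltW.
rewrite /defect (heat_ball_rec k t0) (heat_series_rec q_gt1 alpha_gt0 tk).
have -> : t * (q ^ (k - 1)) `^ alpha = t * (q ^ k) `^ alpha * q `^ (- alpha).
  have := powR_exprzS q_gt1 (k - 1) alpha; rewrite subrK powRN => ->.
  by field; rewrite gt_eqF// powR_gt0.
have -> : q ^ (k - 1) = q ^ k * q^-1 by rewrite expfzDr ?gt_eqF.
by ring.
Qed.

(* The defect does not depend on [k] and tends to [0] as [k] tends to [-oo]. *)
Lemma heat_ball t k : 0 < t ->
  \int[haar]_(eta in padic_ball k) expR (- t * padic_norm eta `^ alpha) =
  q ^ k * (1 - q^-1) * heat_series q alpha (t * (q ^ k) `^ alpha).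
Proof.
move=> t0; apply/eqP; rewrite -subr_eq0 -[X in X == _]/(defect t k).
have dE n : defect t k = defect t (k - n%:Z).
  elim: n => [|n IH]; first by rewrite subr0.
  have -> : k - n.+1%:Z = k - n%:Z - 1 by rewrite -addn1 PoszD opprD addrA.
  exact: (etrans IH (defect_rec _ t0)).
(* Both parts of the defect at level j <= k are O(q^j): the integral is at most q^j, and the series
   is bounded through its value scale at level k. *)
set C := 1 + expR (t * (q ^ k) `^ alpha).
have dle n : `|defect t k| <= (q ^ k * C) * q^-1 ^+ n.
  rewrite (dE n); set j := k - n%:Z.
  have qj : q ^ j = q ^ k * q^-1 ^+ n by rewrite /j expfzDr ?gt_eqF// exprVn -exprnN.
  have jk : q ^ j <= q ^ k.
    by apply: ler_weXz2l; rewrite ?(ltW q_gt1)// /j gerBl.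
  rewrite mulrAC -qj; apply: le_trans (ler_normB _ _) _; rewrite /C [leRHS]mulrDr mulr1; apply: lerD.
    by have /andP[h1 h2] := heat_ball_bound j t0; rewrite ger0_norm.
  have d0 : 0 < 1 - q^-1 by rewrite subr_gt0 invf_lt1.
  have tj : 0 <= t * (q ^ j) `^ alpha by rewrite mulr_ge0 ?powR_ge0// ltW.
  rewrite normrM (@ger0_norm _ (_ * _)); last by rewrite mulr_ge0 ?exprz_ge0 ?ltW.
  rewrite -mulrA ler_pM2l ?exprz_gt0//.
  apply: le_trans (ler_wpM2l (ltW d0) (heat_series_norm_le q_gt1 alpha_gt0 tj)) _.
  rewrite mulVKf ?lt0r_neq0//.
  rewrite ler_expR ler_pM2l// ge0_ler_powR ?nnegrE ?exprz_ge0 ?(ltW q_gt0)//; exact: ltW.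
have c0 : (q ^ k * C) * q^-1 ^+ n @[n --> \oo] --> (q ^ k * C) * 0.
  apply: cvgM; first exact: cvg_cst.
  by apply: cvg_expr; rewrite ger0_norm ?invr_ge0 ?ltW// invf_lt1.
rewrite -normr_le0 -(mulr0 (q ^ k * C)) -(cvg_lim _ c0)//.
by apply: limr_ge; [apply/cvg_ex; eexists; exact: c0|exact: nearW].
Qed.

End HeatBall.

Section RadialIntegral.
Variables (R : realType) (p : nat) (p_pr : prime p).
Local Notation Qp := (padic p_pr).
Variables (haar : {measure set Qp -> \bar R}) (h_haar : is_haar haar) (N : int).
Implicit Types (x eta : Qp) (n k : nat).
Local Notation q := (p%:R : R).
Local Notation sphere j := (padic_annulus j j : set Qp).
Local Notation shell k := (padic_annulus (1 - N) (k%:Z - N) : set Qp).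

Variables (r : nat -> R) (g : Qp -> R).
Hypothesis mg : measurable_fun setT g.
Hypothesis gE : forall n eta, sphere (n.+1%:Z - N) eta -> g eta = r n.+1.
Hypothesis r_ge0 : forall n, 0 <= r n.+1.
(** The decay exponent [b] is alpha for the resolvent with alpha > 1, and a large multiple of alpha
    for the heat kernel. *)
Variables (b C : R).
Hypotheses (b_gt1 : 1 < b) (C_ge0 : 0 <= C).
Hypothesis r_le : forall n, r n.+1 <= C * ((q ^ (n.+1%:Z - N)) `^ b)^-1.

Let q_gt1 : 1 < q. Proof. by rewrite ltr1n prime_gt1. Qed.
Let q_gt0 : 0 < q. Proof. exact: lt_trans ltr01 q_gt1. Qed.

Lemma bigcup_shell : \bigcup_k shell k = padic_co_ball (1 - N).
Proof.
apply/seteqP; split=> eta.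
  by move=> [k _ /padic_annulusP[_ h]]; apply/padic_co_ballP.
move=> h; have [n /padic_annulusP[h1 h2]] := co_ball_sphere h.
exists n.+1 => //; apply/padic_annulusP; split=> //.
by move/padic_co_ballP: h.
Qed.

Let g_ge0 eta : padic_co_ball (1 - N) eta -> 0 <= g eta.
Proof. by move=> /co_ball_sphere[n /gE ->]. Qed.

Let shell_co k : shell k `<=` padic_co_ball (1 - N).
Proof. by rewrite -bigcup_shell => eta h; exists k. Qed.

Let ishell k : (\int[haar]_(eta in shell k) (g eta)%:E =
  (\int[haar]_(eta in shell k) g eta)%:E)%E.
Proof.
by rewrite /Rintegral fineK//; apply: integrable_fin_num; [exact: shell_measurable|exact: (shell_integrable h_haar mg gE k)].
Qed.

Let shell_cvg : ((\int[haar]_(eta in shell k) g eta)%:E @[k --> \oo] -->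
  \int[haar]_(eta in padic_co_ball (1 - N)) (g eta)%:E)%E.
Proof.
rewrite -bigcup_shell; under eq_fun do rewrite -ishell.
apply: ge0_nondecreasing_set_cvg_integral.
- move=> i j ij; apply/subsetPset => eta /padic_annulusP[h1 h2]; apply/padic_annulusP; split=> //.
  by apply: padic_ball_le h1; rewrite lerB// lez_nat.
- exact: shell_measurable.
- by move=> k; apply/measurable_EFinP; exact: measurable_funTS.
- by move=> k eta /shell_co h; rewrite lee_fin g_ge0.
Qed.

(** Monotone convergence along the shells: volume times the bound on [r] gives a geometric series of
    ratio q^(-(b-1)). *)
Lemma co_ball_integrable : haar.-integrable (padic_co_ball (1 - N)) (EFin \o g).
Proof.
apply/integrableP; split; first by apply/measurable_EFinP; exact: measurable_funTS.
rewrite (eq_integral (fun eta => (g eta)%:E)); last first.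
  by move=> eta; rewrite inE => /g_ge0 h; rewrite /= ger0_norm.
have -> : (\int[haar]_(eta in padic_co_ball (1 - N)) (g eta)%:E =
    limn (fun k => (\int[haar]_(eta in shell k) g eta)%:E))%E.
  by apply/esym/cvg_lim => //; exact: shell_cvg.
apply: (@le_lt_trans _ _ (C * ((q ^ (1 - N)) `^ (- (b - 1)) / (1 - q `^ (- (b - 1)))))%:E); last exact: ltry.
apply: lime_le; first by apply/cvg_ex; eexists; exact: shell_cvg.
apply: nearW => k; rewrite lee_fin (Rintegral_shell h_haar mg gE).
apply: (@le_trans _ _ (C * \sum_(n < k) (q ^ (n%:Z + (1 - N))) `^ (- (b - 1)))).
  rewrite mulr_sumr; apply: ler_sum => n _.
  have -> : n%:Z + (1 - N) = n.+1%:Z - N by rewrite addrA -PoszD addn1.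
  rewrite opprB -(powR_exprz_ratio q_gt1) mulrA; apply: le_trans (ler_wpM2r _ (r_le n)); last first.
    by rewrite exprz_ge0// ltW.
  by rewrite ler_wpM2l// gerBl exprz_ge0// ltW.
by apply: ler_wpM2l => //; apply: geometric_weight_sum => //; rewrite subr_gt0.
Qed.

Lemma Rintegral_shell_cvg :
  \sum_(n < k) r n.+1 * (q ^ (n.+1%:Z - N) - q ^ (n%:Z - N)) @[k --> \oo] -->
  \int[haar]_(eta in padic_co_ball (1 - N)) g eta.
Proof.
under eq_fun do rewrite -(Rintegral_shell h_haar mg gE).
have e : (\int[haar]_(eta in padic_co_ball (1 - N)) (g eta)%:E =
    (\int[haar]_(eta in padic_co_ball (1 - N)) g eta)%:E)%E.
  rewrite /Rintegral fineK//; apply: integrable_fin_num; last exact: co_ball_integrable.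
  exact: padic_co_ball_measurable.
have := shell_cvg; rewrite e => h; exact: (fine_cvg h).
Qed.

Lemma radial_weight_cvg0 : r n.+1 * q ^ (n%:Z - N) @[n --> \oo] --> (0 : R).
Proof.
set rho := q `^ (- (b - 1)).
have b1 : 0 < b - 1 by rewrite subr_gt0.
have rho1 : rho < 1 by rewrite /rho powRN invf_lt1 ?(powR_gt1 q_gt1)// powR_gt0.
have rho0 : 0 < rho by rewrite powR_gt0.
have c0 : (C * (q ^ (1 - N)) `^ (- (b - 1))) * rho ^+ n @[n --> \oo] -->
    (C * (q ^ (1 - N)) `^ (- (b - 1))) * 0.
  by apply: cvgM; [exact: cvg_cst|apply: cvg_expr; rewrite ger0_norm ?ltW].
rewrite mulr0 in c0; apply: (squeeze_cvgr _ (cvg_cst 0) c0).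
apply: nearW => n; apply/andP; split; first by rewrite mulr_ge0// exprz_ge0// ltW.
have -> : C * (q ^ (1 - N)) `^ (- (b - 1)) * rho ^+ n =
    C * (q ^ (n.+1%:Z - N)) `^ (- (b - 1)).
  have -> : n.+1%:Z - N = 1 - N + n%:Z by rewrite -addn1 PoszD; ring.
  rewrite -mulrA; congr (_ * _); rewrite !(powR_exprzC q_gt1) [in RHS]expfzDr//.
  by rewrite gt_eqF// powR_gt0.
rewrite opprB -(powR_exprz_ratio q_gt1) mulrA; apply: ler_pM => //.
  by rewrite exprz_ge0// ltW.
apply: ler_weXz2l; first exact: ltW.
by rewrite lerB// lez_nat.
Qed.

End RadialIntegral.

(** M = ord(x) + N, that is |x| = p^(N-M); equivalently M is the last index whose density does not
    vanish at x. *)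
Lemma padic_scale (p : nat) (p_pr : prime p) (N : int) (x : padic p_pr) :
  padic_ball N x -> x != 0 ->
  exists M, padic_ball (N - M%:Z) x /\ ~ padic_ball (N - M.+1%:Z) x.
Proof.
move=> xN x0; exists `|(padic_ord x + N)%R|%N.
move: xN; rewrite !padic_ball_ordP (negPf x0) /= => xN.
by split; [lia|apply/negP; lia].
Qed.

(** * The heat kernel and the resolvent kernel *)

Section Symbol.
Variables (R : realType) (p : nat) (p_pr : prime p) (N : int) (alpha : R).
Hypothesis alpha_gt0 : 0 < alpha.
Local Notation q := (p%:R : R).
Local Notation lambda := (@lambda R p N alpha).

Let q_gt1 : 1 < q. Proof. by rewrite ltr1n prime_gt1. Qed.
Let q_gt0 : 0 < q. Proof. exact: lt_trans ltr01 q_gt1. Qed.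

(* The eigenvalue of [opA] on the range of [E_n - E_(n-1)]; constants ([n = 0])
   have eigenvalue [0], not the value of the formula for [n >= 1]. *)
Definition symbol (n : nat) : R :=
  if n is 0%N then 0 else (q ^ (n%:Z - N)) `^ alpha - lambda.

(** The ratio of [lambda] to the weight p^(alpha (1-N)) of the first sphere outside B_(-N). That it
    is below 1 makes every nonzero index have a positive eigenvalue, bounded below by a fixed
    fraction of its weight. *)
Let theta : R := (q - 1) / (q `^ (alpha + 1) - 1).

Let theta_lt1 : theta < 1.
Proof.
have qa : q < q `^ (alpha + 1).
  rewrite powRD ?(gt_eqF q_gt0) ?implybT// powRr1 ?(ltW q_gt0)//.
  by rewrite ltr_pMl// powR_gt1.
rewrite /theta ltr_pdivrMr ?mul1r ?ltrD2r//.
by rewrite subr_gt0; exact: lt_trans qa.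
Qed.

Let theta_ge0 : 0 <= theta.
Proof.
rewrite divr_ge0 ?subr_ge0 ?(ltW q_gt1)//.
by rewrite ltW// powR_gt1// addr_gt0.
Qed.

Let lambdaE : lambda = theta * (q ^ (1 - N)) `^ alpha.
Proof. by rewrite /Defs.lambda powR_exprz// intrB (mulrC alpha). Qed.

Let weight_le n : (q ^ (1 - N)) `^ alpha <= (q ^ (n.+1%:Z - N)) `^ alpha.
Proof.
rewrite ge0_ler_powR ?nnegrE ?exprz_ge0 ?(ltW q_gt0) ?(ltW alpha_gt0)//.
by apply: ler_weXz2l; [exact: ltW|rewrite lerB// lez_nat].
Qed.

Let delta : R := 1 - theta.
Let delta_gt0 : 0 < delta. Proof. by rewrite subr_gt0. Qed.

Let symbol_geW n : delta * (q ^ (n.+1%:Z - N)) `^ alpha <= symbol n.+1.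
Proof.
rewrite /symbol lambdaE /delta mulrBl mul1r lerB// ler_wpM2l//.
Qed.

Lemma symbol_ge : exists2 delta : R, 0 < delta &
  forall n, delta * (q ^ (n.+1%:Z - N)) `^ alpha <= symbol n.+1.
Proof. by exists delta. Qed.

Lemma symbol_nondecreasing n : symbol n <= symbol n.+1.
Proof.
case: n => [|n].
  by apply: le_trans (symbol_geW 0); rewrite mulr_ge0 ?powR_ge0// ltW.
rewrite /symbol lerB// ge0_ler_powR ?nnegrE ?exprz_ge0 ?(ltW q_gt0) ?(ltW alpha_gt0)//.
by apply: ler_weXz2l; [exact: ltW|rewrite lerB// lez_nat].
Qed.

Lemma symbol_ge0 n : 0 <= symbol n.
Proof. by elim: n => [|n IH] //; apply: le_trans IH (symbol_nondecreasing n). Qed.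

Lemma symbol_pinfty : symbol n @[n --> \oo] --> +oo.
Proof.
apply/cvgryPge => A.
have rho1 : q `^ (- alpha) < 1 by rewrite powRN invf_lt1 ?powR_gt1// powR_gt0.
set B := delta * (q ^ (1 - N)) `^ alpha.
have B0 : 0 < B by rewrite mulr_gt0// powR_exprz_gt0.
have : (q `^ (- alpha)) ^+ n @[n --> \oo] --> (0 : R).
  by apply: cvg_expr; rewrite ger0_norm ?powR_ge0.
have A0 : 0 < B / (`|A| + 1) by rewrite divr_gt0// ltr_pwDr.
move=> /cvgrPdist_le/(_ _ A0)[k _ hk]; exists k.+1 => // -[//|n] /= kn.
have := hk n kn; rewrite sub0r normrN ger0_norm ?exprn_ge0 ?powR_ge0// => h.
apply: le_trans (symbol_geW n).
have -> : (q ^ (n.+1%:Z - N)) `^ alpha = (q ^ (1 - N)) `^ alpha * (q `^ alpha) ^+ n.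
  have -> : n.+1%:Z - N = 1 - N + n%:Z by rewrite -addn1 PoszD; ring.
  by rewrite !(powR_exprzC q_gt1) [in LHS]expfzDr// gt_eqF// powR_gt0.
rewrite mulrA -/B.
have qn : 0 < (q `^ alpha) ^+ n by rewrite exprn_gt0// powR_gt0.
move: h; rewrite powRN exprVn -(ler_pM2l qn) divff ?gt_eqF// mulrA ler_pdivlMr ?ltr_pwDr// mul1r.
rewrite mulrC => h; apply: le_trans h; apply: le_trans (ler_norm A) _.
by rewrite lerDl.
Qed.

End Symbol.

Section Kernels.
Variables (R : realType) (p : nat) (p_pr : prime p).
Local Notation Qp := (padic p_pr).
Variables (haar : {measure set Qp -> \bar R}) (h_haar : is_haar haar) (N : int) (alpha : R).
Hypothesis alpha_gt0 : 0 < alpha.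
Implicit Types (x eta : Qp) (n k M : nat) (t : R).
Local Notation q := (p%:R : R).
Local Notation sphere j := (padic_annulus j j : set Qp).
Local Notation shell k := (padic_annulus (1 - N) (k%:Z - N) : set Qp).
Local Notation lambda := (@lambda R p N alpha).
Local Notation lam := (@symbol R p N alpha).
Local Notation density := (@ball_density R p p_pr N).
Local Notation chi := (@padic_char p p_pr R).

Let q_gt1 : 1 < q. Proof. by rewrite ltr1n prime_gt1. Qed.
Let q_gt0 : 0 < q. Proof. exact: lt_trans ltr01 q_gt1. Qed.

(** One term z^s/s! of the exponential series at z = t y^alpha suffices; [s] is chosen as an integer
    exceeding b/alpha. *)
Lemma expRN_le_powR (t b : R) : 0 < t -> exists2 s : nat, b < alpha * s%:R &
  exists2 C : R, 0 <= C & forall y, 0 < y -> expR (- t * y `^ alpha) <= C * (y `^ (alpha * s%:R))^-1.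
Proof.
move=> t0; pose s := (Num.truncn (`|b| / alpha)).+1.
exists s.
  rewrite mulrC -ltr_pdivrMr//; apply: le_lt_trans (truncnS_gt _).
  by rewrite ler_pM2r ?invr_gt0// ler_norm.
exists (s`!%:R / t ^+ s); first by rewrite divr_ge0// exprn_ge0// ltW.
move=> y y0; have ya : 0 < y `^ alpha by rewrite powR_gt0.
rewrite powRrM powR_mulrn ?powR_ge0// mulNr expRN -[leRHS]invrK.
have f0 : 0 < s`!%:R :> R by rewrite ltr0n fact_gt0.
rewrite lef_pV2 ?posrE ?expR_gt0 ?invr_gt0 ?divr_gt0 ?exprn_gt0//.
rewrite !invfM !invrK.
have ty : 0 <= t * y `^ alpha by rewrite mulr_ge0 ?ltW.
apply: le_trans (expR_ge1Dxn s.-1 ty); rewrite /s/= exprMn.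
by rewrite -mulrA mulrC lerDr.
Qed.

Lemma heat_integrable t : 0 < t -> haar.-integrable (padic_co_ball (1 - N))
  (EFin \o (fun eta : Qp => expR (- t * padic_norm eta `^ alpha))).
Proof.
move=> t0; have [s bs [C C0 hC]] := expRN_le_powR 1 t0.
apply: (@co_ball_integrable _ _ _ _ h_haar N (fun n => expR (- t * (q ^ (n%:Z - N)) `^ alpha)) _ _ _ _ _ _ bs C0).
- exact: (padic_norm_measurable (fun v => expR (- t * v `^ alpha))).
- by move=> n eta /(@padic_norm_sphere R) ->.
- by move=> n; exact: expR_ge0.
- by move=> n; apply: hC; rewrite exprz_gt0.
Qed.

Let setTU : setT = padic_ball (- N) `|` padic_co_ball (1 - N) :> set Qp.
Proof.
apply/seteqP; split=> // eta _; rewrite /= padic_co_ballP addrAC subrr sub0r.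
exact: EM.
Qed.

Let heat_setT t : 0 < t -> haar.-integrable setT
  (EFin \o (fun eta : Qp => expR (- t * padic_norm eta `^ alpha))).
Proof.
move=> t0; have mf : measurable_fun setT (fun eta : Qp => expR (- t * padic_norm eta `^ alpha)).
  exact: (@padic_norm_measurable R p p_pr (fun v => expR (- t * v `^ alpha))).
apply/integrableP; split; first exact/measurable_EFinP.
rewrite setTU ge0_integral_setU//=; first last.
- rewrite disj_set2E; apply/eqP/seteqP; split=> // eta [] /= + /padic_co_ballP.
  by rewrite addrAC subrr sub0r.
- by apply/measurable_EFinP; apply: measurableT_comp => //; exact: measurable_funTS.
- exact: padic_co_ball_measurable.
- exact: padic_ball_measurable.
have [_ h1] := integrableP _ _ _ (heat_fun_integrable h_haar alpha (- N) t0).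
have [_ h2] := integrableP _ _ _ (heat_integrable t0).
exact: lte_add_pinfty.
Qed.

Let co_ball_invariant (F : R -> R) M a eta : padic_ball (M.+1%:Z - N) a ->
  padic_co_ball (M.+2%:Z - N) eta -> F (padic_norm (a + eta)) = F (padic_norm eta).
Proof.
move=> aM /padic_co_ballP h; rewrite addrC (padic_norm_add_lt _ h)//.
by have -> : M.+2%:Z - N - 1 = M.+1%:Z - N by lia.
Qed.

(** Identifies the series in c(t): c(t) is p^(-N) minus the contribution to e^(lambda t) Z(t, x) of
    the frequencies |xi| <= p^(-N), on which the character is 1 for every x in B_N. *)
Lemma heat_constE t : 0 < t -> @heat_const R p N alpha t = q ^ (- N) -
  expR (lambda * t) * \int[haar]_(eta in padic_ball (- N)) expR (- t * padic_norm eta `^ alpha).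
Proof.
move=> t0; rewrite (heat_ball h_haar alpha_gt0 (- N) t0) /heat_const; congr (_ - _).
have -> : limn (series (fun n : nat => (-1) ^+ n / n`!%:R * t ^+ n *
      (q `^ (- N%:~R * alpha * n%:R) / (1 - q `^ (- alpha * n%:R - 1))))) =
    heat_series q alpha (t * (q ^ (- N)) `^ alpha).
  congr (limn (series _)); apply/funext => n; rewrite /heat_coeff /exp_coeff/=.
  rewrite powR_exprz// powRrM powR_mulrn ?powR_ge0// intrN.
  set w := q `^ (- N%:~R * alpha).
  have -> : - (t * w) = -1 * t * w by ring.
  by rewrite !exprMn; ring.
ring.
Qed.

(** The low frequencies cancel against c(t) and leave p^(-N), the boundary term with multiplier e^0
    = 1. The high frequencies are a finite shell, and the factor e^(lambda t) turns their weights
    into e^(-t lam_n). *)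
Lemma heat_kernelNE t x M : 0 < t -> padic_ball N x -> ~ padic_ball (N - M%:Z) x ->
  heat_kernelN haar N alpha t x =
  (\sum_(n < M) (expR (- (t * lam n)) - expR (- (t * lam n.+1))) * density n x)%:C%C.
Proof.
move=> t0 xN xM.
have x0 : x != 0 by apply/eqP => e; apply: xM; rewrite e; exact: padic_ball_center.
have [M' [h1 h2]] := padic_scale xN x0.
set F := fun v : R => expR (- t * v `^ alpha).
pose r n := F (q ^ (n%:Z - N)).
have mF : measurable_fun setT (fun eta : Qp => F (padic_norm eta)) := @padic_norm_measurable R p p_pr F.
have FE n eta : sphere (n.+1%:Z - N) eta -> F (padic_norm eta) = r n.+1.
  by move=> /(@padic_norm_sphere R) ->.
rewrite (@density_sum R p p_pr N (fun n => expR (- (t * lam n))) x M' h1 h2 M xM).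
rewrite /heat_kernelN /heat_kernel.
have := char_cintegrable x measurableT (heat_setT t0); rewrite setTU => ci.
rewrite cintegral_setU//; first last.
- rewrite disj_set2E; apply/eqP/seteqP; split=> // eta [] /= + /padic_co_ballP.
  by rewrite addrAC subrr sub0r.
- exact: padic_co_ball_measurable.
- exact: padic_ball_measurable.
rewrite (char_integral_co_ball_shell h_haar h2 (fun a eta => @co_ball_invariant F M' a eta) (heat_integrable t0)).
rewrite (char_integral_shell h_haar mF FE h1 h2).
rewrite (@eq_cintegral _ _ _ _ _ _ (fun eta : Qp => (F (padic_norm eta))%:C%C)); last first.
  move=> eta h; rewrite padic_char_ball0 ?mul1r//.
  by have := padic_ballM h xN; rewrite addNr.
rewrite cintegral_real -!rmorphD -rmorphM -rmorphD heat_constE//; congr (_%:C%C).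
rewrite mulr0 oppr0 expR0 mul1r -/F.
have mE n : expR (- (t * lam n.+1)) = expR (lambda * t) * r n.+1.
  by rewrite /r /F -expRD; congr expR; rewrite /symbol; ring.
rewrite mE; under [in RHS]eq_bigr do rewrite mE -mulrA.
by rewrite -mulr_sumr; ring.
Qed.

Section ResolventKernel.
Variable mu : R.
Hypothesis mu_gt0 : 0 < mu.

Let F (v : R) := (v `^ alpha - lambda + mu)^-1.
Let r n := (mu + lam n)^-1.

Let mF : measurable_fun setT (fun eta : Qp => F (padic_norm eta)).
Proof. exact: (@padic_norm_measurable R p p_pr F). Qed.

Let FE n eta : sphere (n.+1%:Z - N) eta -> F (padic_norm eta) = r n.+1.
Proof. by move=> /(@padic_norm_sphere R) ->; rewrite /F /r addrC. Qed.

Lemma resolvent_weight_gt0 n : 0 < (mu + lam n)^-1.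
Proof. by rewrite invr_gt0 ltr_wpDr// symbol_ge0. Qed.

Lemma resolvent_weight_le : exists2 C : R, 0 < C & forall n,
  (mu + lam n.+1)^-1 <= C * ((q ^ (n.+1%:Z - N)) `^ alpha)^-1.
Proof.
have [d d0 hd] := symbol_ge p_pr N alpha_gt0; exists d^-1; first by rewrite invr_gt0.
move=> n; have w0 : 0 < (q ^ (n.+1%:Z - N)) `^ alpha by rewrite powR_exprz_gt0.
rewrite -invfM lef_pV2 ?posrE ?mulr_gt0 ?ltr_wpDr ?symbol_ge0//.
by apply: (le_trans (hd n)); rewrite lerDr ltW.
Qed.

Lemma resolvent_kernelE_shell x M : padic_ball (N - M%:Z) x -> ~ padic_ball (N - M.+1%:Z) x ->
  resolvent_kernel haar N alpha mu x =
  (\sum_(n < M) r n.+1 * (q ^ (n.+1%:Z - N) - q ^ (n%:Z - N)) - r M.+1 * q ^ (M%:Z - N))%:C%C.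
Proof.
move=> h1 h2.
have x0 : x != 0 by apply/eqP => e; apply: h2; rewrite e; exact: padic_ball_center.
rewrite /resolvent_kernel (negPf x0) -(char_integral_shell h_haar mF FE h1 h2).
(* The outer exponent 1 - m of the annulus in the definition, with |x| = p^m and m = N - M. *)
have -> : 1 - - padic_ord x = M.+1%:Z - N.
  move: h1 h2; rewrite !padic_ball_ordP (negPf x0) /= => h1 /negP h2.
  by move: h1 h2; move: (padic_ord x) => o; clear; lia.
by [].
Qed.

Lemma resolvent_kernelE x M : padic_ball N x -> ~ padic_ball (N - M%:Z) x ->
  resolvent_kernel haar N alpha mu x + (mu^-1 * q ^ (- N))%:C%C =
  (\sum_(n < M) (r n - r n.+1) * density n x)%:C%C.
Proof.
move=> xN xM.
have x0 : x != 0 by apply/eqP => e; apply: xM; rewrite e; exact: padic_ball_center.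
have [M' [h1 h2]] := padic_scale xN x0.
rewrite (resolvent_kernelE_shell h1 h2) (density_sum _ h1 h2 xM) -rmorphD; congr (_%:C%C).
by rewrite {3}/r addr0 addrC.
Qed.

Lemma resolvent_kernel0 : resolvent_kernel haar N alpha mu 0 =
  (\int[haar]_(eta in padic_co_ball (1 - N)) F (padic_norm eta))%:C%C.
Proof.
rewrite /resolvent_kernel eqxx -cintegral_real; apply: eq_cintegral => eta _.
rewrite /resolvent_integrand mulr0 padic_char_ball0 ?mul1r//; exact: padic_ball_center.
Qed.

Lemma resolvent_kernel_real x : complex.Im (resolvent_kernel haar N alpha mu x) = 0.
Proof.
have [->|x0] := eqVneq x 0; first by rewrite resolvent_kernel0.
have [xN|xN] := pselect (padic_ball N x).
  have [M [h1 h2]] := padic_scale xN x0.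
  by rewrite (resolvent_kernelE_shell h1 h2).
rewrite /resolvent_kernel (negPf x0).
(* Outside B_N one has m > N, so the outer radius p^(1-m) is smaller than the inner radius
   p^(1-N). *)
rewrite (_ : padic_annulus _ _ = set0).
  by rewrite Im_cintegral Rintegral_set0.
apply/seteqP; split=> // eta /padic_annulusP[h1 h2]; apply: h2; apply: padic_ball_le h1.
move: xN; rewrite padic_ball_ordP (negPf x0) /= => /negP.
by move: (padic_ord x) => o; clear; lia.
Qed.

Lemma resolvent_kernel_bound x M : padic_ball (N - M%:Z) x -> ~ padic_ball (N - M.+1%:Z) x ->
  Normc.normc (resolvent_kernel haar N alpha mu x) <= \sum_(n < M.+1) r n.+1 * q ^ (n.+1%:Z - N).
Proof.
move=> h1 h2; rewrite (resolvent_kernelE_shell h1 h2).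
rewrite [leLHS](_ : _ = `|\sum_(n < M) r n.+1 * (q ^ (n.+1%:Z - N) - q ^ (n%:Z - N)) - r M.+1 * q ^ (M%:Z - N)|); last first.
  by rewrite /Normc.normc /= expr0n addr0 sqrtr_sqr.
have r0 n : 0 <= r n by rewrite ltW// resolvent_weight_gt0.
have q0 j : 0 <= q ^ j by rewrite exprz_ge0// ltW.
have qS n : q ^ (n%:Z - N) <= q ^ (n.+1%:Z - N).
  by apply: ler_weXz2l; [exact: ltW|rewrite lerB// lez_nat].
apply: le_trans (ler_normB _ _) _; rewrite big_ord_recr/=; apply: lerD.
  apply: le_trans (ler_norm_sum _ _ _) _; apply: ler_sum => n _.
  rewrite ger0_norm; last by rewrite mulr_ge0// subr_ge0.
  by rewrite ler_wpM2l// gerBl.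
by rewrite ger0_norm ?mulr_ge0// ler_wpM2l.
Qed.

Section Alpha_gt1.
Hypothesis alpha_gt1 : 1 < alpha.

Let Fi : haar.-integrable (padic_co_ball (1 - N)) (EFin \o (fun eta : Qp => F (padic_norm eta))).
Proof.
have [C C0 hC] := resolvent_weight_le.
apply: (@co_ball_integrable _ _ _ _ h_haar N r _ mF FE _ _ _ alpha_gt1 (ltW C0) hC).
by move=> n; rewrite ltW// resolvent_weight_gt0.
Qed.

Lemma resolvent_integrand_cintegrable x :
  cintegrable haar (padic_co_ball (1 - N)) (resolvent_integrand N alpha mu x).
Proof. by apply: char_cintegrable => //; exact: padic_co_ball_measurable. Qed.

Lemma resolvent_kernel_co_ball x : padic_ball N x -> resolvent_kernel haar N alpha mu x =
  cintegral haar (padic_co_ball (1 - N)) (resolvent_integrand N alpha mu x).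
Proof.
move=> xN; have [->|x0] := eqVneq x 0; first by rewrite /resolvent_kernel eqxx.
have [M [h1 h2]] := padic_scale xN x0.
rewrite (resolvent_kernelE_shell h1 h2) -(char_integral_shell h_haar mF FE h1 h2).
exact/esym/(char_integral_co_ball_shell h_haar h2 (fun a eta => @co_ball_invariant F M a eta) Fi).
Qed.

(** As x tends to 0 the index M tends to infinity: the sum in [resolvent_kernelE_shell] converges to
    the full integral, which is the value at 0, and its last term tends to 0. *)
Lemma resolvent_kernel_cvg0 : forall e : R, 0 < e -> exists k : int, forall x, padic_ball k x ->
  padic_ball N x ->
  Normc.normc (resolvent_kernel haar N alpha mu x - resolvent_kernel haar N alpha mu 0) <= e.
Proof.
move=> e e0; have [C C0 hC] := resolvent_weight_le.
have r0 n : 0 <= r n.+1 by rewrite ltW// resolvent_weight_gt0.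
have c1 := Rintegral_shell_cvg h_haar mF FE r0 alpha_gt1 (ltW C0) hC.
have c2 := radial_weight_cvg0 p_pr r0 alpha_gt1 hC.
have : (\sum_(n < k) r n.+1 * (q ^ (n.+1%:Z - N) - q ^ (n%:Z - N)) - r k.+1 * q ^ (k%:Z - N))
    @[k --> \oo] --> \int[haar]_(eta in padic_co_ball (1 - N)) F (padic_norm eta) - 0.
  by apply: cvgB; [exact: c1|exact: c2].
rewrite subr0 => /cvgrPdist_le/(_ e e0)[k _ hk].
exists (N - k%:Z) => x xk xN; have [->|x0] := eqVneq x 0.
  by rewrite subrr /Normc.normc /= expr0n addr0 sqrtr0 ltW.
have [M [h1 h2]] := padic_scale xN x0.
have kM : (k <= M)%N.
  rewrite leqNgt; apply/negP => h; apply: h2; apply: padic_ball_le xk.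
  by rewrite lerB// lez_nat.
have := hk M kM; rewrite resolvent_kernel0 (resolvent_kernelE_shell h1 h2) -rmorphB distrC /=.
by rewrite expr0n addr0 sqrtr_sqr.
Qed.

End Alpha_gt1.

End ResolventKernel.
End Kernels.

(** * Continuity, integrability and growth of the kernel *)

Section KernelRegularity.
Variables (R : realType) (p : nat) (p_pr : prime p).
Local Notation Qp := (padic p_pr).
Variables (haar : {measure set Qp -> \bar R}) (h_haar : is_haar haar) (N : int) (alpha : R).
Hypothesis alpha_gt0 : 0 < alpha.
Variables (mu : R) (mu_gt0 : 0 < mu).
Implicit Types (x y z eta : Qp) (n M : nat).
Local Notation q := (p%:R : R).
Local Notation BN := (padic_ball N : set Qp).
Local Notation lam := (@symbol R p N alpha).
Local Notation K := (resolvent_kernel haar N alpha mu).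
Local Notation density := (@ball_density R p p_pr N).

Let q_gt1 : 1 < q. Proof. by rewrite ltr1n prime_gt1. Qed.
Let q_gt0 : 0 < q. Proof. exact: lt_trans ltr01 q_gt1. Qed.
Let mBN : measurable BN. Proof. exact: padic_ball_measurable. Qed.

Lemma padic_nbhs_ball x k : nbhs x [set y | padic_ball k (y - x)].
Proof.
apply: open_nbhs_nbhs; split; last by rewrite /= subrr; exact: padic_ball_center.
apply: (@padic_ball_stable_open _ _ _ k) => y z /= yk zk.
by rewrite addrAC; exact: padic_ballD.
Qed.

Lemma padic_within_ball D x k : within D (nbhs x) [set y | padic_ball k (y - x)].
Proof. by apply: filterS (padic_nbhs_ball x k) => y h _. Qed.

Lemma resolvent_kernel_add M x z : padic_ball (N - M%:Z) x -> ~ padic_ball (N - M.+1%:Z) x ->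
  padic_ball (N - M.+1%:Z) z -> K (x + z) = K x.
Proof.
move=> h1 h2 zM.
rewrite (resolvent_kernelE_shell h_haar alpha mu h1 h2).
rewrite (@resolvent_kernelE_shell _ _ _ _ h_haar _ alpha mu (x + z) M)//.
  by apply: padic_ballD => //; apply: padic_ball_le zM; rewrite lerB// lez_nat.
by move=> h; apply: h2; apply/(padic_ball_addr _ zM).
Qed.

Lemma resolvent_kernel_continuous : {within BN `\ 0, continuous (K : Qp -> R[i]^o)}.
Proof.
apply/subspace_continuousP => x [xN /eqP x0].
have [M [h1 h2]] := padic_scale xN x0.
apply: cvg_near_cst; apply: filterS (padic_within_ball _ x (N - M.+1%:Z)) => y /= yx.
by have := resolvent_kernel_add h1 h2 yx; rewrite addrC subrK.
Qed.

Lemma resolvent_kernel_continuous0 : 1 < alpha -> {within BN, continuous (K : Qp -> R[i]^o)}.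
Proof.
move=> alpha1; apply/subspace_continuousP => x xN.
have [->|x0] := eqVneq x 0; last first.
  have [M [h1 h2]] := padic_scale xN x0.
  apply: cvg_near_cst; apply: filterS (padic_within_ball _ x (N - M.+1%:Z)) => y /= yx.
  by have := resolvent_kernel_add h1 h2 yx; rewrite addrC subrK.
(* The radius is a complex number here; being positive means having zero imaginary part and positive
   real part. *)
apply/cvgrPdist_le => /= e; rewrite ltcE => /andP[/eqP/= ie re].
have [k hk] := resolvent_kernel_cvg0 h_haar N alpha_gt0 mu_gt0 alpha1 re.
have h1 := padic_within_ball BN 0 k.
have h2 : within BN (nbhs (0 : Qp)) BN by apply: withinT; exact: nbhs_filter.
apply: filterS2 h1 h2 => y; rewrite /= subr0 => yk yN.
rewrite distrC lecE normc_def /= ie eqxx /=.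
by have := hk y yk yN; case: (K y - K 0) => a b.
Qed.

Let green y : R := complex.Re (K y) + mu^-1 * q ^ (- N).
Let r n := (mu + lam n)^-1.

Let greenE y M : BN y -> ~ padic_ball (N - M%:Z) y ->
  green y = \sum_(n < M) (r n - r n.+1) * density n y.
Proof.
by move=> yN yM; have := resolvent_kernelE h_haar alpha mu yN yM => /(congr1 (@complex.Re R)); rewrite cReD.
Qed.

Let r_ge0 n : 0 <= r n. Proof. by rewrite ltW// resolvent_weight_gt0. Qed.

Let rS n : r n.+1 <= r n.
Proof.
by rewrite lef_pV2 ?posrE ?ltr_wpDr ?symbol_ge0// lerD2l symbol_nondecreasing.
Qed.

Lemma resolvent_kernelN y : BN y -> K (- y) = K y.
Proof.
move=> yN; have [->|y0] := eqVneq y 0; first by rewrite oppr0.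
have [M [h1 h2]] := padic_scale yN y0.
by rewrite !(@resolvent_kernelE_shell _ _ _ _ h_haar _ alpha mu _ M) ?padic_ballN.
Qed.

(** Apply the convergence criterion for convolutions to f = 1 at the point 0: all averages of 1
    equal 1, so the series telescopes and is at most r_0. The symmetry K(-y) = K(y) removes the
    reflection. *)
Lemma resolvent_kernel_cintegrable : cintegrable haar BN K.
Proof.
have cst_integ (c : R) : haar.-integrable BN (EFin \o (fun=> c)).
  by apply: (@coset_invariant_integ _ _ _ _ h_haar N 0).
have h : haar.-integrable BN (EFin \o (fun y => green (0 - y) * 1)).
  apply: (kernel_integrableP h_haar rS greenE (padic_ball_center p_pr N) (cst_integ 1)).2.
  rewrite /kernel_series.
  under eq_eseriesr do rewrite (@average_id _ _ _ _ h_haar N _ (fun=> `|1 : R|))// normr1 mulr1.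
  by apply: le_lt_trans (telescope_tail_le 0 r_ge0 rS) _; exact: ltry.
apply/cintegrableP; split.
  apply: eq_in_integrable (integrableBr mBN h (cst_integ (mu^-1 * q ^ (- N)))) => // y yN.
  by rewrite sub0r mulr1 /green resolvent_kernelN// addrK.
apply: eq_in_integrable (cst_integ 0) => // y _.
by rewrite resolvent_kernel_real.
Qed.

Lemma padic_norm_shell M x : padic_ball (N - M%:Z) x -> ~ padic_ball (N - M.+1%:Z) x ->
  padic_norm x = q ^ (N - M%:Z).
Proof.
move=> h1 h2; apply: padic_norm_sphere; apply/padic_annulusP; split=> //.
by have -> : N - M%:Z - 1 = N - M.+1%:Z by lia.
Qed.

Lemma resolvent_kernel_weight_bound : exists2 C : R, 0 < C & forall x M,
  padic_ball (N - M%:Z) x -> ~ padic_ball (N - M.+1%:Z) x ->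
  Normc.normc (K x) <= C * \sum_(n < M.+1) (q ^ (n.+1%:Z - N)) `^ (1 - alpha).
Proof.
have [C C0 hC] := resolvent_weight_le p_pr N alpha_gt0 mu_gt0; exists C => // x M h1 h2.
apply: le_trans (resolvent_kernel_bound h_haar alpha_gt0 mu_gt0 h1 h2) _.
rewrite mulr_sumr; apply: ler_sum => n _.
rewrite -(powR_exprz_ratio q_gt1) mulrA ler_wpM2r// exprz_ge0//; exact: ltW.
Qed.

(** For alpha = 1 each sphere contributes a bounded amount, so K is bounded by a multiple of the
    number M+1 of spheres. The logarithm vanishes on |x| = 1 whereas K need not: for N = 0 it equals
    -(mu + lam_1)^-1 there. *)
Lemma resolvent_kernel_log : alpha = 1 -> exists2 C : R, 0 < C &
  forall x, BN x -> x != 0 -> (padic_norm x : R) != 1 ->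
    Normc.normc (K x) <= C * `|ln (padic_norm x)|.
Proof.
move=> a1; have [C C0 hC] := resolvent_kernel_weight_bound.
have lnq : 0 < ln q by rewrite ln_gt0.
exists (C * (`|N|%:~R + 2) / ln q).
  by rewrite divr_gt0// mulr_gt0// ltr_wpDl// ler0z.
move=> x xN x0; have [M [h1 h2]] := padic_scale xN x0.
rewrite (padic_norm_shell h1 h2) => xn1.
apply: le_trans (hC x M h1 h2) _.
rewrite -powR_intmul ?(ltW q_gt0)// ln_powR normrM (gtr0_norm lnq).
rewrite mulrA mulrAC mulfVK ?gt_eqF// -mulrA ler_wpM2l ?(ltW C0)//.
rewrite (eq_bigr (fun=> 1)); last by move=> i _; rewrite a1 subrr powRr0.
have d0 : N - M%:Z != 0 by apply: contra xn1 => /eqP ->.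
(* Uses M + 1 <= |N| + |N - M| + 1 and |N - M| >= 1; this is where |N| + 2 in the constant comes
   from. *)
have h : M.+1%:Z <= (`|N| + 2) * `|N - M%:Z|.
  have d1 : 1 <= `|N - M%:Z| by rewrite -gtz0_ge1 normr_gt0.
  have : `|N| <= `|N| * `|N - M%:Z| by rewrite ler_peMr.
  by rewrite mulrDl; clear -d1; lia.
rewrite sumr_const card_ord; move: h; rewrite -(ler_int R) intrM [(_ + 2)%:~R]intrD.
by rewrite [X in _ * X]intr_norm.

Qed.

Lemma resolvent_kernel_powR : alpha < 1 -> exists2 C : R, 0 < C &
  forall x, BN x -> x != 0 -> Normc.normc (K x) <= C * padic_norm x `^ (alpha - 1).
Proof.
move=> a1; have [C C0 hC] := resolvent_kernel_weight_bound.
have g0 : 0 < 1 - alpha by rewrite subr_gt0.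
set Q := q `^ (1 - alpha); have Q1 : 1 < Q by rewrite powR_gt1.
(* The terms grow geometrically with ratio Q, so their sum is at most Q/(Q-1) times the last one,
   which is Q times w_M. *)
pose A := Q * Q / (Q - 1).
have Q0 : 0 < Q := lt_trans ltr01 Q1.
have A0 : 0 < A by rewrite divr_gt0 ?mulr_gt0// subr_gt0.
exists (C * A); first exact: mulr_gt0.
move=> x xN x0; have [M [h1 h2]] := padic_scale xN x0.
apply: le_trans (hC x M h1 h2) _; rewrite -mulrA ler_wpM2l ?(ltW C0)//.
have -> : padic_norm x `^ (alpha - 1) = (q ^ (M%:Z - N)) `^ (1 - alpha).
  by rewrite (padic_norm_shell h1 h2) !powR_exprz// !intrB; congr (_ `^ _); ring.
pose w (n : nat) := (q ^ (n%:Z - N)) `^ (1 - alpha).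
have wS n : w n.+1 = Q * w n.
  rewrite /w; have -> : n.+1%:Z - N = n%:Z - N + 1 by rewrite -addn1 PoszD addrAC.
  by rewrite powR_exprzS.
have w0 n : 0 <= w n by exact: powR_ge0.
rewrite -/(w M) (eq_bigr (fun n : 'I_M.+1 => w n.+1))//; elim: (M) => [|k IH].
  rewrite big_ord_recr big_ord0 /= add0r wS ler_wpM2r// /A ler_pdivlMr ?subr_gt0//.
  by rewrite ler_wpM2l ?(ltW Q0)// gerBl.
rewrite big_ord_recr/= (le_trans (lerD IH (lexx _)))// !wS.
rewrite le_eqVlt; apply/orP; left; apply/eqP; rewrite /A.
by field; rewrite subr_eq0 gt_eqF.
Qed.

End KernelRegularity.

(** * The resolvent *)

Section ComplexNorm.
Context d (T : measurableType d) (R : realType).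
Variables (nu : {measure set T -> \bar R}) (D : set T) (mD : measurable D).
Local Notation Re := complex.Re.
Local Notation Im := complex.Im.
Implicit Types F : T -> R[i].

Lemma Re_le_normc (z : R[i]) : `|Re z| <= Normc.normc z.
Proof. by case: z => a b; rewrite /= -sqrtr_sqr ler_wsqrtr// lerDl sqr_ge0. Qed.

Lemma Im_le_normc (z : R[i]) : `|Im z| <= Normc.normc z.
Proof. by case: z => a b; rewrite /= -sqrtr_sqr ler_wsqrtr// lerDr sqr_ge0. Qed.

Lemma normc_le_ReIm (z : R[i]) : Normc.normc z <= `|Re z| + `|Im z|.
Proof.
case: z => a b /=; have h : 0 <= `|a| + `|b| by rewrite addr_ge0.
rewrite -[leRHS](ger0_norm h) -sqrtr_sqr ler_wsqrtr// sqrrD !real_normK ?num_real//.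
by rewrite lerD2r lerDl mulrn_wge0// mulr_ge0.
Qed.

Lemma normc_ge0 (z : R[i]) : 0 <= Normc.normc z.
Proof. exact: le_trans (Re_le_normc z). Qed.

Lemma integrable_normc F : cintegrable nu D F ->
  nu.-integrable D (EFin \o (fun x => Normc.normc (F x))).
Proof.
move=> /cintegrableP[f1 f2].
apply: (@le_integrable _ _ _ _ _ mD _ (fun x => (`|Re (F x)| + `|Im (F x)|)%:E)); first last.
- exact: (integrableDr mD (integrable_normr f1) (integrable_normr f2)).
- move=> x _ /=; rewrite lee_fin ger0_norm ?normc_ge0// ger0_norm ?addr_ge0//.
  exact: normc_le_ReIm.
- have -> : (fun x => Normc.normc (F x)) =
      (fun x => Num.sqrt (Re (F x) ^+ 2 + Im (F x) ^+ 2)).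
    by apply/funext => x; case: (F x).
  apply/measurable_EFinP; apply: measurableT_comp.
    exact: (continuous_measurable_fun (@sqrt_continuous R)).
  by apply: measurable_funD; apply: measurable_funX; apply/measurable_EFinP;
    [exact: measurable_int f1|exact: measurable_int f2].
Qed.

Lemma cnorm1E F : cintegrable nu D F ->
  cnorm1 nu D F = (\int[nu]_(x in D) Normc.normc (F x))%:E.
Proof.
move=> Fi; rewrite /cnorm1 /Rintegral fineK//.
exact: (integrable_fin_num mD (integrable_normc Fi)).
Qed.

Lemma L1norm_Re_le F : cintegrable nu D F ->
  L1norm nu D (fun x => Re (F x)) <= \int[nu]_(x in D) Normc.normc (F x).
Proof.
move=> Fi; have /cintegrableP[f1 _] := Fi; apply: le_Rintegral => //.
- exact: integrable_normr.
- exact: integrable_normc.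
- by move=> x _; exact: Re_le_normc.
Qed.

Lemma L1norm_Im_le F : cintegrable nu D F ->
  L1norm nu D (fun x => Im (F x)) <= \int[nu]_(x in D) Normc.normc (F x).
Proof.
move=> Fi; have /cintegrableP[_ f2] := Fi; apply: le_Rintegral => //.
- exact: integrable_normr.
- exact: integrable_normc.
- by move=> x _; exact: Im_le_normc.
Qed.

Lemma Rintegral_normc_le F : cintegrable nu D F ->
  \int[nu]_(x in D) Normc.normc (F x) <=
  L1norm nu D (fun x => Re (F x)) + L1norm nu D (fun x => Im (F x)).
Proof.
move=> Fi; have /cintegrableP[f1 f2] := Fi.
rewrite -RintegralD//; [|exact: integrable_normr..].
apply: le_Rintegral => //; first exact: integrable_normc.
  by apply: integrableDr => //; exact: integrable_normr.
by move=> x _; exact: normc_le_ReIm.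
Qed.

End ComplexNorm.

(** * The generator on real functions: existence and uniqueness of solutions *)

Section RadialGenerator.
Variables (R : realType) (p : nat) (p_pr : prime p).
Local Notation Qp := (padic p_pr).
Variables (haar : {measure set Qp -> \bar R}) (h_haar : is_haar haar) (N : int).
Implicit Types (x y z : Qp) (f g w : Qp -> R) (n M : nat) (t : R).

Local Notation BN := (padic_ball N : set Qp).
Local Notation integ f := (haar.-integrable BN (EFin \o f)).
Local Notation nrm := (L1norm haar BN).
Local Notation density := (@ball_density R p p_pr N).
Local Notation conv := (kernel_conv haar N).

Variables (mu : R) (mu_gt0 : 0 < mu) (lam : nat -> R).
Hypothesis lam0 : lam 0%N = 0.
Hypothesis lam_nondecreasing : forall n, lam n <= lam n.+1.
Hypothesis lam_pinfty : lam n @[n --> \oo] --> +oo.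
Variables (heat : R -> Qp -> R) (green : Qp -> R).
Hypothesis heatE : forall t y M, 0 < t -> BN y -> ~ padic_ball (N - M%:Z) y ->
  heat t y = \sum_(n < M) (expR (- (t * lam n)) - expR (- (t * lam n.+1))) * density n y.
Hypothesis greenE : forall y M, BN y -> ~ padic_ball (N - M%:Z) y ->
  green y = \sum_(n < M) ((mu + lam n)^-1 - (mu + lam n.+1)^-1) * density n y.

Let mBN : measurable BN. Proof. exact: padic_ball_measurable. Qed.

Definition radial_generator f g := [/\ integ f, integ g & forall e : R, 0 < e ->
  exists2 d : R, 0 < d & forall t, 0 < t -> t < d ->
    nrm (fun x => t^-1 * (f x - conv (heat t) f x) - g x) <= e].

Let heat_mul_measurable t f x : 0 < t -> BN x -> integ f ->
  measurable_fun BN (fun y => heat t (x - y) * f y).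
Proof.
move=> t0 xN fi; exact: (@kernel_mul_measurable R p p_pr haar N
  (fun n => expR (- (t * lam n))) (heat t) (fun y M => @heatE t y M t0) x f xN fi).
Qed.

Lemma semigroup_ae_eq t f g x : 0 < t -> BN x -> integ f -> integ g ->
  ae_eq haar BN f g -> conv (heat t) f x = conv (heat t) g x.
Proof.
move=> t0 xN fi gi fg; rewrite /kernel_conv /Rintegral; congr fine.
apply: ae_eq_integral => //.
- by apply/measurable_EFinP; exact: (heat_mul_measurable t0 xN fi).
- by apply/measurable_EFinP; exact: (heat_mul_measurable t0 xN gi).
- by apply: filterS fg => y fg yN /=; rewrite fg.
Qed.

Lemma generator_dist_integ t f g : 0 < t -> integ f -> integ g ->
  integ (fun x => t^-1 * (f x - conv (heat t) f x) - g x).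
Proof.
move=> t0 fi gi; apply: (integrableBr mBN) => //.
apply: (integrableZlr mBN); apply: (integrableBr mBN) => //.
exact: (semigroup_integ h_haar lam_nondecreasing heatE t0 fi).
Qed.

(** Agreement with the convolution is asked for only almost everywhere: the representation in the
    theorem takes other values where its integral diverges. *)
Lemma resolvent_radial_generator f w : integ f -> integ w -> ae_eq haar BN w (conv green f) ->
  radial_generator w (fun x => f x - mu * w x).
Proof.
move=> fi wi wE; have gi : integ (fun x => f x - mu * w x).
  by apply: (integrableBr mBN) => //; exact: (integrableZlr mBN).
split=> // e e0.
have [d d0 hd] := resolvent_equation h_haar mu_gt0 lam0 lam_nondecreasing lam_pinfty heatE greenE fi e0.
exists d => // t t0 td; apply: le_trans (hd t t0 td).
have ci : integ (conv green f) := resolvent_integ h_haar mu_gt0 lam0 lam_nondecreasing greenE fi.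
rewrite le_eqVlt; apply/orP; left; apply/eqP; apply: (ae_eq_L1norm mBN).
- exact: generator_dist_integ.
- have := generator_dist_integ t0 ci fi.
  move/(integrableDr mBN)/(_ (integrableZlr mBN mu ci)).
  by apply: eq_in_integrable => // x _; ring.
- apply: filterS (wE) => x wxE xN.
  by rewrite -(wxE xN) -(semigroup_ae_eq t0 xN wi ci wE); ring.
Qed.

(** The generator relation is applied to both functions at one common t, and almost everywhere
    linearity reduces the claim to the homogeneous equation for f1 - f2. *)
Lemma radial_generator_injective f1 g1 f2 g2 :
  radial_generator f1 g1 -> radial_generator f2 g2 ->
  ae_eq haar BN (fun x => g1 x + mu * f1 x) (fun x => g2 x + mu * f2 x) ->
  ae_eq haar BN f1 f2.
Proof.
move=> [f1i g1i h1] [f2i g2i h2] gE.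
have Di : integ (fun x => f1 x - f2 x) by exact: (integrableBr mBN).
suff /(L1norm_eq0 mBN Di) : nrm (fun x => f1 x - f2 x) = 0.
  by apply: filterS => x h xN; apply/eqP; rewrite -subr_eq0 h.
apply: (resolvent_injective h_haar mu_gt0 lam0 lam_nondecreasing heatE Di) => e e0.
have e2 : 0 < e / 2 by rewrite divr_gt0.
have [d1 d10 hd1] := h1 _ e2; have [d2 d20 hd2] := h2 _ e2.
set t := Num.min d1 d2 / 2.
have m0 : 0 < Num.min d1 d2 by rewrite lt_min d10.
have t0 : 0 < t by rewrite divr_gt0.
have tm : t < Num.min d1 d2 by rewrite /t ltr_pdivrMr// ltr_pMr// ltr1n.
have [t1 t2] : t < d1 /\ t < d2 by apply/andP; rewrite -lt_min.
exists t => //; rewrite (splitr e).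
apply: le_trans (lerD (hd1 t t0 t1) (hd2 t t0 t2)).
have a1 := generator_dist_integ t0 f1i g1i; have a2 := generator_dist_integ t0 f2i g2i.
apply: le_trans (L1normB mBN a1 a2).
rewrite le_eqVlt; apply/orP; left; apply/eqP; apply: (ae_eq_L1norm mBN).
- have := generator_dist_integ t0 Di (integrableZlr mBN (- mu) Di).
  by apply: eq_in_integrable => // x _; rewrite mulNr opprK.
- exact: (integrableBr mBN).
- have i1 := semigroup_ae_integrable h_haar lam_nondecreasing heatE t0 f1i.
  have i2 := semigroup_ae_integrable h_haar lam_nondecreasing heatE t0 f2i.
  apply: filterS3 gE i1 i2 => x gE i1 i2 xN.
  have -> : conv (heat t) (fun x => f1 x - f2 x) x = conv (heat t) f1 x - conv (heat t) f2 x.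
    rewrite /kernel_conv -RintegralB//; [|exact: i1|exact: i2].
    by apply: eq_Rintegral => y _; rewrite mulrBr.
  have -> : g1 x = g2 x + mu * f2 x - mu * f1 x by rewrite -(gE xN) addrK.
  by ring.
Qed.

End RadialGenerator.

(** * Separating the constant from the kernel of the resolvent *)

Section ShiftedKernel.
Variables (R : realType) (p : nat) (p_pr : prime p).
Local Notation Qp := (padic p_pr).
Variables (haar : {measure set Qp -> \bar R}) (h_haar : is_haar haar) (N : int).
Local Notation BN := (padic_ball N : set Qp).
Local Notation integ f := (haar.-integrable BN (EFin \o f)).
Local Notation conv := (kernel_conv haar N).

Variables (r : nat -> R) (k : Qp -> R) (c : R).
Hypothesis r_ge0 : forall n, 0 <= r n.
Hypothesis r_nonincreasing : forall n, r n.+1 <= r n.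
Let green y := k y + c.
Hypothesis greenE : forall y M, BN y -> ~ padic_ball (N - M%:Z) y ->
  green y = \sum_(n < M) (r n - r n.+1) * ball_density R N n y.
Variable f : Qp -> R.
Hypothesis fi : integ f.

Let mBN : measurable BN. Proof. exact: padic_ball_measurable. Qed.

Let shifted_integrable x : integ (fun y => k (x - y) * f y) <-> integ (fun y => green (x - y) * f y).
Proof.
have cf := integrableZlr mBN c fi; split=> h.
  by apply: eq_in_integrable (integrableDr mBN h cf) => // y _; rewrite mulrDl.
by apply: eq_in_integrable (integrableBr mBN h cf) => // y _; rewrite /green mulrDl addrK.
Qed.

Lemma shifted_kernel_ae_integrable :
  {ae haar, forall x, BN x -> integ (fun y => k (x - y) * f y)}.
Proof.
apply: filterS (kernel_series_lty h_haar r_ge0 r_nonincreasing fi) => x h xN.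
apply/shifted_integrable.
by apply: (kernel_integrableP h_haar r_nonincreasing greenE xN fi).2; exact: h.
Qed.

Definition shifted_conv x := \int[haar]_(y in BN) (k (x - y) * f y) +
  c * \int[haar]_(y in BN) f y.

Let shifted_convE x : integ (fun y => green (x - y) * f y) -> shifted_conv x = conv green f x.
Proof.
move=> h; have h' := (shifted_integrable x).2 h.
rewrite /shifted_conv -RintegralZl// -RintegralD//; last exact: integrableZlr.
by apply: eq_Rintegral => y _; rewrite mulrDl.
Qed.

Let shifted_conv_junk x : BN x -> ~ integ (fun y => green (x - y) * f y) ->
  shifted_conv x = c * \int[haar]_(y in BN) f y.
Proof.
move=> xN h; rewrite /shifted_conv Rintegral_nonintegrable ?add0r//; last by move/shifted_integrable.
have := kernel_mul_measurable greenE xN fi.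
have mf : measurable_fun BN f by apply/measurable_EFinP; exact: measurable_int fi.
move=> /measurable_funB/(_ (measurable_funM (measurable_cst c) mf)).
by apply: eq_measurable_fun => y _; rewrite /green /cst /= mulrDl addrK.
Qed.

Lemma shifted_conv_ae_eq : ae_eq haar BN shifted_conv (conv green f).
Proof.
apply: filterS shifted_kernel_ae_integrable => x h xN.
by apply: shifted_convE; apply/shifted_integrable; exact: h.
Qed.

(** Equality almost everywhere does not by itself give measurability when the measure may be
    incomplete. On the bad set the two expressions take the explicit values c ∫ f and 0, so an
    indicator corrects the difference at every point of B_N. *)
Lemma shifted_conv_integ : integ shifted_conv.
Proof.
pose good := BN `&` [set x | (kernel_series haar N r 0 f x < +oo)%E].
have mgood : measurable good.
  by apply: emeasurable_fun_infty_o => //; exact: kernel_series_measurable.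
have mbad : measurable (~` good) by exact: measurableC.
have := integrableDr mBN (kernel_conv_integ h_haar r_ge0 r_nonincreasing greenE fi)
  (integrableZlr mBN (c * \int[haar]_(y in BN) f y) (indic_integ h_haar N mbad)).
apply: eq_in_integrable => // x xN; rewrite indicE.
have [xg|xg] := pselect (kernel_series haar N r 0 f x < +oo)%E.
  rewrite memNset ?mulr0 ?addr0; last by move=> /(_ (conj xN xg)).
  by rewrite shifted_convE//; apply: (kernel_integrableP h_haar r_nonincreasing greenE xN fi).2.
rewrite mem_set ?mulr1; last by move=> [].
rewrite (kernel_conv_junk h_haar r_nonincreasing greenE)// add0r shifted_conv_junk//.
by move/(kernel_integrableP h_haar r_nonincreasing greenE xN fi).
Qed.

End ShiftedKernel.

Section ResolventOperator.
Variables (R : realType) (p : nat) (p_pr : prime p).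
Local Notation Qp := (padic p_pr).
Variables (haar : {measure set Qp -> \bar R}) (h_haar : is_haar haar) (N : int) (alpha mu : R).
Hypotheses (alpha_gt0 : 0 < alpha) (mu_gt0 : 0 < mu).
Implicit Types (x y : Qp) (u v w : Qp -> R[i]) (t : R).
Local Notation q := (p%:R : R).
Local Notation BN := (padic_ball N : set Qp).
Local Notation integ f := (haar.-integrable BN (EFin \o f)).
Local Notation nrm := (L1norm haar BN).
Local Notation density := (@ball_density R p p_pr N).
Local Notation conv := (kernel_conv haar N).
Local Notation lam := (@symbol R p N alpha).
Local Notation K := (resolvent_kernel haar N alpha mu).
Local Notation Re := (@complex.Re R).
Local Notation Im := (@complex.Im R).

Let mBN : measurable BN. Proof. exact: padic_ball_measurable. Qed.

Let heat t y : R := Re (heat_kernelN haar N alpha t y).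
Let c : R := mu^-1 * q ^ (- N).
Let green y : R := Re (K y) + c.

Let heatE t y M : 0 < t -> BN y -> ~ padic_ball (N - M%:Z) y ->
  heat t y = \sum_(n < M) (expR (- (t * lam n)) - expR (- (t * lam n.+1))) * density n y.
Proof. by move=> t0 yN yM; rewrite /heat (heat_kernelNE h_haar alpha_gt0 t0 yN yM). Qed.

Let greenE y M : BN y -> ~ padic_ball (N - M%:Z) y ->
  green y = \sum_(n < M) ((mu + lam n)^-1 - (mu + lam n.+1)^-1) * density n y.
Proof.
by move=> yN yM; have := resolvent_kernelE h_haar alpha mu yN yM => /(congr1 (@complex.Re R)); rewrite cReD.
Qed.

(** The point y = 0 is not covered by the sum over averages; there the character is 1 and the
    integrand itself is real. Realness on all of B_N lets the complex problem split into two real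
    ones. *)
Let heat_real t y : 0 < t -> BN y -> Im (heat_kernelN haar N alpha t y) = 0.
Proof.
move=> t0 yN; have [->|y0] := eqVneq y 0; last first.
  have [M [_ yM]] := padic_scale yN y0.
  by rewrite (heat_kernelNE h_haar alpha_gt0 t0 yN yM).
rewrite /heat_kernelN /heat_kernel (@eq_cintegral _ _ _ _ _ _
  (fun xi : Qp => (expR (- t * padic_norm xi `^ alpha))%:C%C)); last first.
  by move=> xi _; rewrite mulr0 padic_char_ball0 ?mul1r//; exact: padic_ball_center.
by rewrite cintegral_real -rmorphM -rmorphD.
Qed.

Let semigroup_integrand t u x y : 0 < t -> BN x -> BN y ->
  heat_kernelN haar N alpha t (x - y) * u y =
  (heat t (x - y) * Re (u y) +i* (heat t (x - y) * Im (u y)))%C.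
Proof.
move=> t0 xN yN; have h := heat_real t0 (padic_ballB xN yN).
by apply: complex_eqP; rewrite ?cReM ?cImM h mul0r ?subr0 ?addr0.
Qed.

Let heat_semigroupE t u x : 0 < t -> BN x -> heat_semigroup haar N alpha t u x =
  (conv (heat t) (Re \o u) x +i* conv (heat t) (Im \o u) x)%C.
Proof.
move=> t0 xN; rewrite /heat_semigroup gt_eqF//.
apply: complex_eqP; apply: eq_Rintegral => y; rewrite inE => yN;
  by rewrite semigroup_integrand.
Qed.

Let dist t u v x : R[i] := (t^-1)%:C%C * (u x - heat_semigroup haar N alpha t u x) - v x.

Let Re_dist t u v x : 0 < t -> BN x ->
  Re (dist t u v x) = t^-1 * (Re (u x) - conv (heat t) (Re \o u) x) - Re (v x).
Proof.
by move=> t0 xN; rewrite /dist heat_semigroupE// cReB cReM cReB/= mul0r subr0.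
Qed.

Let Im_dist t u v x : 0 < t -> BN x ->
  Im (dist t u v x) = t^-1 * (Im (u x) - conv (heat t) (Im \o u) x) - Im (v x).
Proof.
by move=> t0 xN; rewrite /dist heat_semigroupE// cImB cImM cImB/= mul0r addr0.
Qed.

Let symbolS := symbol_nondecreasing p_pr N alpha_gt0.
Let symbol_oo := symbol_pinfty p_pr N alpha_gt0.

Let dist_cintegrable t u v : 0 < t -> cintegrable haar BN u -> cintegrable haar BN v ->
  cintegrable haar BN (dist t u v).
Proof.
move=> t0 /cintegrableP[u1 u2] /cintegrableP[v1 v2]; apply/cintegrableP; split.
  apply: eq_in_integrable (generator_dist_integ h_haar symbolS heatE t0 u1 v1) => // x xN.
  by rewrite Re_dist.
apply: eq_in_integrable (generator_dist_integ h_haar symbolS heatE t0 u2 v2) => // x xN.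
by rewrite Im_dist.
Qed.

Let generator := radial_generator haar N heat.

(** With its converse [generator_opA], this reduces the complex operator to two copies of the real
    one, through max(|Re z|, |Im z|) <= |z| <= |Re z| + |Im z|. *)
Let opA_generator u v : opA haar N alpha u v ->
  generator (Re \o u) (Re \o v) /\ generator (Im \o u) (Im \o v).
Proof.
move=> [ui vi /fine_cvgP[_ /cvgrPdist_le uv]].
have /cintegrableP[u1 u2] := ui; have /cintegrableP[v1 v2] := vi.
have small (e : R) : 0 < e -> exists2 d : R, 0 < d & forall t, 0 < t -> t < d ->
    \int[haar]_(x in BN) Normc.normc (dist t u v x) <= e.
  move=> /uv /nbhs_ballP[d /= d0 hd]; exists d => // t t0 td.
  have tball : ball (0 : R) d t by rewrite /ball /= sub0r normrN gtr0_norm.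
  have := hd t tball t0; rewrite sub0r normrN => /(le_trans (ler_norm _)).
  by rewrite -[X in fine X]/(cnorm1 haar BN (dist t u v)) (cnorm1E mBN (dist_cintegrable t0 ui vi)).
split; split=> // e /small[d d0 hd]; exists d => // t t0 td; apply: le_trans (hd t t0 td).
  apply: le_trans (L1norm_Re_le mBN (dist_cintegrable t0 ui vi)).
  by rewrite le_eqVlt; apply/orP; left; apply/eqP; apply: eq_L1norm => x xN; rewrite Re_dist.
apply: le_trans (L1norm_Im_le mBN (dist_cintegrable t0 ui vi)).
by rewrite le_eqVlt; apply/orP; left; apply/eqP; apply: eq_L1norm => x xN; rewrite Im_dist.
Qed.

Let generator_opA u v : generator (Re \o u) (Re \o v) -> generator (Im \o u) (Im \o v) ->
  opA haar N alpha u v.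
Proof.
move=> [u1 v1 h1] [u2 v2 h2].
have ui : cintegrable haar BN u by [].
have vi : cintegrable haar BN v by [].
have dE t : 0 < t -> cnorm1 haar BN (dist t u v) =
    (\int[haar]_(x in BN) Normc.normc (dist t u v x))%:E.
  by move=> t0; apply: cnorm1E => //; exact: dist_cintegrable.
split=> //; apply/fine_cvgP; split.
  apply: filterS (nbhs_right_gt 0) => t t0.
  by rewrite -[X in X \is a fin_num]/(cnorm1 haar BN (dist t u v)) dE.
apply/cvgrPdist_le => e e0; have e2 : 0 < e / 2 by rewrite divr_gt0.
have [d1 d10 hd1] := h1 _ e2; have [d2 d20 hd2] := h2 _ e2.
have near1 := nbhs_right_lt d10; have near2 := nbhs_right_lt d20.
apply: filterS3 (nbhs_right_gt 0) near1 near2 => t t0 t1 t2 /=.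
rewrite sub0r normrN -[X in fine X]/(cnorm1 haar BN (dist t u v)) dE//=.
rewrite ger0_norm; last by apply: Rintegral_ge0 => x _; exact: normc_ge0.
apply: le_trans (Rintegral_normc_le mBN (dist_cintegrable t0 ui vi)) _.
rewrite (splitr e); apply: lerD.
  apply: le_trans (hd1 t t0 t1).
  by rewrite le_eqVlt; apply/orP; left; apply/eqP; apply: eq_L1norm => x xN; rewrite Re_dist.
apply: le_trans (hd2 t t0 t2).
by rewrite le_eqVlt; apply/orP; left; apply/eqP; apply: eq_L1norm => x xN; rewrite Im_dist.
Qed.

Section Solution.
Variable u : Qp -> R[i].
Hypothesis ui : cintegrable haar BN u.

Let r n : R := (mu + lam n)^-1.
Let r_ge0 n : 0 <= r n. Proof. by rewrite ltW// resolvent_weight_gt0. Qed.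
Let rS n : r n.+1 <= r n.
Proof. by rewrite lef_pV2 ?posrE ?ltr_wpDr ?symbol_ge0// lerD2l. Qed.

Let u1 : integ (Re \o u) := proj1 ui.
Let u2 : integ (Im \o u) := proj2 ui.

Let kernelM x xi : K (x - xi) * u xi =
  (Re (K (x - xi)) * Re (u xi) +i* (Re (K (x - xi)) * Im (u xi)))%C.
Proof.
have h := resolvent_kernel_real h_haar N alpha mu (x - xi).
by apply: complex_eqP; rewrite ?cReM ?cImM h mul0r ?subr0 ?addr0.
Qed.

Lemma resolvent_ae_cintegrable :
  {ae haar, forall x, BN x -> cintegrable haar BN (fun xi => K (x - xi) * u xi)}.
Proof.
have h1 := shifted_kernel_ae_integrable h_haar r_ge0 rS greenE u1.
have h2 := shifted_kernel_ae_integrable h_haar r_ge0 rS greenE u2.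
apply: filterS2 h1 h2 => x h1 h2 xN; apply/cintegrableP; split.
  by apply: eq_in_integrable (h1 xN) => // xi _; rewrite kernelM.
by apply: eq_in_integrable (h2 xN) => // xi _; rewrite kernelM.
Qed.

Let w x : R[i] := cintegral haar BN (fun xi => K (x - xi) * u xi) +
  c%:C%C * cintegral haar BN u.

Let wE x : w x = (shifted_conv haar N (fun y => Re (K y)) c (Re \o u) x +i*
  shifted_conv haar N (fun y => Re (K y)) c (Im \o u) x)%C.
Proof.
apply: complex_eqP; rewrite /w ?cReD ?cImD ?cReM ?cImM/= mul0r ?subr0 ?addr0;
  by congr (_ + _); apply: eq_Rintegral => xi _; rewrite kernelM.
Qed.

Lemma resolvent_kernel_is_resolvent : is_resolvent haar BN (opA haar N alpha) mu u w.
Proof.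
(* The only possible value of A w; with it the equation v + mu w = u holds at every point, and what
   remains is that (w, v) is in the graph. *)
pose v x := u x - mu%:C%C * w x.
have ReBZ (a z : R[i]) : Re (a - mu%:C%C * z) = Re a - mu * Re z.
  by rewrite cReB cReM/= mul0r subr0.
have ImBZ (a z : R[i]) : Im (a - mu%:C%C * z) = Im a - mu * Im z.
  by rewrite cImB cImM/= mul0r addr0.
have ReDZ (a z : R[i]) : Re (a + mu%:C%C * z) = Re a + mu * Re z.
  by rewrite cReD cReM/= mul0r subr0.
have ImDZ (a z : R[i]) : Im (a + mu%:C%C * z) = Im a + mu * Im z.
  by rewrite cImD cImM/= mul0r addr0.
have Rew : Re \o w = shifted_conv haar N (fun y => Re (K y)) c (Re \o u).
  by apply/funext => x; exact: (congr1 (@complex.Re R) (wE x)).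
have Imw : Im \o w = shifted_conv haar N (fun y => Re (K y)) c (Im \o u).
  by apply/funext => x; exact: (congr1 (@complex.Im R) (wE x)).
have wv : opA haar N alpha w v.
  apply: generator_opA.
  - have -> : Re \o v = (fun x => (Re \o u) x - mu * (Re \o w) x).
      by apply/funext => x; exact: ReBZ.
    apply: (resolvent_radial_generator h_haar mu_gt0 _ symbolS symbol_oo heatE greenE u1) => //.
      by rewrite Rew; exact: (shifted_conv_integ h_haar r_ge0 rS greenE u1).
    by rewrite Rew; exact: (shifted_conv_ae_eq h_haar r_ge0 rS greenE u1).
  - have -> : Im \o v = (fun x => (Im \o u) x - mu * (Im \o w) x).
      by apply/funext => x; exact: ImBZ.
    apply: (resolvent_radial_generator h_haar mu_gt0 _ symbolS symbol_oo heatE greenE u2) => //.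
      by rewrite Imw; exact: (shifted_conv_integ h_haar r_ge0 rS greenE u2).
    by rewrite Imw; exact: (shifted_conv_ae_eq h_haar r_ge0 rS greenE u2).
have wu : ae_eq haar BN (fun x => v x + mu%:C%C * w x) u.
  by apply: nearW => x _; rewrite /v subrK.
split; first by exists v.
move=> w' [v' [/opA_generator[g1' g2'] w'u]].
have [g1 g2] := opA_generator wv.
have e1 : ae_eq haar BN (Re \o w') (Re \o w).
  apply: (radial_generator_injective h_haar mu_gt0 _ symbolS heatE g1' g1) => //.
  apply: filterS2 w'u wu => x h1 h2 xN.
  have := etrans (h1 xN) (esym (h2 xN)) => /(congr1 (@complex.Re R)).
  by rewrite !ReDZ.
have e2 : ae_eq haar BN (Im \o w') (Im \o w).
  apply: (radial_generator_injective h_haar mu_gt0 _ symbolS heatE g2' g2) => //.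
  apply: filterS2 w'u wu => x h1 h2 xN.
  have := etrans (h1 xN) (esym (h2 xN)) => /(congr1 (@complex.Im R)).
  by rewrite !ImDZ.
by apply: filterS2 e1 e2 => x h1 h2 xN; apply: complex_eqP; [exact: h1|exact: h2].
Qed.

End Solution.
End ResolventOperator.

Theorem theorem2 (R : realType) (p : nat) (p_pr : prime p)
    (haar : {measure set (padic p_pr) -> \bar R}) (h_haar : is_haar haar)
    (N : int) (alpha mu : R) (alpha_gt0 : 0 < alpha) (mu_gt0 : 0 < mu) :
  let BN : set (padic p_pr) := padic_ball N in
  let A := opA haar N alpha in
  let K := resolvent_kernel haar N alpha mu in
  [/\ (forall u : padic p_pr -> R[i], cintegrable haar BN u ->
        (\forall x \ae haar, BN x ->
           cintegrable haar BN (fun xi => K (x - xi) * u xi)) /\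
        is_resolvent haar BN A mu u (fun x =>
          cintegral haar BN (fun xi => K (x - xi) * u xi) +
          (mu^-1 * p%:R ^ (- N))%:C%C * cintegral haar BN u)),
      (1 < alpha -> forall x, BN x ->
        let f := resolvent_integrand N alpha mu x in
        let D : set (padic p_pr) := padic_co_ball (1 - N) in
        cintegrable haar D f /\ K x = cintegral haar D f),
      {within BN `\ 0, continuous (K : padic p_pr -> R[i]^o)} /\
        cintegrable haar BN K &
      [/\ (1 < alpha -> {within BN, continuous (K : padic p_pr -> R[i]^o)}),
          (alpha = 1 -> exists2 C : R, 0 < C &
             forall x, BN x -> x != 0 -> (padic_norm x : R) != 1 ->
               Normc.normc (K x) <= C * `|ln (padic_norm x)|) &
          (alpha < 1 -> exists2 C : R, 0 < C &
             forall x, BN x -> x != 0 ->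
               Normc.normc (K x) <= C * padic_norm x `^ (alpha - 1))]].
Proof.
split.
- move=> u ui; split; first exact: resolvent_ae_cintegrable.
  exact: resolvent_kernel_is_resolvent.
- move=> alpha1 x xN; split; first exact: resolvent_integrand_cintegrable.
  exact: resolvent_kernel_co_ball.
- split; first exact: resolvent_kernel_continuous.
  exact: resolvent_kernel_cintegrable.
- split.
  + exact: resolvent_kernel_continuous0.
  + exact: resolvent_kernel_log.
  + exact: resolvent_kernel_powR.
Qed.
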